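(* Let $A$ be a universal $\mathrm{GE}_2$-ring with $\mu_2(A)=\{\pm1\}$ such that the inclusion $T(A)\hookrightarrow B(A)$ induces isomorphisms $H_i(T(A),\mathbb{Z})\simeq H_i(B(A),\mathbb{Z})$ for $i\leq 3$. Then there is an exact sequence $$I(A)\otimes \mu_2(A) \to H_3(\mathrm{SL}_2(A), \mathrm{SM}_2(A); \mathbb{Z}) \to \frac{\mathcal{RP}_1(A)}{\langle \psi_1(a^2):a\in A^\times\rangle} \to 0.$$ In particular, if $-1\in (A^\times)^2$, then $H_3(\mathrm{SL}_2(A),\mathrm{SM}_2(A);\mathbb{Z})\simeq \mathcal{RP}_1(A)$.
   Context: Rings are commutative with $1$. $A^\times$ is the unit group, $\mu_2(A)=\{a\in A^\times: a^2=1\}$, $\mathcal{G}_A=A^\times/(A^\times)^2$, $\langle a\rangle$ is the class of $a\in A^\times$ in $\mathcal{G}_A$. $T(A)$ is the group of diagonal matrices in $\mathrm{SL}_2(A)$, $B(A)$ the group of upper triangular matrices in $\mathrm{SL}_2(A)$, and $\mathrm{SM}_2(A)$ the group of monomial matrices in $\mathrm{SL}_2(A)$, i.e. the matrices $\begin{pmatrix} a&0\\0&a^{-1}\end{pmatrix}$ and $\begin{pmatrix}0&a\\-a^{-1}&0\end{pmatrix}$, $a\in A^\times$. For a subgroup $G'\le G$, $H_n(G,G';\mathbb{Z})$ is the usual relative homology (homology of $C_\bullet(G)_G/C_\bullet(G')_{G'}$ with $C_\bullet$ the standard resolution). Universal $\mathrm{GE}_2$-ring: for $x\in A$ let $E(x)=\begin{pmatrix}x&1\\-1&0\end{pmatrix}$,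 and for $a\in A^\times$ let $D(a)=E(-a)E(-a^{-1})E(-a)=\mathrm{diag}(a,a^{-1})$. $A$ is a $\mathrm{GE}_2$-ring if $\mathrm{SL}_2(A)$ is generated by elementary matrices (equivalently by the $E(x)$). It is a universal $\mathrm{GE}_2$-ring if $\mathrm{SL}_2(A)$ is generated by the $E(x)$, $x\in A$, with the following complete set of defining relations ($x,y\in A$, $a,b\in A^\times$): $E(x)E(0)E(y)=D(-1)E(x+y)$; $E(x)D(a)=D(a^{-1})E(a^2x)$; $D(a)D(b)=D(ab)$, where $D(a):=E(-a)E(-a^{-1})E(-a)$. A column vector $u\in A^2$ is unimodular if it is the first column of some matrix in $\mathrm{GL}_2(A)$; $\langle u\rangle=uA$. $X_n(A^2)$ is the free abelian group on all $(n+1)$-tuples $(\langle v_0\rangle,\dots,\langle v_n\rangle)$ with every $v_i$ unimodular and the matrix $(v_i,v_j)$ invertible for $i\neq j$; $\mathrm{GL}_2(A)$ acts by left multiplication. $\partial_n:X_n(A^2)\to X_{n-1}(A^2)$ is the alternating sum of the maps omitting the $i$-th entry. $Z_i(A^2)=\ker\partial_i$ for $i=1,2$. Put $\pmb\infty=\langle e_1\rangle$, $\pmb 0=\langle e_2\rangle$, $\pmb a=\langle e_1+ae_2\rangle$ for $a\in A^\times$. $X_2(A^2)_{\mathrm{SL}_2(A)}$ is identified with $\mathbb{Z}[\mathcal{G}_A]$ by $(\pmb\infty,\pmb 0,\pmb a)\leftrightarrow\langle a\rangle$. $\mathcal{RP}(A)=H_0(\mathrm{SL}_2(A),Z_2(A^2))$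 and $\mathcal{RP}_1(A)=\ker(\mathcal{RP}(A)\to\mathbb{Z}[\mathcal{G}_A])$, the map being induced by the inclusion $Z_2(A^2)\subseteq X_2(A^2)$ (refined scissors congruence group). For $a\in A^\times$, $\psi_1(a)\in\mathcal{RP}(A)$ is the class of $(\pmb\infty,\pmb0,\pmb a)+(\pmb0,\pmb\infty,\pmb a)-(\pmb\infty,\pmb0,\pmb1)-(\pmb0,\pmb\infty,\pmb1)$; the elements $\psi_1(a^2)$ lie in $\mathcal{RP}_1(A)$. $\mathrm{GW}(A)=H_0(\mathrm{SL}_2(A),Z_1(A^2))$, and the fundamental ideal $I(A)$ is the kernel of the map $\mathrm{GW}(A)\to H_0(\mathrm{SL}_2(A),X_1(A^2))\simeq\mathbb{Z}$ induced by the inclusion $Z_1(A^2)\subseteq X_1(A^2)$. *)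

(* Defs.v *)
From HB Require Import structures.
From mathcomp Require Import all_boot all_order all_algebra.
From mathcomp Require Import boolp classical_sets.
From mathcomp.multinomials Require Import freeg.

Set Implicit Arguments.
Unset Strict Implicit.
Unset Printing Implicit Defensive.

Import GRing.Theory.

Local Open Scope ring_scope.
Local Open Scope quotient_scope.

Definition kerp (U V : zmodType) (f : {additive U -> V}) : {pred U} :=
  fun x => f x == 0.

Lemma kerp_closed (U V : zmodType) (f : {additive U -> V}) :
  zmod_closed (kerp f).
Proof.
split=> [|x y]; rewrite !unfold_in /kerp ?raddf0 //.
by move=> /eqP fx /eqP fy; rewrite raddfB fx fy subr0.
Qed.
HB.instance Definition _ (U V : zmodType) (f : {additive U -> V}) :=
  GRing.isZmodClosed.Build U (kerp f) (kerp_closed f).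

Record ker (U V : zmodType) (f : {additive U -> V}) := Ker {
  ker_val :> U; _ : ker_val \in kerp f }.
HB.instance Definition _ (U V : zmodType) (f : {additive U -> V}) :=
  [isSub for @ker_val U V f].
HB.instance Definition _ (U V : zmodType) (f : {additive U -> V}) :=
  [Choice of ker f by <:].
HB.instance Definition _ (U V : zmodType) (f : {additive U -> V}) :=
  [SubChoice_isSubZmodule of ker f by <:].

(* The subgroup generated by S: the intersection of the subgroups containing S. *)
Definition spanp (V : zmodType) (S : set V) : {pred V} :=
  fun x => `[< forall P : {pred V}, zmod_closed P ->
                 (forall y, S y -> y \in P) -> x \in P >].

Lemma spanp_closed (V : zmodType) (S : set V) : zmod_closed (spanp S).
Proof.
split=> [|x y]; rewrite !unfold_in; first by apply/asboolP => P [].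
move=> /asboolP Sx /asboolP Sy; apply/asboolP => P cP SP.
by have [_ PB] := cP; apply: PB; [apply: Sx | apply: Sy].
Qed.
HB.instance Definition _ (V : zmodType) (S : set V) :=
  GRing.isZmodClosed.Build V (spanp S) (spanp_closed S).

Lemma mem_spanp (V : zmodType) (S : set V) x : S x -> x \in spanp S.
Proof. by move=> Sx; rewrite unfold_in; apply/asboolP => P _; apply. Qed.

Definition quo (V : zmodType) (S : set V) := Quotient.quot (spanp S).
HB.instance Definition _ (V : zmodType) (S : set V) :=
  GRing.Zmodule.on (quo S).

Definition quo_pi (V : zmodType) (S : set V) (x : V) : quo S :=
  \pi_(Quotient.quot (spanp S)) x.

Lemma quo_pi_is_additive (V : zmodType) (S : set V) :
  zmod_morphism (@quo_pi V S).
Proof. by move=> x y; rewrite /quo_pi raddfB. Qed.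
HB.instance Definition _ (V : zmodType) (S : set V) :=
  GRing.isZmodMorphism.Build V (quo S) (@quo_pi V S)
    (@quo_pi_is_additive V S).

Lemma quo_pi_eq (V : zmodType) (S : set V) (x y : V) :
  x - y \in spanp S -> quo_pi S x = quo_pi S y.
Proof. by rewrite Quotient.idealrBE => /eqP. Qed.

Lemma quo_piK (V : zmodType) (S : set V) (x : quo S) :
  quo_pi S (repr (x : Quotient.quot (spanp S))) = x.
Proof. exact: reprK. Qed.

Lemma quo_pi_repr (V : zmodType) (S : set V) (x : V) :
  repr (quo_pi S x : Quotient.quot (spanp S)) - x \in spanp S.
Proof. by rewrite Quotient.idealrBE reprK. Qed.

Lemma spanp_map (V W : zmodType) (S : set V) (T : set W)
    (f : {additive V -> W}) (fST : forall x, S x -> f x \in spanp T) x :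
  x \in spanp S -> f x \in spanp T.
Proof.
rewrite unfold_in => /asboolP Sx.
apply: (Sx (fun y => f y \in spanp T)) => //; split=> [|y z].
  by rewrite -[_ \in _]/(f 0 \in spanp T) raddf0 rpred0.
rewrite -[y \in _]/(f y \in spanp T) -[z \in _]/(f z \in spanp T) => fy fz.
by rewrite -[_ \in _]/(f (y - z) \in spanp T) raddfB rpredB.
Qed.

(* Defined through a representative; quo_map_pi shows that it is the map
   V/<S> -> W/<T> induced by f. *)
Definition quo_map (V W : zmodType) (S : set V) (T : set W)
    (f : {additive V -> W}) (fST : forall x, S x -> f x \in spanp T)
    (x : quo S) : quo T :=
  quo_pi T (f (repr (x : Quotient.quot (spanp S)))).

Section QuoMap.
Variables (V W : zmodType) (S : set V) (T : set W) (f : {additive V -> W}).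
Hypothesis fST : forall x, S x -> f x \in spanp T.

Lemma quo_map_pi x : quo_map fST (quo_pi S x) = quo_pi T (f x).
Proof.
by apply: quo_pi_eq; rewrite -raddfB; apply: (spanp_map fST); apply: quo_pi_repr.
Qed.

Lemma quo_map_is_additive : zmod_morphism (quo_map fST).
Proof.
move=> x y; rewrite -[x]quo_piK -[y]quo_piK -raddfB !quo_map_pi.
by rewrite !raddfB.
Qed.
HB.instance Definition _ :=
  GRing.isZmodMorphism.Build (quo S) (quo T) (quo_map fST) quo_map_is_additive.

End QuoMap.

Definition tensor_rel (U V : zmodType) : set {freeg (U * V)} :=
  [set t | (exists x y z, t = << (x + y, z) >> - << (x, z) >> - << (y, z) >>)
        \/ (exists x y z, t = << (x, y + z) >> - << (x, y) >> - << (x, z) >>)].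

Definition tensor (U V : zmodType) := quo (@tensor_rel U V).
HB.instance Definition _ (U V : zmodType) := GRing.Zmodule.on (tensor U V).

Record complex := Complex {
  chain :> nat -> zmodType;
  bd : forall n, {additive chain n.+1 -> chain n};
  bdK : forall n x, bd n (bd n.+1 x) = 0 }.
Arguments bd C n : rename.

Record chain_map (C D : complex) := ChainMap {
  cmap :> forall n, {additive C n -> D n};
  cmapE : forall n x, cmap n (bd C n x) = bd D n (cmap n.+1 x) }.

Definition cyclep (C : complex) (n : nat) : {pred C n} :=
  match n with
  | 0 => xpredT
  | m.+1 => fun x : C m.+1 => bd C m x == 0
  end.

Lemma cyclep_closed (C : complex) n : zmod_closed (@cyclep C n).
Proof. by case: n => [|n]; [split | apply: kerp_closed]. Qed.
HB.instance Definition _ (C : complex) n :=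
  GRing.isZmodClosed.Build (C n) (@cyclep C n) (cyclep_closed C n).

Record cycles (C : complex) (n : nat) := Cycle {
  cycle_val :> C n; _ : cycle_val \in @cyclep C n }.
HB.instance Definition _ (C : complex) n := [isSub for @cycle_val C n].
HB.instance Definition _ (C : complex) n := [Choice of cycles C n by <:].
HB.instance Definition _ (C : complex) n :=
  [SubChoice_isSubZmodule of cycles C n by <:].

Definition boundaries (C : complex) (n : nat) : set (cycles C n) :=
  [set z | exists y, val z = bd C n y].

Definition homology (C : complex) (n : nat) := quo (@boundaries C n).
HB.instance Definition _ (C : complex) n := GRing.Zmodule.on (homology C n).

Section ChainMaps.
Variables (C D : complex) (f : chain_map C D).

Lemma cycle_map_subproof n (z : cycles C n) : f n (val z) \in @cyclep D n.
Proof.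
case: n z => [|n] [z] //=; rewrite !unfold_in /= => /eqP z0.
by rewrite -cmapE z0 raddf0.
Qed.

Definition cycle_map n (z : cycles C n) : cycles D n :=
  Cycle (cycle_map_subproof z).

Lemma cycle_map_is_additive n : zmod_morphism (@cycle_map n).
Proof. by move=> x y; apply: val_inj; rewrite /= raddfB. Qed.
HB.instance Definition _ n :=
  GRing.isZmodMorphism.Build (cycles C n) (cycles D n) (@cycle_map n)
    (@cycle_map_is_additive n).

Lemma homology_map_subproof n z :
  @boundaries C n z -> cycle_map z \in spanp (@boundaries D n).
Proof. by move=> [y zy]; apply: mem_spanp; exists (f n.+1 y); rewrite /= zy cmapE. Qed.

Definition homology_map n : {additive homology C n -> homology D n} :=
  quo_map (@homology_map_subproof n).

Definition image_rel n : set (D n) := [set x | exists y, x = f n y].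

Definition coker_chain n := quo (@image_rel n).

Lemma coker_bd_subproof n x :
  @image_rel n.+1 x -> bd D n x \in spanp (@image_rel n).
Proof. by move=> [y ->]; apply: mem_spanp; exists (bd C n y); rewrite cmapE. Qed.

Definition coker_bd n : {additive coker_chain n.+1 -> coker_chain n} :=
  quo_map (@coker_bd_subproof n).

Lemma coker_bdK n x : coker_bd n (coker_bd n.+1 x) = 0.
Proof. by rewrite -[x]quo_piK /coker_bd /= !quo_map_pi bdK raddf0. Qed.

Definition coker_complex : complex := Complex coker_bdK.

End ChainMaps.

(* H_0(G, M), computed as the coinvariants M_G = M / <g m - m>. *)
Definition coinv_rel (G : Type) (M : zmodType) (act : G -> {additive M -> M}) :
    set M :=
  [set m' | exists g m, m' = act g m - m].

Definition coinv (G : Type) (M : zmodType) (act : G -> {additive M -> M}) :=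
  quo (coinv_rel act).
HB.instance Definition _ (G : Type) (M : zmodType)
    (act : G -> {additive M -> M}) := GRing.Zmodule.on (coinv act).

Section CoinvMap.
Variables (G H : Type) (M N : zmodType).
Variables (actM : G -> {additive M -> M}) (actN : H -> {additive N -> N}).
Variables (phi : G -> H) (f : {additive M -> N}).
Hypothesis fE : forall g m, f (actM g m) = actN (phi g) (f m).

Lemma coinv_map_subproof x : coinv_rel actM x -> f x \in spanp (coinv_rel actN).
Proof.
by move=> [g [m ->]]; apply: mem_spanp; exists (phi g), (f m); rewrite raddfB fE.
Qed.

Definition coinv_map : {additive coinv actM -> coinv actN} :=
  quo_map coinv_map_subproof.

End CoinvMap.

Section CoinvComplex.
Variables (G : Type) (C : complex) (act : G -> chain_map C C).

Definition coinv_bd n :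
    {additive coinv (fun g => act g n.+1) -> coinv (fun g => act g n)} :=
  coinv_map (phi := id) (f := bd C n) (fun g m => esym (cmapE (act g) m)).

Lemma coinv_bdK n x : coinv_bd n (coinv_bd n.+1 x) = 0.
Proof. by rewrite -[x]quo_piK /coinv_bd /= !quo_map_pi bdK raddf0. Qed.

Definition coinv_complex : complex := Complex coinv_bdK.

End CoinvComplex.

Record semi_simplicial := SemiSimplicial {
  simplex :> nat -> choiceType;
  face : forall n, 'I_n.+2 -> simplex n.+1 -> simplex n;
  faceK : forall n (i j : nat) s, (i <= j < n.+2)%N ->
    @face n (inord j) (face (inord i) s) =
    @face n (inord i) (face (inord j.+1) s) }.
Arguments face K {n} : rename.

Record simplicial_map (K L : semi_simplicial) := SimplicialMap {
  smap :> forall n, K n -> L n;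
  smapE : forall n i (s : K n.+1), smap (face K i s) = face L i (smap s) }.

Lemma freeg_additive_eq (K : choiceType) (V : zmodType)
    (f g : {additive {freeg K} -> V}) :
  (forall k, f << k >> = g << k >>) -> f =1 g.
Proof.
move=> fg x; rewrite -[x]freeg_sumE !raddf_sum; apply: eq_bigr => k _.
by rewrite -[coeff k x]intz -freegU_mulz !raddfMz fg.
Qed.

Lemma fglift_is_additive (K : choiceType) (M : lmodType int) (f : K -> M) :
  zmod_morphism (fglift f : {freeg K} -> M).
Proof. exact: lift_is_additive. Qed.
HB.instance Definition _ (K : choiceType) (M : lmodType int) (f : K -> M) :=
  GRing.isZmodMorphism.Build {freeg K} M (fglift f) (fglift_is_additive f).

Definition freeg_map (K L : choiceType) (f : K -> L) :
    {additive {freeg K} -> {freeg L}} :=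
  fglift (fun k => << f k >> : {freeg L}).

Lemma freeg_mapU (K L : choiceType) (f : K -> L) k :
  freeg_map f << k >> = << f k >>.
Proof. by rewrite /freeg_map /= liftU scale1r. Qed.

Section Chains.
Variable K : semi_simplicial.

Definition alt_bd n : {additive {freeg (K n.+1)} -> {freeg (K n)}} :=
  fglift (fun s => \sum_(i < n.+2) (-1) ^+ i *: << face K i s >> : {freeg (K n)}).

Lemma alt_bdU n s :
  alt_bd n << s >> = \sum_(i < n.+2) (-1) ^+ i *: << face K i s >>.
Proof. by rewrite /alt_bd /= liftU scale1r. Qed.

Lemma alt_bdK n x : alt_bd n (alt_bd n.+1 x) = 0.
Proof.
pose f : {additive _ -> _} := alt_bd n \o alt_bd n.+1.
rewrite -[LHS]/(f x); have -> // : f =1 \0; apply: freeg_additive_eq => s.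
rewrite /f /= alt_bdU raddf_sum /=.
pose F i j : {freeg (K n)} :=
  (-1) ^+ (i + j) *: << face K (inord j) (face K (inord i) s) >>.
transitivity (\sum_(0 <= i < n.+3) \sum_(0 <= j < n.+2) F i j).
  rewrite big_mkord; apply: eq_bigr => i _.
  rewrite raddfZsign /= alt_bdU scaler_sumr big_mkord; apply: eq_bigr => j _.
  by rewrite /F !inord_val scalerA exprD.
transitivity (\sum_(0 <= j < n.+2) \sum_(0 <= i < n.+2)
   if (i <= j)%N then F i j + F j.+1 i else 0).
  under eq_bigr => i _ do rewrite (bigID (fun j => (i <= j)%N)) /=.
  rewrite big_split /=; under [RHS]eq_bigr => j _.
    rewrite -big_mkcond big_split /=; over.
  rewrite [RHS]big_split /=; congr (_ + _).
    have -> : \sum_(0 <= i < n.+3) \sum_(0 <= j < n.+2 | (i <= j)%N) F i j =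
              \sum_(0 <= i < n.+2) \sum_(0 <= j < n.+2 | (i <= j)%N) F i j.
      rewrite big_nat_recr //= [X in _ + X]big_nat_cond.
      rewrite [X in _ + X]big_pred0 ?addr0 // => j.
      by rewrite ltnNge andNb.
    rewrite [RHS](eq_bigr (fun j => \sum_(0 <= i < n.+2 | (i <= j)%N) F i j)) //.
    under eq_bigr => i _ do rewrite big_mkcond.
    rewrite exchange_big /=; apply: eq_bigr => j _.
    by rewrite big_mkcond.
  rewrite big_nat_recl //= [X in X + _]big1 ?add0r //.
  by apply: eq_bigr => j _; apply: eq_bigl => i; rewrite -ltnNge ltnS.
rewrite big_nat big1 // => j /= jn; rewrite big1 // => i _.
case: ifP => // ij; rewrite /F faceK ?ij //.
by rewrite addnC addSn exprS -scalerA scaleN1r subrr.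
Qed.

Definition free_complex : complex := Complex alt_bdK.

End Chains.

Lemma free_map_subproof (K L : semi_simplicial) (f : simplicial_map K L) n
    (x : free_complex K n.+1) :
  freeg_map (f n) (bd (free_complex K) n x) =
  bd (free_complex L) n (freeg_map (f n.+1) x).
Proof.
pose g : {additive _ -> _} := freeg_map (f n) \o alt_bd K n.
pose h : {additive _ -> _} := alt_bd L n \o freeg_map (f n.+1).
rewrite -[LHS]/(g x) -[RHS]/(h x); move: x; apply: freeg_additive_eq => s.
rewrite /g /h /= freeg_mapU !alt_bdU raddf_sum; apply: eq_bigr => i _.
by rewrite raddfZsign freeg_mapU smapE.
Qed.

Definition free_map (K L : semi_simplicial) (f : simplicial_map K L) :
    chain_map (free_complex K) (free_complex L) :=
  @ChainMap (free_complex K) (free_complex L) (fun n => freeg_map (f n))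
    (free_map_subproof f).

Definition omit (T : Type) n (i : 'I_n.+2) (t : n.+2.-tuple T) : n.+1.-tuple T :=
  [tuple tnth t (fintype.lift i j) | j < n.+1].

Lemma omitK (T : Type) n i j (t : n.+3.-tuple T) : (i <= j < n.+2)%N ->
  omit (inord j : 'I_n.+2) (omit (inord i) t) =
  omit (inord i) (omit (inord j.+1) t).
Proof.
case/andP=> ij jn; apply: eq_from_tnth => k; rewrite !tnth_mktuple.
have iN : (i < n.+2)%N := leq_ltn_trans ij jn.
congr (tnth t _); apply: val_inj; rewrite /= !inordK ?ltnS // ?(ltnW iN) //.
rewrite /bump; case: (leqP j k) => jk.
  by rewrite (leq_trans ij jk) /= !add1n ltnS jk /= add1n (leq_trans ij (leqW jk)).
rewrite !add0n; case: (leqP i k) => ik; rewrite /= ?add1n ?add0n ?ltnS.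
  by rewrite leqNgt jk.
by rewrite leqNgt ltnW.
Qed.

Lemma omit_map (T U : Type) (f : T -> U) n i (t : n.+2.-tuple T) :
  map_tuple f (omit i t) = omit i (map_tuple f t).
Proof. by apply: eq_from_tnth => j; rewrite !(tnth_map, tnth_mktuple). Qed.

(* C_n(G) is free on (n+1)-tuples of elements of G, the boundary is the
   alternating sum of the omissions of an entry, and G acts diagonally by left
   multiplication. *)
Definition std_simplicial (G : choiceType) : semi_simplicial :=
  @SemiSimplicial (fun n => n.+1.-tuple G) (@omit G) (@omitK G).

Definition std_resolution (G : choiceType) : complex :=
  free_complex (std_simplicial G).

Definition std_simplicial_map (G H : choiceType) (f : G -> H) :
    simplicial_map (std_simplicial G) (std_simplicial H) :=
  @SimplicialMap (std_simplicial G) (std_simplicial H)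
    (fun n => @map_tuple n.+1 G H f) (@omit_map G H f).

Definition std_map (G H : choiceType) (f : G -> H) :
    chain_map (std_resolution G) (std_resolution H) :=
  free_map (std_simplicial_map f).

Definition group_complex (G : groupType) : complex :=
  coinv_complex (fun g : G => std_map (fun h => (g * h)%g)).

Section GroupMap.
Variables (G H : groupType) (f : {multiplicative G -> H}).

Lemma group_map_subproof n (g : G) (x : std_resolution G n) :
  std_map f n (std_map (fun h => (g * h)%g) n x) =
  std_map (fun h => (f g * h)%g) n (std_map f n x).
Proof.
pose u : {additive _ -> _} := std_map f n \o std_map (fun h => (g * h)%g) n.
pose v : {additive _ -> _} := std_map (fun h => (f g * h)%g) n \o std_map f n.
rewrite -[LHS]/(u x) -[RHS]/(v x); move: x; apply: freeg_additive_eq => s.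
rewrite /u /v /= !freeg_mapU; congr << _ >>; apply: eq_from_tnth => i.
by rewrite !tnth_map gmulfM.
Qed.

Definition group_map_chain n :
    {additive group_complex G n -> group_complex H n} :=
  coinv_map (phi := f) (@group_map_subproof n).

Lemma group_map_chainE n x :
  group_map_chain n (bd (group_complex G) n x) =
  bd (group_complex H) n (group_map_chain n.+1 x).
Proof.
rewrite -[x]quo_piK /group_map_chain /= /coinv_bd /coinv_map /= !quo_map_pi.
by rewrite (cmapE (std_map f)).
Qed.

Definition group_map : chain_map (group_complex G) (group_complex H) :=
  ChainMap group_map_chainE.

End GroupMap.

Definition group_homology (G : groupType) (n : nat) :=
  homology (group_complex G) n.
HB.instance Definition _ (G : groupType) n := GRing.Zmodule.on (group_homology G n).

Definition group_homology_map (G H : groupType) (f : {multiplicative G -> H}) n :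
    {additive group_homology G n -> group_homology H n} :=
  homology_map (group_map f) n.

(* For f the inclusion of a subgroup, group_map f is injective in each degree
   and its cokernel is C(G)_G / C(G')_G', whose homology is H_n(G, G'; Z). *)
Definition rel_group_homology (G' G : groupType) (f : {multiplicative G' -> G})
    (n : nat) :=
  homology (coker_complex (group_map f)) n.
HB.instance Definition _ (G' G : groupType) (f : {multiplicative G' -> G}) n :=
  GRing.Zmodule.on (rel_group_homology f n).

Section Matrices2.
Variable A : comPzRingType.
Implicit Types (a b c d : A) (M N : 'M[A]_2).

Definition mx2 a b c d : 'M[A]_2 :=
  \matrix_(i, j) if i == 0 then if j == 0 then a else b
                 else if j == 0 then c else d.

Lemma ord2P (P : 'I_2 -> Prop) : P 0 -> P 1 -> forall i, P i.
Proof.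
by move=> P0 P1 [[|[|//]] hi]; [move: P0 | move: P1]; congr P; apply: val_inj.
Qed.

Lemma eq_mx2 M N : M 0 0 = N 0 0 -> M 0 1 = N 0 1 -> M 1 0 = N 1 0 ->
  M 1 1 = N 1 1 -> M = N.
Proof.
move=> e00 e01 e10 e11; apply/matrixP.
by elim/ord2P; elim/ord2P.
Qed.

Lemma mulmx2E M N i j : (M *m N) i j = M i 0 * N 0 j + M i 1 * N 1 j.
Proof.
rewrite !mxE !big_ord_recl big_ord0 addr0.
by congr (M i _ * N _ j + M i _ * N _ j); apply: val_inj.
Qed.

Lemma det_mx2E M : \det M = M 0 0 * M 1 1 - M 0 1 * M 1 0.
Proof.
rewrite (expand_det_row _ 0) !big_ord_recl big_ord0 addr0 /cofactor !det_mx11.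
rewrite !mxE /= addn0 expr0 mul1r expr1 mulN1r mulrN.
by congr (_ * M _ _ - M _ _ * M _ _); apply: val_inj.
Qed.

Definition adj2 M := mx2 (M 1 1) (- M 0 1) (- M 1 0) (M 0 0).

Lemma mul_adj2 M : adj2 M *m M = (\det M)%:M.
Proof.
rewrite det_mx2E; apply: eq_mx2; rewrite mulmx2E !mxE /= ?mulr1n ?mulr0n.
- by rewrite mulNr mulrC.
- by rewrite mulNr [X in _ - X]mulrC subrr.
- by rewrite mulNr [_ * M 0 0]mulrC addNr.
- by rewrite mulNr addrC [M 1 0 * _]mulrC.
Qed.

End Matrices2.

Record SL2 (A : comPzRingType) := SL2Mx {
  SL2_val :> 'M[A]_2; _ : \det SL2_val == 1 }.

Section SL2Group.
Variable A : comPzRingType.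

HB.instance Definition _ := [isSub for @SL2_val A].
HB.instance Definition _ := [Choice of SL2 A by <:].
Implicit Types g h : SL2 A.

Lemma det_SL2 g : \det (val g) = 1.
Proof. by apply/eqP; case: g. Qed.

Lemma SL2_one_subproof : \det (1%:M : 'M[A]_2) == 1.
Proof. by rewrite det1. Qed.
Definition SL2_one := SL2Mx SL2_one_subproof.

Lemma SL2_mul_subproof g h : \det (val g *m val h) == 1.
Proof. by rewrite det_mulmx !det_SL2 mulr1. Qed.
Definition SL2_mul g h := SL2Mx (SL2_mul_subproof g h).

Lemma SL2_inv_subproof g : \det (adj2 (val g)) == 1.
Proof.
have := congr1 determinant (mul_adj2 (val g)).
by rewrite det_mulmx det_SL2 mulr1 det1 => ->.
Qed.
Definition SL2_inv g := SL2Mx (SL2_inv_subproof g).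

Lemma SL2_mulA : associative SL2_mul.
Proof. by move=> x y z; apply: val_inj; rewrite /= mulmxA. Qed.
Lemma SL2_mul1 : left_id SL2_one SL2_mul.
Proof. by move=> x; apply: val_inj; rewrite /= mul1mx. Qed.
Lemma SL2_mulr1 : right_id SL2_one SL2_mul.
Proof. by move=> x; apply: val_inj; rewrite /= mulmx1. Qed.
Lemma SL2_mulV : left_inverse SL2_one SL2_inv SL2_mul.
Proof. by move=> x; apply: val_inj; rewrite /= mul_adj2 det_SL2. Qed.
Lemma SL2_mulrV : right_inverse SL2_one SL2_inv SL2_mul.
Proof.
by move=> x; apply: val_inj; apply: mulmx1C; rewrite mul_adj2 det_SL2.
Qed.
HB.instance Definition _ := isGroup.Build (SL2 A)
  SL2_mulA SL2_mul1 SL2_mulr1 SL2_mulV SL2_mulrV.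

Lemma SL2_val1 : val (1%g : SL2 A) = 1%:M. Proof. by []. Qed.
Lemma SL2_valM g h : val (g * h)%g = val g *m val h. Proof. by []. Qed.
Lemma SL2_valV g : val (g^-1)%g = adj2 (val g). Proof. by []. Qed.

Lemma SL2_mx2_subproof (a b c d : A) : a * d - b * c = 1 ->
  \det (mx2 a b c d) == 1.
Proof. by move=> h; rewrite det_mx2E !mxE /= h. Qed.

Definition SL2_diag : {pred SL2 A} := fun g => (g 0 1 == 0) && (g 1 0 == 0).
Definition SL2_upper : {pred SL2 A} := fun g => g 1 0 == 0.
Definition SL2_monomial : {pred SL2 A} := fun g =>
  `[< exists a b : A, a * b = 1 /\
        (val g = mx2 a 0 0 b \/ val g = mx2 0 a (- b) 0) >].

Lemma SL2_diag_closed : group_closed SL2_diag.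
Proof.
split=> [|g h]; rewrite !unfold_in /SL2_diag; first by rewrite !mxE !eqxx.
move=> /andP[/eqP g1 /eqP g2] /andP[/eqP h1 /eqP h2].
rewrite !mulmx2E !mxE /= g1 g2 h1 h2.
by rewrite !(mul0r, mulr0, oppr0, addr0) eqxx.
Qed.

Lemma SL2_upper_closed : group_closed SL2_upper.
Proof.
split=> [|g h]; rewrite !unfold_in /SL2_upper; first by rewrite !mxE !eqxx.
move=> /eqP g2 /eqP h2.
by rewrite !mulmx2E !mxE /= g2 h2 !(mul0r, mulr0, oppr0, addr0).
Qed.

Lemma SL2_monomial_closed : group_closed SL2_monomial.
Proof.
split=> [|g h]; rewrite !unfold_in.
  apply/asboolP; exists 1, 1; split; rewrite ?mulr1 //; left.
  by apply: eq_mx2; rewrite !mxE.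
move=> /asboolP[a [b [ab gE]]] /asboolP[c [d [cd hE]]]; apply/asboolP.
have dc : d * c = 1 by rewrite mulrC.
have ba : b * a = 1 by rewrite mulrC.
rewrite SL2_valM SL2_valV; case: gE hE => -> [->|->].
- exists (a * d), (b * c); rewrite mulrACA ab dc mulr1; split=> //; left.
  by apply: eq_mx2; rewrite mulmx2E !mxE /= !(mul0r, mulr0, oppr0, addr0, add0r).
- exists (- (a * c)), (- (b * d)); rewrite mulrNN mulrACA ab cd mulr1.
  split=> //; right.
  by apply: eq_mx2; rewrite mulmx2E !mxE /=
    !(mul0r, mulr0, oppr0, addr0, add0r, opprK, mulrN).
- exists (a * c), (b * d); rewrite mulrACA ab cd mulr1; split=> //; right.
  by apply: eq_mx2; rewrite mulmx2E !mxE /=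
    !(mul0r, mulr0, oppr0, addr0, add0r, opprK, mulrN, mulNr).
exists (a * d), (b * c); rewrite mulrACA ab dc mulr1; split=> //; left.
by apply: eq_mx2; rewrite mulmx2E !mxE /=
  !(mul0r, mulr0, oppr0, addr0, add0r, opprK, mulrN, mulNr).
Qed.

Record T2 := MkT2 { T2_val :> SL2 A; _ : T2_val \in SL2_diag }.
HB.instance Definition _ := [isSub for T2_val].
HB.instance Definition _ := [Choice of T2 by <:].
HB.instance Definition _ :=
  SubChoice_isSubGroup.Build (SL2 A) SL2_diag T2 SL2_diag_closed.

Record B2 := MkB2 { B2_val :> SL2 A; _ : B2_val \in SL2_upper }.
HB.instance Definition _ := [isSub for B2_val].
HB.instance Definition _ := [Choice of B2 by <:].
HB.instance Definition _ :=
  SubChoice_isSubGroup.Build (SL2 A) SL2_upper B2 SL2_upper_closed.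

Record SM2 := MkSM2 { SM2_val :> SL2 A; _ : SM2_val \in SL2_monomial }.
HB.instance Definition _ := [isSub for SM2_val].
HB.instance Definition _ := [Choice of SM2 by <:].
HB.instance Definition _ :=
  SubChoice_isSubGroup.Build (SL2 A) SL2_monomial SM2 SL2_monomial_closed.

Lemma diag_upper (t : T2) : val t \in SL2_upper.
Proof. by case: t => g /= /andP[]. Qed.

Definition T2_to_B2 (t : T2) : B2 := MkB2 (diag_upper t).

Lemma T2_to_B2_morph : {morph T2_to_B2 : s t / (s * t)%g}.
Proof. by move=> s t; apply: val_inj. Qed.
HB.instance Definition _ := isMultiplicative.Build T2 B2 T2_to_B2 T2_to_B2_morph.

Definition SM2_incl : {multiplicative SM2 -> SL2 A} := (val : SM2 -> SL2 A).

End SL2Group.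

(* Words in the generators and their formal inverses: (x, true) stands for
   x^-1. *)
Definition word (X : Type) := seq (X * bool).

Inductive presented_eq (X : Type) (R : word X -> word X -> Prop) :
    word X -> word X -> Prop :=
| pe_rel u v : R u v -> presented_eq R u v
| pe_cancel x b : presented_eq R [:: (x, b); (x, ~~ b)] [::]
| pe_cat u u' v v' : presented_eq R u u' -> presented_eq R v v' ->
    presented_eq R (u ++ v) (u' ++ v')
| pe_refl u : presented_eq R u u
| pe_sym u v : presented_eq R u v -> presented_eq R v u
| pe_trans u v w :
    presented_eq R u v -> presented_eq R v w -> presented_eq R u w.

Definition word_eval (G : groupType) (X : Type) (e : X -> G) (w : word X) : G :=
  (\prod_(p <- w) if p.2 then (e p.1)^-1 else e p.1)%g.

Definition presentation (G : groupType) (X : Type) (e : X -> G)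
    (R : word X -> word X -> Prop) : Prop :=
  (forall g, exists w, word_eval e w = g) /\
  (forall u v, word_eval e u = word_eval e v <-> presented_eq R u v).

Section GE2.
Variable A : comPzRingType.

Lemma E2_subproof (x : A) : \det (mx2 x 1 (-1) 0) == 1.
Proof. by apply: SL2_mx2_subproof; rewrite mulr0 mul1r sub0r opprK. Qed.
Definition E2 (x : A) : SL2 A := SL2Mx (E2_subproof x).

Definition Ew (x : A) : word A := [:: (x, false)].

(* The word D(a) = E(-a) E(-a^-1) E(-a), where b stands for a^-1. *)
Definition Dw (a b : A) : word A := Ew (- a) ++ Ew (- b) ++ Ew (- a).

Inductive GE2_rel : word A -> word A -> Prop :=
| GE2_add x y : GE2_rel (Ew x ++ Ew 0 ++ Ew y) (Dw (-1) (-1) ++ Ew (x + y))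
| GE2_conj x a a' : a * a' = 1 ->
    GE2_rel (Ew x ++ Dw a a') (Dw a' a ++ Ew (a ^+ 2 * x))
| GE2_mul a a' b b' : a * a' = 1 -> b * b' = 1 ->
    GE2_rel (Dw a a' ++ Dw b b') (Dw (a * b) (a' * b')).

Definition universal_GE2_ring : Prop := presentation E2 GE2_rel.

End GE2.

Section Lines.
Variable A : comPzRingType.

Definition invertible2 (M : 'M[A]_2) : Prop :=
  exists N, M *m N = 1%:M /\ N *m M = 1%:M.

Definition unimodular (u : 'cV[A]_2) : Prop :=
  exists M : 'M[A]_2, invertible2 M /\ u = col 0 M.

Definition line (u : 'cV[A]_2) : set 'cV[A]_2 := [set a *: u | a in setT].

Definition X_admissible n (t : n.-tuple (set 'cV[A]_2)) : Prop :=
  exists v : 'I_n -> 'cV[A]_2,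
    [/\ forall i, unimodular (v i),
        forall i, tnth t i = line (v i) &
        forall i j, i != j -> invertible2 (row_mx (v i) (v j))].

Record X_simplex n := XSimplex {
  X_tuple :> n.+1.-tuple (set 'cV[A]_2); _ : `[< X_admissible X_tuple >] }.
HB.instance Definition _ n := [isSub for @X_tuple n].
HB.instance Definition _ n := [Choice of X_simplex n by <:].

Lemma X_face_subproof n (i : 'I_n.+2) (s : X_simplex n.+1) :
  `[< X_admissible (omit i (val s)) >].
Proof.
case: s => t /= /asboolP[v [vu vt vi]]; apply/asboolP.
exists (fun j => v (fintype.lift i j)); split=> [j|j|j k jk] //.
- by rewrite tnth_mktuple vt.
- by apply: vi; apply: contraNneq jk => /lift_inj ->.
Qed.
Definition X_face n (i : 'I_n.+2) (s : X_simplex n.+1) : X_simplex n :=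
  XSimplex (X_face_subproof i s).

Lemma X_faceK n (i j : nat) (s : X_simplex n.+2) : (i <= j < n.+2)%N ->
  X_face (inord j : 'I_n.+2) (X_face (inord i) s) =
  X_face (inord i) (X_face (inord j.+1) s).
Proof. by move=> ij; apply: val_inj; apply: omitK. Qed.

Definition X_simplicial : semi_simplicial :=
  @SemiSimplicial X_simplex X_face X_faceK.

Definition X_complex : complex := free_complex X_simplicial.

Lemma invertible2M (M N : 'M[A]_2) :
  invertible2 M -> invertible2 N -> invertible2 (M *m N).
Proof.
move=> [M' [MM' M'M]] [N' [NN' N'N]]; exists (N' *m M'); split.
  by rewrite mulmxA -(mulmxA M) NN' mulmx1 MM'.
by rewrite mulmxA -(mulmxA N') M'M mulmx1 N'N.
Qed.

Lemma invertible2_SL2 (g : SL2 A) : invertible2 (val g).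
Proof.
exists (val (g^-1)%g).
by split; rewrite -SL2_valM (mulgV, mulVg).
Qed.

Definition line_act (g : SL2 A) (L : set 'cV[A]_2) : set 'cV[A]_2 :=
  [set val g *m w | w in L].

Lemma line_actE g u : line_act g (line u) = line (val g *m u).
Proof.
apply/seteqP; split=> w /=.
  by move=> [_ [a _ <-] <-]; exists a => //; rewrite -scalemxAr.
move=> [a _ <-]; exists (a *: u); first by exists a.
by rewrite -scalemxAr.
Qed.

Lemma X_act_subproof n (g : SL2 A) (s : X_simplex n) :
  `[< X_admissible (map_tuple (line_act g) (val s)) >].
Proof.
case: s => t /= /asboolP[v [vu vt vi]]; apply/asboolP.
exists (fun j => val g *m v j); split=> [j|j|j k jk].
- have [M [Mi ->]] := vu j; exists (val g *m M); split.
    by apply: invertible2M => //; apply: invertible2_SL2.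
  by rewrite !colE mulmxA.
- by rewrite tnth_map vt line_actE.
- rewrite -mul_mx_row; apply: invertible2M; first exact: invertible2_SL2.
  exact: vi.
Qed.
Definition X_act_simplex (g : SL2 A) n (s : X_simplex n) : X_simplex n :=
  XSimplex (X_act_subproof g s).

Lemma X_act_face (g : SL2 A) n i (s : X_simplex n.+1) :
  X_act_simplex g (X_face i s) = X_face i (X_act_simplex g s).
Proof. by apply: val_inj; apply: omit_map. Qed.

Definition X_act (g : SL2 A) : chain_map X_complex X_complex :=
  free_map (@SimplicialMap X_simplicial X_simplicial (X_act_simplex g)
              (X_act_face g)).

Definition X_coinv n := coinv (fun g => X_act g n).
HB.instance Definition _ n := GRing.Zmodule.on (X_coinv n).

Definition Z_act n (g : SL2 A) : {additive cycles X_complex n -> cycles X_complex n} :=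
  @cycle_map _ _ (X_act g) n.

Definition Z_coinv n := coinv (Z_act n).
HB.instance Definition _ n := GRing.Zmodule.on (Z_coinv n).

Lemma Z_incl_subproof n (g : SL2 A) (z : cycles X_complex n) :
  val (Z_act n g z) = X_act g n (val z).
Proof. by []. Qed.

Definition Z_to_X_coinv n : {additive Z_coinv n -> X_coinv n} :=
  coinv_map (phi := id)
    (f := (val : cycles X_complex n -> X_complex n)) (@Z_incl_subproof n).

Definition GW := Z_coinv 1.
HB.instance Definition _ := GRing.Zmodule.on GW.

(* The kernel of GW(A) = Z_coinv 1 -> X_1(A^2)_{SL_2(A)}. *)
Definition fund_ideal := ker (Z_to_X_coinv 1).
HB.instance Definition _ := GRing.Zmodule.on fund_ideal.

Definition RP := Z_coinv 2.
HB.instance Definition _ := GRing.Zmodule.on RP.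

(* The codomain of Z_to_X_coinv 2 is X_2(A^2)_{SL_2(A)}, identified with
   Z[A^x / (A^x)^2] through (oo, 0, a) <-> <a>. *)
Definition RP1 := ker (Z_to_X_coinv 2).
HB.instance Definition _ := GRing.Zmodule.on RP1.

Definition is_unit (a : A) : Prop := exists b, a * b = 1.

Definition vec_inf : 'cV[A]_2 := delta_mx 0 0.
Definition vec_zero : 'cV[A]_2 := delta_mx 1 0.
Definition vec_pt (a : A) : 'cV[A]_2 := vec_inf + a *: vec_zero.

Lemma invertible_row_mx (u v : 'cV[A]_2) :
  is_unit (u 0 0 * v 1 0 - v 0 0 * u 1 0) -> invertible2 (row_mx u v).
Proof.
have dE : \det (row_mx u v) = u 0 0 * v 1 0 - v 0 0 * u 1 0.
  have l i : row_mx u v i 0 = u i 0.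
    by rewrite -[RHS](row_mxEl u v); congr (row_mx u v i _); apply: val_inj.
  have r i : row_mx u v i 1 = v i 0.
    by rewrite -[RHS](row_mxEr u v); congr (row_mx u v i _); apply: val_inj.
  by rewrite det_mx2E !l !r.
rewrite -dE => -[b db].
have NM : (b *: adj2 (row_mx u v)) *m row_mx u v = 1%:M.
  by rewrite -scalemxAl mul_adj2 scale_scalar_mx mulrC db.
by exists (b *: adj2 (row_mx u v)); split=> //; apply: mulmx1C.
Qed.

End Lines.

Section Psi.
Variable A : comPzRingType.
Implicit Types (a b : A) (u v w : 'cV[A]_2).

Definition vdet (u v : 'cV[A]_2) : A := u 0 0 * v 1 0 - v 0 0 * u 1 0.

Lemma is_unitN a : is_unit a -> is_unit (- a).
Proof. by move=> [b ab]; exists (- b); rewrite mulrNN. Qed.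

Lemma is_unitX a n : is_unit a -> is_unit (a ^+ n).
Proof. by move=> [b ab]; exists (b ^+ n); rewrite -exprMn ab expr1n. Qed.

Lemma is_unit1 : is_unit (1 : A).
Proof. by exists 1; rewrite mulr1. Qed.

Lemma X_triple_subproof (u v w : 'cV[A]_2) :
  is_unit (vdet u v) -> is_unit (vdet u w) -> is_unit (vdet v w) ->
  `[< X_admissible [tuple line u; line v; line w] >].
Proof.
move=> uv uw vw; apply/asboolP; pose f := tnth [tuple u; v; w].
have sym x y : is_unit (vdet x y) -> is_unit (vdet y x).
  by move=> /is_unitN; rewrite /vdet opprB.
have f0 : f ord0 = u by [].
have fi i j : i != j -> invertible2 (row_mx (f i) (f j)).
  move=> ij; apply: invertible_row_mx; rewrite -/(vdet _ _); move: ij.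
  by case: i j => [[|[|[|//]]] ?] [[|[|[|//]]] ?] //= _; do ?apply: sym.
exists f; split=> // i.
  have [j ij] : exists j, i != j.
    by case: i => [[|i] hi]; [exists (inord 1) | exists ord0];
       rewrite -val_eqE /= ?inordK.
  exists (row_mx (f i) (f j)); split; first exact: fi.
  apply/colP => k; rewrite mxE -[LHS](row_mxEl _ (f j)).
  by congr (row_mx (f i) (f j) k _); apply: val_inj.
by case: i => [[|[|[|//]]] ?].
Qed.

Definition X_triple u v w uv uw vw : X_simplex A 2 :=
  XSimplex (@X_triple_subproof u v w uv uw vw).

Lemma vdet_inf_zero : is_unit (vdet (vec_inf A) (vec_zero A)).
Proof.
by rewrite /vdet !mxE /= !(mulr1, mulr0, subr0); apply: is_unit1.
Qed.

Lemma vdet_zero_inf : is_unit (vdet (vec_zero A) (vec_inf A)).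
Proof.
by rewrite /vdet !mxE /= !(mulr1, mulr0, sub0r); apply/is_unitN/is_unit1.
Qed.

Lemma vdet_inf_pt a : is_unit a -> is_unit (vdet (vec_inf A) (vec_pt a)).
Proof. by rewrite /vdet !mxE /= !(mulr1, mulr0, subr0, mul1r, add0r). Qed.

Lemma vdet_zero_pt a : is_unit (vdet (vec_zero A) (vec_pt a)).
Proof.
rewrite /vdet !mxE /= !(mulr1, mulr0, subr0, mul1r, add0r, addr0, mul0r, sub0r).
exact/is_unitN/is_unit1.
Qed.

Definition X_inf_zero a (ha : is_unit a) : X_simplex A 2 :=
  X_triple vdet_inf_zero (vdet_inf_pt ha) (vdet_zero_pt a).
Definition X_zero_inf a (ha : is_unit a) : X_simplex A 2 :=
  X_triple vdet_zero_inf (vdet_zero_pt a) (vdet_inf_pt ha).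

Definition psi1_pair a (ha : is_unit a) : X_complex A 2 :=
  << X_inf_zero ha : X_simplicial A 2 >> + << X_zero_inf ha : X_simplicial A 2 >>.

Definition psi1_chain a (ha : is_unit a) : X_complex A 2 :=
  psi1_pair ha - psi1_pair is_unit1.

Lemma omit3 (T : Type) (x y z : T) (i : 'I_3) :
  omit i [tuple x; y; z] =
  if val i is 0%N then [tuple y; z] else
  if val i is 1%N then [tuple x; z] else [tuple x; y].
Proof.
by case: i => [[|[|[|//]]] ?]; apply: eq_from_tnth => j; rewrite tnth_mktuple;
   case: j => [[|[|//]] ?].
Qed.

Lemma bd_psi1_pair a (ha : is_unit a) :
  bd (X_complex A) 1 (psi1_pair ha) = bd (X_complex A) 1 (psi1_pair is_unit1).
Proof.
pose o2 : 'I_3 := fintype.lift ord0 (fintype.lift ord0 ord0).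
have H b (hb : is_unit b) : bd (X_complex A) 1 (psi1_pair hb) =
    << face (X_simplicial A) o2 (X_inf_zero hb) >>
    + << face (X_simplicial A) o2 (X_zero_inf hb) >>.
  have sum3 (F : 'I_3 -> {freeg (X_simplicial A 1)}) :
      \sum_(i < 3) (-1) ^+ i *: F i = F ord0 - F (fintype.lift ord0 ord0) + F o2.
    rewrite !big_ord_recl big_ord0 addr0 expr0 scale1r expr1 scaleN1r addrA.
    by rewrite -[X in _ + X *: _]/((-1) ^+ 2) sqrrN expr1n scale1r.
  rewrite /psi1_pair raddfD /= !liftU !scale1r !sum3 /=.
  have -> : X_face (fintype.lift ord0 ord0) (X_inf_zero hb) =
            X_face ord0 (X_zero_inf hb) by apply: val_inj; rewrite /= !omit3.
  have -> : X_face (fintype.lift ord0 ord0) (X_zero_inf hb) =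
            X_face ord0 (X_inf_zero hb) by apply: val_inj; rewrite /= !omit3.
  by rewrite addrACA subrKA subrr add0r.
rewrite !H; congr (<< _ >> + << _ >>); apply: val_inj; by rewrite /= !omit3.
Qed.

Lemma psi1_chain_cycle a (ha : is_unit a) :
  psi1_chain ha \in @cyclep (X_complex A) 2.
Proof. by rewrite unfold_in /= raddfB bd_psi1_pair subrr. Qed.

Definition psi1_cycle a (ha : is_unit a) : cycles (X_complex A) 2 :=
  Cycle (psi1_chain_cycle ha).

Definition psi1 a (ha : is_unit a) : RP A := quo_pi _ (psi1_cycle ha).

Lemma line_scale c u : is_unit c -> line (c *: u) = line u.
Proof.
move=> [d cd]; apply/seteqP; split=> w /= [x _ <-].
  by exists (x * c) => //; rewrite scalerA.
by exists (x * d) => //; rewrite scalerA -mulrA [d * c]mulrC cd mulr1.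
Qed.

(* g = diag(a, a^-1). *)
Lemma X_act_sq a (ha : is_unit a) : exists g : SL2 A,
  X_act_simplex g (X_inf_zero (is_unitX 2 ha)) = X_inf_zero is_unit1 /\
  X_act_simplex g (X_zero_inf (is_unitX 2 ha)) = X_zero_inf is_unit1.
Proof.
have [b ab] := ha; have ba : b * a = 1 by rewrite mulrC.
have hb : is_unit b by exists a.
have dg : a * b - 0 * 0 = 1 by rewrite mulr0 subr0.
exists (SL2Mx (SL2_mx2_subproof dg)).
have gE : forall u, mx2 a 0 0 b *m u = \col_i if i == 0 then a * u 0 0 else b * u 1 0.
  move=> u; apply/colP; elim/ord2P; rewrite !mxE !big_ord_recl big_ord0 !mxE /=.
    by rewrite mul0r !addr0; congr (_ * u _ _); apply: val_inj.
  by rewrite mul0r addr0 add0r; congr (_ * u _ _); apply: val_inj.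
have e0 : line_act (SL2Mx (SL2_mx2_subproof dg)) (line (vec_inf A)) = line (vec_inf A).
  rewrite line_actE -[RHS](line_scale _ ha) /= gE; congr line; apply/colP.
  by elim/ord2P; rewrite !mxE /= ?mulr0.
have e1 : line_act (SL2Mx (SL2_mx2_subproof dg)) (line (vec_zero A)) = line (vec_zero A).
  rewrite line_actE -[RHS](line_scale _ hb) /= gE; congr line; apply/colP.
  by elim/ord2P; rewrite !mxE /= ?mulr0.
have e2 : line_act (SL2Mx (SL2_mx2_subproof dg)) (line (vec_pt (a ^+ 2))) =
          line (vec_pt 1).
  rewrite line_actE -[RHS](line_scale _ ha) /= gE; congr line; apply/colP.
  elim/ord2P; rewrite !mxE /= !(mulr0, addr0, add0r, mulr1) //.
  by rewrite expr2 mulrA ba mul1r.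
by split; apply: val_inj; apply: val_inj; rewrite /= e0 e1 e2.
Qed.

Lemma psi1_sq_subproof a (ha : is_unit a) :
  psi1 (is_unitX 2 ha) \in kerp (Z_to_X_coinv A 2).
Proof.
rewrite unfold_in /Z_to_X_coinv /coinv_map /psi1 /= quo_map_pi /=.
have [g [g1 g2]] := X_act_sq ha.
rewrite -[0](raddf0 (quo_pi _)); apply/eqP/esym/quo_pi_eq; rewrite sub0r.
apply: mem_spanp; exists g, (psi1_pair (is_unitX 2 ha)).
rewrite /psi1_chain opprB; congr (_ - _).
by rewrite /psi1_pair raddfD /= !liftU !scale1r g1 g2.
Qed.

Definition psi1_sq a (ha : is_unit a) : RP1 A := Ker (psi1_sq_subproof ha).

Definition RP1_mod_psi1 :=
  quo [set x : RP1 A | exists (a : A) (ha : is_unit a), x = psi1_sq ha].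
HB.instance Definition _ := GRing.Zmodule.on RP1_mod_psi1.

(* a^2 = 1 already forces a to be a unit. *)
Record mu2 := Mu2 { mu2_val :> A; _ : mu2_val ^+ 2 == 1 }.
HB.instance Definition _ := [isSub for mu2_val].
HB.instance Definition _ := [Choice of mu2 by <:].

Lemma mu2_one_subproof : (1 : A) ^+ 2 == 1.
Proof. by rewrite expr1n. Qed.
Definition mu2_one := Mu2 mu2_one_subproof.

Lemma mu2_mul_subproof (x y : mu2) : (val x * val y) ^+ 2 == 1.
Proof. by case: x y => x /= /eqP hx [y /= /eqP hy]; rewrite exprMn hx hy mulr1. Qed.
Definition mu2_mul x y := Mu2 (mu2_mul_subproof x y).

Lemma mu2_mulA : associative mu2_mul.
Proof. by move=> x y z; apply: val_inj; rewrite /= mulrA. Qed.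
Lemma mu2_mulC : commutative mu2_mul.
Proof. by move=> x y; apply: val_inj; rewrite /= mulrC. Qed.
Lemma mu2_mul1 : left_id mu2_one mu2_mul.
Proof. by move=> x; apply: val_inj; rewrite /= mul1r. Qed.
Lemma mu2_mulV : left_inverse mu2_one id mu2_mul.
Proof. by move=> x; apply: val_inj; case: x => x /= /eqP; rewrite expr2. Qed.

(* mu_2(A) is written additively (x + y is the product in A, and - x = x), so
   that it can be tensored with other abelian groups. *)
HB.instance Definition _ :=
  GRing.isZmodule.Build mu2 mu2_mulA mu2_mulC mu2_mul1 mu2_mulV.

End Psi.

Definition exact_at (U V W : zmodType) (f : U -> V) (g : V -> W) : Prop :=
  forall y, g y = 0 <-> exists x, f x = y.

Definition H_SL2_SM2 (A : comPzRingType) (n : nat) :=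
  rel_group_homology (SM2_incl A) n.
HB.instance Definition _ (A : comPzRingType) n :=
  GRing.Zmodule.on (H_SL2_SM2 A n).

(* Main.v *)
Require Import Defs.
From HB Require Import structures.
From mathcomp Require Import all_boot all_order all_algebra.
From mathcomp Require Import boolp classical_sets.
From mathcomp.multinomials Require Import freeg.
From mathcomp Require Import ring zify.

(* Write G = SL_2(A), N = SM_2(A). The complex X_2 -> X_1 -> X_0 -> Z is exact
   because A is universal for GE_2: a word in the E(x) traces a path of lines, and
   the three defining relations only change it by boundaries of triangles. The
   N-module complex spanned by the lines oo, 0 and the edges (oo,0), (0,oo) maps to
   it, with kernel Z h in degree 1, h = (oo,0) + (0,oo). By Shapiro's lemma and
   H_i(T) = H_i(B) this map is a homology isomorphism on X_0 (in degrees <= 3) and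
   on X_1, so shifting dimension twice gives
   H_3(G, N) = H_1(G, Z_1) / (classes h (x) g, g in N).

   Next, 0 -> Z_2 -> X_2 -> Z_1 -> 0 yields a map H_1(G, Z_1) -> RP_1 which is onto,
   with kernel the classes z (x) (-1), z in Z_1, since triangles have stabilizer
   mu_2 = {1, -1}. It sends h (x) diag(a, 1/a) to psi_1(a^2), but h (x) w to psi_1(-1)
   for w antidiagonal, so it does not pass to the quotient as it stands. The cure is
   the map rho from H_1(G, Z_1) to H_1(G, X_1) = A^x. Its values are square roots of 1,
   it is -1 on h (x) w, 1 on h (x) diag(a, 1/a) and (-1)^(deg z) on z (x) (-1). Hence
   every class of H_3(G, N) has a representative in ker rho, unique up to the
   h (x) diag(a, 1/a), and the map to RP_1 / <psi_1(a^2)> is read off from it; its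
   kernel comes from the z (x) (-1) with deg z = 0, that is from I(A) (x) mu_2.

   If -1 = b^2, a matrix w_a of square -1 exchanges oo and 0 and fixes a; as
   h = z + w_a z for the boundary z of the triangle (oo, 0, a), one finds
   z (x) (-1) = h (x) w_a. Then all h (x) g die in RP_1 and span its kernel. *)

Set Implicit Arguments.
Unset Strict Implicit.
Unset Printing Implicit Defensive.

Import GRing.Theory.

Local Open Scope ring_scope.

(** * Free abelian groups and quotients *)

Section Generalities.

(** Homology with coefficients in Z_1 is never formed. C_n(G) (x)_G X_p is free on n-tuples times
    p-simplices, so an element of C_1(G) (x)_G Z_1 is a chain [k] with [del 0 k = 0], and it is
    trivial when [k = bd m] with [del 0 m = 0]. Connecting maps are zigzags of choices; they stay
    relations between chains and classes ([Rel], [Delta]), additive in both arguments, and become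
    homomorphisms only once 0 is known to be related to nothing but 0. Relative homology is computed
    by mapping cones, and a homology isomorphism becomes acyclicity of a cone. This needs squares
    that commute on chains, hence coset representatives for SL_2 that extend those for SM_2. The
    case -1 = 1 is not excluded: there rho vanishes on cycles and mu_2 is trivial, so the parity
    arguments are guarded by [uneg1 A <> 0]. The zero ring, where oo = 0, is treated apart. *)

Lemma spanp_ind (V : zmodType) (S : set V) (P : V -> Prop) :
  P 0 -> (forall x y, P x -> P y -> P (x - y)) -> (forall y, S y -> P y) ->
  forall x, x \in spanp S -> P x.
Proof.
move=> P0 PB PS x; rewrite unfold_in => /asboolP/(_ (fun y => `[< P y >])).
rewrite -[X in _ -> X]/(P x) => h; apply/asboolP/h.
  split=> [|y z]; first exact/asboolP.
  by move=> /asboolP Py /asboolP Pz; apply/asboolP/PB.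
by move=> y Sy; apply/asboolP/PS.
Qed.

Lemma quo_pi_eq0 (V : zmodType) (S : set V) x :
  quo_pi S x = 0 <-> x \in spanp S.
Proof.
split=> [x0|xS]; last by rewrite -[0](raddf0 (quo_pi S)); apply: quo_pi_eq; rewrite subr0.
have := quo_pi_repr S x; have := quo_pi_repr S 0; rewrite raddf0 x0 subr0.
by move=> h0 hx; rewrite -[x](subKr (repr (0 : quo S))) rpredB.
Qed.

Lemma quo_pi_eqP (V : zmodType) (S : set V) x y :
  quo_pi S x = quo_pi S y <-> x - y \in spanp S.
Proof.
split=> [xy|]; last exact: quo_pi_eq.
by apply/quo_pi_eq0; rewrite raddfB; apply/eqP; rewrite subr_eq0; apply/eqP.
Qed.

Lemma quo_piP (V : zmodType) (S : set V) (a : quo S) : exists x, a = quo_pi S x.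
Proof. by exists (repr (a : Quotient.quot (spanp S))); rewrite quo_piK. Qed.

Lemma freeg_ind (K : choiceType) (P : {freeg K} -> Prop) :
  P 0 -> (forall x y, P x -> P y -> P (x - y)) -> (forall k, P << k >>) ->
  forall x, P x.
Proof.
move=> P0 PB PU x.
have PN y : P y -> P (- y) by rewrite -sub0r; apply: PB.
have PD y z : P y -> P z -> P (y + z) by move=> Py /PN; rewrite -{2}[z]opprK; apply: PB.
rewrite -[x]freeg_sumE; apply: (big_ind P) => // k _.
rewrite -[coeff k x]intz -freegU_mulz.
have Pn n : P (<< k >> *+ n) by elim: n => // n IH; rewrite mulrS; apply: PD.
by case: (coeff k x) => n; [exact: Pn | apply/PN/Pn].
Qed.

(** The universal property of [freeg] with values in any abelian group: [zmodule V] is V with its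
    structure of Z-module. *)
Definition flift (K : choiceType) (V : zmodType) (f : K -> V) : {freeg K} -> V :=
  fglift (f : K -> zmodule V).

Lemma flift_is_additive (K : choiceType) (V : zmodType) (f : K -> V) :
  zmod_morphism (flift f).
Proof. exact: (@fglift_is_additive K (zmodule V) f). Qed.
HB.instance Definition _ (K : choiceType) (V : zmodType) (f : K -> V) :=
  GRing.isZmodMorphism.Build {freeg K} V (flift f) (flift_is_additive f).

Lemma fliftU (K : choiceType) (V : zmodType) (f : K -> V) k :
  flift f << k >> = f k.
Proof. by rewrite /flift liftU scale1r. Qed.

Lemma freeg_map_id (K : choiceType) (f : K -> K) x :
  f =1 id -> freeg_map f x = x.
Proof.
move=> fid; have -> // : freeg_map f =1 (idfun : {additive _ -> _}).
by apply: freeg_additive_eq => k; rewrite freeg_mapU fid.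
Qed.

Lemma freeg_map_comp (K L M : choiceType) (f : L -> M) (g : K -> L) x :
  freeg_map f (freeg_map g x) = freeg_map (f \o g) x.
Proof.
rewrite -[LHS]/((freeg_map f \o freeg_map g : {additive _ -> _}) x).
by move: x; apply: freeg_additive_eq => k /=; rewrite !freeg_mapU.
Qed.

Lemma eq_freeg_map (K L : choiceType) (f g : K -> L) :
  f =1 g -> freeg_map f =1 freeg_map g.
Proof. by move=> fg; apply: freeg_additive_eq => k; rewrite !freeg_mapU fg. Qed.

Lemma freeg_map_inj (K L : choiceType) (f : K -> L) :
  injective f -> injective (freeg_map f).
Proof.
move=> fI.
have fK x y : x = y -> coeff (f x) =1 coeff (f y) by move=> ->.
have cE k x : coeff (f k) (freeg_map f x) = coeff k x.
  rewrite -[LHS]/((coeff (f k) \o freeg_map f : {additive _ -> _}) x).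
  move: x; apply: freeg_additive_eq => j /=.
  by rewrite freeg_mapU !coeffU (inj_eq fI).
move=> x y xy; apply/eqP/freeg_eqP => k.
by rewrite -!cE xy.
Qed.

(** By additivity two values at u differ by a value at 0, so the last hypothesis contains all the
    independence of choices. Every homomorphism of the theorem, except in the zero ring, is obtained
    from a zigzag or a quotient in this way. *)
Lemma rel_additive (U V : zmodType) (R : U -> V -> Prop) :
  (forall u, exists v, R u v) ->
  (forall u v u' v', R u v -> R u' v' -> R (u - u') (v - v')) ->
  (forall v, R 0 v -> v = 0) ->
  exists g : {additive U -> V}, forall u v, R u v <-> g u = v.
Proof.
move=> tot RB R0; pose g u := sval (cid (tot u)).
have Rg u : R u (g u) by rewrite /g; case: cid.
have fn u v v' : R u v -> R u v' -> v = v'.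
  by move=> h /(RB _ _ _ _ h); rewrite subrr => /R0/eqP; rewrite subr_eq0 => /eqP.
have gB : zmod_morphism g.
  by move=> u v; apply: (fn (u - v)) => //; apply: RB.
pose gA := GRing.isZmodMorphism.Build U V g gB.
pose G : {additive U -> V} := HB.pack g gA.
exists G => u v; split=> [Ruv|<-]; last exact: Rg.
exact: fn (Rg u) Ruv.
Qed.

End Generalities.

(** * Tensoring with a free abelian group *)

Section Hat.
Variable T : choiceType.

Definition tens {S : choiceType} (t : T) : {additive {freeg S} -> {freeg (T * S)}} :=
  freeg_map (fun s => (t, s)).

Lemma tensU (S : choiceType) t (s : S) : tens t << s >> = << (t, s) >>.
Proof. exact: freeg_mapU. Qed.

(* id (x) f, under freeg (T * S) = freeg T (x) freeg S *)
Definition hat (S S' : choiceType) (f : {additive {freeg S} -> {freeg S'}}) :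
    {additive {freeg (T * S)} -> {freeg (T * S')}} :=
  flift (fun p => tens p.1 (f << p.2 >>)).

Lemma hat_tens (S S' : choiceType) (f : {additive {freeg S} -> {freeg S'}}) t x :
  hat f (tens t x) = tens t (f x).
Proof.
rewrite -[LHS]/((hat f \o tens t : {additive _ -> _}) x).
rewrite -[RHS]/((tens t \o f : {additive _ -> _}) x).
by move: x; apply: freeg_additive_eq => s /=; rewrite tensU fliftU.
Qed.

Definition fiber {S : choiceType} (t : T) : {additive {freeg (T * S)} -> {freeg S}} :=
  flift (fun p => if p.1 == t then << p.2 >> else 0).

Lemma fiber_tens (S : choiceType) t t' (x : {freeg S}) :
  fiber t (tens t' x) = if t' == t then x else 0.
Proof.
move: x; apply: freeg_ind => [|x y hx hy|s]; first by rewrite !raddf0; case: ifP.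
  by rewrite !raddfB hx hy; case: ifP => _; rewrite ?subr0.
by rewrite tensU /fiber /= fliftU.
Qed.

Lemma tens_ind (S : choiceType) (P : {freeg (T * S)} -> Prop) :
  P 0 -> (forall x y, P x -> P y -> P (x - y)) -> (forall t x, P (tens t x)) ->
  forall x, P x.
Proof.
move=> P0 PB PT; apply: freeg_ind => // -[t s]; rewrite -tensU; exact: PT.
Qed.

Lemma fiber_hat (S S' : choiceType) (f : {additive {freeg S} -> {freeg S'}}) t x :
  fiber t (hat f x) = f (fiber t x).
Proof.
move: x; apply: tens_ind => [|x y hx hy|t' x]; rewrite ?raddf0 //.
  by rewrite !raddfB hx hy.
by rewrite hat_tens !fiber_tens; case: ifP; rewrite ?raddf0.
Qed.

Lemma fiber_sum (S : choiceType) (x : {freeg (T * S)}) :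
  exists r : seq T, x = \sum_(t <- r) tens t (fiber t x).
Proof.
have [r rU xr] : exists2 r, uniq r & x = \sum_(t <- r) tens t (fiber t x).
  exists (undup (map fst (dom x))); first exact: undup_uniq.
  set r := undup _; have rU : uniq r := undup_uniq _.
  (* [g] keeps the terms whose first entry lies in [r]. Being additive it can be compared with the
     sum on generators, and by the choice of [r] it fixes x. *)
  pose g : {additive {freeg (T * S)} -> {freeg (T * S)}} :=
    flift (fun p => if p.1 \in r then << p >> else 0).
  have gE y : g y = \sum_(t <- r) tens t (fiber t y).
    move: y; apply: tens_ind => [|y z hy hz|t' y].
    - by rewrite raddf0 big1 // => t _; rewrite !raddf0.
    - by rewrite raddfB hy hz -sumrB; apply: eq_bigr => t _; rewrite !raddfB.
    under eq_bigr do rewrite fiber_tens.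
    have -> : \sum_(i <- r) tens i (if t' == i then y else 0) =
              if t' \in r then tens t' y else 0.
      case: ifP => t'r; last first.
        rewrite big_seq big1 // => i ir; case: eqP => [t'i|]; rewrite ?raddf0 //.
        by rewrite t'i ir in t'r.
      rewrite (big_rem t') //= eqxx big_seq big1 ?addr0 // => i.
      rewrite (mem_rem_uniq _ rU) inE => /andP[it _].
      by rewrite eq_sym (negbTE it) raddf0.
    move: y; apply: freeg_ind => [|y z hy hz|s]; first by rewrite !raddf0; case: ifP.
      by rewrite !raddfB hy hz; case: ifP => _; rewrite ?raddfB ?subrr.
    by rewrite !tensU /g /= fliftU.
  rewrite -gE -[in RHS](freeg_sumE x) raddf_sum -[LHS]freeg_sumE.
  rewrite [LHS]big_seq [RHS]big_seq; apply: eq_bigr => k kx.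
  rewrite -[coeff k x]intz -freegU_mulz raddfMz /g /= fliftU.
  by rewrite mem_undup (map_f fst kx).
by exists r.
Qed.

(** [freeg T] is flat; concretely, preimages are chosen fiber by fiber over the finitely many t that
    occur. *)
Lemma hat_exact (S S' S'' : choiceType) (f : {additive {freeg S} -> {freeg S'}})
    (g : {additive {freeg S'} -> {freeg S''}}) :
  (forall x, g x = 0 -> exists y, x = f y) ->
  forall x, hat g x = 0 -> exists y, x = hat f y.
Proof.
move=> ex x gx; have [r ->] := fiber_sum x.
have /choice[h hE] t : exists y, fiber t x = f y.
  by apply: ex; rewrite -fiber_hat gx raddf0.
exists (\sum_(t <- r) tens t (h t)); rewrite raddf_sum; apply: eq_bigr => t _.
by rewrite hat_tens hE.
Qed.

Lemma hat_ker (S S' : choiceType) (f : {additive {freeg S} -> {freeg S'}}) x :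
  hat f x = 0 -> exists r : seq T, exists h : T -> {freeg S},
    (forall t, f (h t) = 0) /\ x = \sum_(t <- r) tens t (h t).
Proof.
move=> fx; have [r xE] := fiber_sum x; exists r, (fun t => fiber t x); split=> // t.
by rewrite -fiber_hat fx raddf0.
Qed.

Lemma hat_comp0 (S S' S'' : choiceType) (f : {additive {freeg S} -> {freeg S'}})
    (g : {additive {freeg S'} -> {freeg S''}}) :
  (forall x, g (f x) = 0) -> forall x, hat g (hat f x) = 0.
Proof.
move=> gf; apply: tens_ind => [|x y hx hy|t x]; rewrite ?raddf0 //.
  by rewrite !raddfB hx hy subrr.
by rewrite !hat_tens gf raddf0.
Qed.

End Hat.
Arguments hat {T S S'} f.

(** * Chains of a group with coefficients in a permutation module *)

Lemma free_bdU (K : semi_simplicial) n (s : K n.+1) :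
  bd (free_complex K) n << s >> = \sum_(i < n.+2) (-1) ^+ i *: << face K i s >>.
Proof. exact: alt_bdU. Qed.

Record action (G : groupType) (S : choiceType) := Action {
  act :> G -> S -> S;
  act1 : forall s, act 1%g s = s;
  actM : forall g h s, act (g * h)%g s = act g (act h s) }.

Section Nerve.
Variables (G : groupType) (S : choiceType) (a : action G S).

Lemma actK g s : a g^-1%g (a g s) = s.
Proof. by rewrite -actM mulVg act1. Qed.

Lemma actKV g s : a g (a g^-1%g s) = s.
Proof. by rewrite -actM mulgV act1. Qed.

Definition hface n (i : 'I_n.+2) (x : n.+2.-tuple G * S) : n.+1.-tuple G * S :=
  (omit i x.1, x.2).

Lemma hfaceK n (i j : nat) (s : n.+3.-tuple G * S) : (i <= j < n.+2)%N ->
  hface (inord j : 'I_n.+2) (hface (inord i) s) =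
  hface (inord i) (hface (inord j.+1) s).
Proof. by move=> ij; rewrite /hface /= omitK. Qed.

Definition homog : semi_simplicial :=
  @SemiSimplicial (fun n => (n.+1.-tuple G * S)%type) hface hfaceK.

Definition translate (k : G) n (x : n.+1.-tuple G * S) : n.+1.-tuple G * S :=
  (map_tuple (fun g => (k * g)%g) x.1, a k x.2).

Definition normt n (t : n.+1.-tuple G) : n.-tuple G :=
  [tuple ((thead t)^-1 * tnth t (fintype.lift ord0 i))%g | i < n].

Definition norm n (x : n.+1.-tuple G * S) : n.-tuple G * S :=
  (normt x.1, a (thead x.1)^-1%g x.2).

Definition expand n (x : n.-tuple G * S) : n.+1.-tuple G * S :=
  ([tuple of 1%g :: x.1], x.2).

Lemma thead_omit0 n (t : n.+1.-tuple G) k :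
  thead (map_tuple (fun g => (k * g)%g) t) = (k * thead t)%g.
Proof. by rewrite /thead tnth_map. Qed.

Lemma norm_translate k n (x : n.+1.-tuple G * S) : norm (translate k x) = norm x.
Proof.
rewrite /norm /= thead_omit0 invgM actM actK; congr pair.
by apply: eq_from_tnth => i; rewrite !tnth_mktuple thead_omit0 tnth_map invgM -mulgA mulKg.
Qed.

Lemma expandK n : cancel (@expand n) (@norm n).
Proof.
case=> t s; rewrite /norm /expand /= theadE invg1 act1; congr pair.
apply: eq_from_tnth => i; rewrite tnth_mktuple theadE invg1 mul1g.
by rewrite !(tnth_nth 1%g).
Qed.

Lemma expand_norm n (x : n.+1.-tuple G * S) :
  expand (norm x) = translate (thead x.1)^-1%g x.
Proof.
case: x => t s; rewrite /expand /norm /translate /=; congr pair.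
apply: eq_from_tnth => i; rewrite tnth_map.
case: (unliftP ord0 i) => [j|] ->; last by rewrite tnth0 mulVg.
by rewrite tnthS tnth_mktuple.
Qed.

Lemma translate_hface k n i (x : n.+2.-tuple G * S) :
  hface i (translate k x) = translate k (hface i x).
Proof. by rewrite /hface /translate /= omit_map. Qed.

Definition nface n (i : 'I_n.+2) (x : n.+1.-tuple G * S) : n.-tuple G * S :=
  norm (hface i (expand x)).

Lemma nface_norm n i (x : n.+2.-tuple G * S) :
  nface i (norm x) = norm (hface i x).
Proof. by rewrite /nface expand_norm translate_hface norm_translate. Qed.

Lemma nfaceK n (i j : nat) (s : n.+2.-tuple G * S) : (i <= j < n.+2)%N ->
  nface (inord j : 'I_n.+2) (nface (inord i) s) =
  nface (inord i) (nface (inord j.+1) s).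
Proof. by move=> ij; rewrite [nface (inord i) s]/nface nface_norm hfaceK // -nface_norm. Qed.

(* (h_1, .., h_n; s) stands for the orbit of (1, h_1, .., h_n; s) under the
   diagonal action, so that this is the nerve of the action groupoid and its
   chains are C(G) (x)_G Z[S]. *)
Definition nerve : semi_simplicial :=
  @SemiSimplicial (fun n => (n.-tuple G * S)%type) nface nfaceK.

Definition norm_smap : simplicial_map homog nerve :=
  @SimplicialMap homog nerve norm (fun n i s => esym (nface_norm i s)).

Definition actf (k : G) : {additive {freeg S} -> {freeg S}} := freeg_map (a k).

Lemma actf1 x : actf 1%g x = x.
Proof. by apply: freeg_map_id => s; rewrite act1. Qed.

Lemma actfM g h x : actf (g * h)%g x = actf g (actf h x).
Proof. by rewrite /actf freeg_map_comp; apply: eq_freeg_map => s; rewrite /= actM. Qed.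

Definition nerve_complex : complex := free_complex nerve.

Lemma nerve_bd_tens n (t : n.+1.-tuple G) (z : {freeg S}) :
  bd nerve_complex n (tens t z) =
  \sum_(i < n.+2) (-1) ^+ i *: tens (normt (omit i [tuple of 1%g :: t]))
     (actf (thead (omit i [tuple of 1%g :: t]))^-1%g z).
Proof.
move: z; apply: freeg_ind => [|x y hx hy|s].
- by rewrite !raddf0 big1 // => i _; rewrite !raddf0.
- rewrite !raddfB hx hy -sumrB; apply: eq_bigr => i _.
  by rewrite -scalerBr -!raddfB.
rewrite tensU free_bdU; apply: eq_bigr => i _.
by rewrite /actf freeg_mapU tensU.
Qed.

Lemma omit0_cons (T : Type) n x (t : n.+1.-tuple T) : omit ord0 [tuple of x :: t] = t.
Proof. by apply: eq_from_tnth => i; rewrite tnth_mktuple tnthS. Qed.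

Lemma nerve_bd0 (g : G) (z : {freeg S}) :
  bd nerve_complex 0 (tens [tuple g] z) =
  tens [tuple] (actf g^-1%g z) - tens [tuple] z.
Proof.
rewrite nerve_bd_tens !big_ord_recl big_ord0 addr0 expr0 scale1r expr1 scaleN1r.
rewrite omit0_cons theadE /thead tnth_mktuple /= (tnth_nth 1%g) /= invg1 actf1.
by congr (tens _ _ - tens _ _); apply: eq_from_tnth => -[].
Qed.

(** Entries are vertices, not successive quotients: the simplex has vertices 1, g, h, and omitting 1
    leaves (g, h), which is translated back by g^-1 together with z. *)
Lemma nerve_bd1 (g h : G) (z : {freeg S}) :
  bd nerve_complex 1 (tens [tuple g; h] z) =
  tens [tuple (g^-1 * h)%g] (actf g^-1%g z) - tens [tuple h] z + tens [tuple g] z.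
Proof.
rewrite nerve_bd_tens !big_ord_recl big_ord0 addr0 expr0 scale1r expr1 scaleN1r.
rewrite omit0_cons theadE /thead !tnth_mktuple /= !(tnth_nth 1%g) /= invg1 actf1.
rewrite addrA -[X in _ + X *: _]/((-1) ^+ 2) sqrrN expr1n scale1r.
congr (tens _ _ - tens _ _ + tens _ _);
  apply: eq_from_tnth => -[[|//] i]; rewrite !tnth_mktuple /thead ?tnth_mktuple;
  by rewrite !(tnth_nth 1%g) /= ?invg1 ?mul1g.
Qed.

End Nerve.

Section HatBd.
Variables (G : groupType) (S S' : choiceType) (a : action G S) (a' : action G S').
Variable f : {additive {freeg S} -> {freeg S'}}.
Hypothesis fE : forall g x, f (actf a g x) = actf a' g (f x).

Lemma hat_bd n (x : nerve_complex a n.+1) :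
  hat f (bd (nerve_complex a) n x) = bd (nerve_complex a') n (hat f x).
Proof.
move: x; apply: tens_ind => [|x y hx hy|t x]; first by rewrite !raddf0.
  by rewrite !raddfB hx hy.
rewrite hat_tens !nerve_bd_tens raddf_sum; apply: eq_bigr => i _.
by rewrite raddfZsign hat_tens fE.
Qed.

Definition hat_map : chain_map (nerve_complex a) (nerve_complex a') :=
  @ChainMap (nerve_complex a) (nerve_complex a') (fun n => hat f) hat_bd.

End HatBd.

Section NerveMap.
Variables (G H : groupType) (S S' : choiceType) (a : action G S) (a' : action H S').
Variables (F : S -> G -> H) (f : S -> S').
Hypothesis FE : forall k s, exists c, f (a k s) = a' c (f s) /\
  forall g, F (a k s) (k * g)%g = (c * F s g)%g.

(** [F s] need not be a homomorphism. The hypothesis only asks that translation by k become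
    translation by some c, which suffices to pass to orbits and covers both homomorphisms and the
    retraction of Shapiro's lemma. *)
Definition hmap n (x : n.+1.-tuple G * S) : n.+1.-tuple H * S' :=
  (map_tuple (F x.2) x.1, f x.2).

Lemma hmap_translate k n (x : n.+1.-tuple G * S) :
  exists c, hmap (translate a k x) = translate a' c (hmap x).
Proof.
have [c [fc Fc]] := FE k x.2; exists c; rewrite /hmap /translate /= fc.
by congr pair; apply: eq_from_tnth => i; rewrite !tnth_map Fc.
Qed.

Lemma hmap_face n i (x : n.+2.-tuple G * S) : hmap (hface i x) = hface i (hmap x).
Proof. by rewrite /hmap /hface /= omit_map. Qed.

Definition hmap_smap : simplicial_map (homog G S) (homog H S') :=
  @SimplicialMap (homog G S) (homog H S') hmap hmap_face.

Definition nmap n (x : n.-tuple G * S) : n.-tuple H * S' :=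
  norm a' (hmap (expand x)).

Lemma nmap_norm n (x : n.+1.-tuple G * S) : nmap (norm a x) = norm a' (hmap x).
Proof.
rewrite /nmap expand_norm; have [c ->] := hmap_translate (thead x.1)^-1%g x.
by rewrite norm_translate.
Qed.

Lemma nmap_face n i (x : n.+1.-tuple G * S) :
  nmap (nface a i x) = nface a' i (nmap x).
Proof. by rewrite /nface nmap_norm hmap_face -nface_norm. Qed.

Definition nmap_smap : simplicial_map (nerve a) (nerve a') :=
  @SimplicialMap (nerve a) (nerve a') nmap nmap_face.

Definition nerve_map : chain_map (nerve_complex a) (nerve_complex a') :=
  free_map nmap_smap.

Lemma nerve_mapU n (x : n.-tuple G * S) :
  nerve_map n << x >> = << nmap x >>.
Proof. exact: freeg_mapU. Qed.

End NerveMap.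

Lemma cyclepS (C : complex) n (x : C n.+1) : x \in @cyclep C n.+1 <-> bd C n x = 0.
Proof. by split=> [/eqP|/eqP]. Qed.

Lemma cyclep_cmap (C D : complex) (f : chain_map C D) n (x : C n) :
  x \in @cyclep C n -> f n x \in @cyclep D n.
Proof. by case: n x => [//|n] x /cyclepS x0; apply/cyclepS; rewrite -cmapE x0 raddf0. Qed.

Lemma cyclep_bd (C : complex) n (x : C n.+1) : bd C n x \in @cyclep C n.
Proof. by case: n x => [//|n] x; apply/cyclepS; rewrite bdK. Qed.

(** * Equivariant homotopies *)

Section Homotopy.
Variables (G : groupType) (S : choiceType) (a : action G S) (F : S -> G -> G).
Hypothesis FE : forall k s g, F (a k s) (k * g)%g = (k * F s g)%g.

Lemma FE_self k s : exists c, a k s = a c s /\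
  forall g, F (a k s) (k * g)%g = (c * F s g)%g.
Proof. by exists k; split=> // g; rewrite FE. Qed.

Let HC : complex := free_complex (homog G S).
Let Phi : chain_map HC HC := free_map (hmap_smap F id).

Definition hcone (k : G) n : {additive HC n -> HC n.+1} :=
  freeg_map (fun x : n.+1.-tuple G * S => ([tuple of k :: x.1], x.2)).

Lemma omitS_cons (T : Type) n x (t : n.+2.-tuple T) i :
  omit (fintype.lift ord0 i) [tuple of x :: t] = [tuple of x :: omit i t].
Proof.
apply: eq_from_tnth => j; rewrite tnth_mktuple.
case: (unliftP ord0 j) => [l|] ->; last first.
  rewrite tnth0 (_ : fintype.lift (fintype.lift ord0 i : 'I_n.+3) _ = ord0) ?tnth0 //.
  exact: val_inj.
rewrite tnthS tnth_mktuple -[RHS](tnthS x); congr tnth; apply: val_inj => /=.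
by rewrite /bump /= !add1n ltnS addnS.
Qed.

Lemma hcone_bd k n (z : HC n.+1) :
  bd HC n.+1 (hcone k n.+1 z) = z - hcone k n (bd HC n z).
Proof.
rewrite -[LHS]/((bd HC n.+1 \o hcone k n.+1 : {additive _ -> _}) z).
rewrite -[RHS]/((idfun \- (hcone k n \o bd HC n) : {additive _ -> _}) z).
move: z; apply: freeg_additive_eq => x.
rewrite -[LHS]/(bd HC n.+1 (hcone k n.+1 << x >>)).
rewrite -[RHS]/(<< x >> - hcone k n (bd HC n << x >>)).
rewrite freeg_mapU !free_bdU big_ord_recl expr0 scale1r /= /hface /= omit0_cons.
rewrite -surjective_pairing.
congr (_ + _); rewrite raddf_sum -sumrN; apply: eq_bigr => i _.
by rewrite raddfZsign freeg_mapU /= omitS_cons exprS mulN1r scaleNr.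
Qed.

Lemma hcone_bd0 k (t : 1.-tuple G) s :
  bd HC 0 (hcone k 0 << (t, s) >>) = << (t, s) >> - << ([tuple k], s) >>.
Proof.
rewrite freeg_mapU free_bdU !big_ord_recl big_ord0.
rewrite addr0 expr0 scale1r expr1 scaleN1r /= /hface /= omit0_cons.
congr (_ - << (_, s) >>); apply: eq_from_tnth => -[[|//] i].
by rewrite !tnth_mktuple !(tnth_nth 1%g).
Qed.

(* The homotopy is built degree by degree from cones, as in the acyclic carrier
   argument; taking the first vertex as apex makes it equivariant. *)
Fixpoint hhom n : {additive HC n -> HC n.+1} :=
  match n return {additive HC n -> HC n.+1} with
  | 0 => flift (fun x : 1.-tuple G * S =>
           hcone (thead x.1) 0 (Phi 0 << x >> - << x >>))
  | m.+1 => flift (fun x : m.+2.-tuple G * S =>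
           hcone (thead x.1) m.+1
             (Phi m.+1 << x >> - << x >> - hhom m (bd HC m << x >>)))
  end.

Lemma hhom0_bd (x : HC 0) : bd HC 0 (hhom 0 x) = Phi 0 x - x.
Proof.
rewrite -[LHS]/((bd HC 0 \o hhom 0 : {additive _ -> _}) x).
rewrite -[RHS]/((Phi 0 \- idfun : {additive _ -> _}) x).
move: x; apply: freeg_additive_eq => -[t s].
rewrite /= fliftU /= freeg_mapU raddfB [in LHS]raddfB /hmap /=.
by rewrite !hcone_bd0 opprB addrA subrK.
Qed.

Lemma hhom_bd n (x : HC n.+1) :
  bd HC n.+1 (hhom n.+1 x) = Phi n.+1 x - x - hhom n (bd HC n x).
Proof.
elim: n x => [|n IH] x.
  rewrite -[LHS]/((bd HC 1 \o hhom 1 : {additive _ -> _}) x).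
  rewrite -[RHS]/((Phi 1 \- idfun \- (hhom 0 \o bd HC 0) : {additive _ -> _}) x).
  move: x; apply: freeg_additive_eq => x.
  rewrite -[LHS]/(bd HC 1 (hhom 1 << x >>)).
  rewrite -[RHS]/(Phi 1 << x >> - << x >> - hhom 0 (bd HC 0 << x >>)).
  rewrite [hhom 1 _]fliftU hcone_bd [X in hcone _ _ X](_ : _ = 0); last first.
    rewrite !raddfB -(cmapE Phi).
    rewrite [X in _ - X](_ : _ = Phi 0 (bd HC 0 << x >>) - bd HC 0 << x >>) ?subrr //.
    exact: hhom0_bd.
  by rewrite raddf0 subr0.
rewrite -[LHS]/((bd HC n.+2 \o hhom n.+2 : {additive _ -> _}) x).
rewrite -[RHS]/((Phi n.+2 \- idfun \- (hhom n.+1 \o bd HC n.+1) : {additive _ -> _}) x).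
move: x; apply: freeg_additive_eq => x.
rewrite -[LHS]/(bd HC n.+2 (hhom n.+2 << x >>)).
rewrite -[RHS]/(Phi n.+2 << x >> - << x >> - hhom n.+1 (bd HC n.+1 << x >>)).
rewrite [hhom n.+2 _]fliftU hcone_bd [X in hcone _ _ X](_ : _ = 0); last first.
  by rewrite !raddfB -(cmapE Phi) [X in _ - X](IH (bd HC n.+1 << x >>)) bdK raddf0 subr0 subrr.
by rewrite raddf0 subr0.
Qed.

Let tr k : chain_map HC HC :=
  free_map (@SimplicialMap (homog G S) (homog G S) (fun n => @translate G S a k n)
    (fun n i s => esym (translate_hface a k i s))).

Lemma hcone_tr k l n (x : HC n) : hcone (k * l)%g n (tr k n x) = tr k n.+1 (hcone l n x).
Proof.
rewrite /hcone [LHS]freeg_map_comp [RHS]freeg_map_comp; apply: eq_freeg_map => -[t s].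
by congr pair; apply: val_inj.
Qed.

Lemma Phi_tr k n (x : HC n) : Phi n (tr k n x) = tr k n (Phi n x).
Proof.
rewrite [LHS]freeg_map_comp [RHS]freeg_map_comp; apply: eq_freeg_map => -[t s].
congr pair; apply: eq_from_tnth => i; rewrite !tnth_map; exact: FE.
Qed.

Lemma hhom_tr k n (x : HC n) : hhom n (tr k n x) = tr k n.+1 (hhom n x).
Proof.
elim: n x => [|n IH] x.
  rewrite -[LHS]/((hhom 0 \o tr k 0 : {additive _ -> _}) x).
  rewrite -[RHS]/((tr k 1 \o hhom 0 : {additive _ -> _}) x).
  move: x; apply: freeg_additive_eq => x.
  rewrite -[LHS]/(hhom 0 (tr k 0 << x >>)) -[RHS]/(tr k 1 (hhom 0 << x >>)).
  rewrite [tr k 0 _]freeg_mapU ![hhom 0 _]fliftU thead_omit0 -hcone_tr.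
  by rewrite (raddfB (tr k 0)) -Phi_tr [tr k 0 _]freeg_mapU.
rewrite -[LHS]/((hhom n.+1 \o tr k n.+1 : {additive _ -> _}) x).
rewrite -[RHS]/((tr k n.+2 \o hhom n.+1 : {additive _ -> _}) x).
move: x; apply: freeg_additive_eq => x.
rewrite -[LHS]/(hhom n.+1 (tr k n.+1 << x >>)) -[RHS]/(tr k n.+2 (hhom n.+1 << x >>)).
rewrite [tr k n.+1 _]freeg_mapU ![hhom n.+1 _]fliftU thead_omit0 -hcone_tr.
by rewrite !(raddfB (tr k n.+1)) -Phi_tr -IH (cmapE (tr k)) [tr k n.+1 _]freeg_mapU.
Qed.

(** The homotopy [hhom] lives on homogeneous chains; commuting with translations ([hhom_tr]), it
    descends to orbits. *)
Lemma nerve_homotopy n (x : nerve_complex a n) : x \in @cyclep (nerve_complex a) n ->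
  exists y, nerve_map FE_self n x = x + bd (nerve_complex a) n y.
Proof.
pose pi := free_map (norm_smap a).
pose sg n : {additive nerve_complex a n -> HC n} := freeg_map (@expand G S n).
have pisg m z : pi m (sg m z) = z.
  by rewrite [LHS]freeg_map_comp; apply: freeg_map_id => b; apply: expandK.
have piPhi m z : pi m (Phi m (sg m z)) = nerve_map FE_self m z.
  by rewrite [LHS]freeg_map_comp [LHS]freeg_map_comp.
have pitr k m z : pi m (tr k m z) = pi m z.
  rewrite [LHS]freeg_map_comp; apply: eq_freeg_map => b; exact: norm_translate.
have pih m z : pi m.+1 (hhom m z) = pi m.+1 (hhom m (sg m (pi m z))).
  rewrite -[LHS]/((pi m.+1 \o hhom m : {additive _ -> _}) z).
  rewrite -[RHS]/((pi m.+1 \o hhom m \o sg m \o pi m : {additive _ -> _}) z).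
  move: z; apply: freeg_additive_eq => b.
  rewrite -[LHS]/(pi m.+1 (hhom m << b >>)).
  rewrite -[RHS]/(pi m.+1 (hhom m (sg m (pi m << b >>)))).
  rewrite [pi m _]freeg_mapU [sg m _]freeg_mapU [expand _]expand_norm.
  have -> : << translate a (thead b.1)^-1%g b >> = tr (thead b.1)^-1%g m << b >>.
    by rewrite [RHS]freeg_mapU.
  by rewrite hhom_tr pitr.
case: n x => [|n] x => [_|/cyclepS x0].
  exists (pi 1 (hhom 0 (sg 0 x))); rewrite -(cmapE pi) hhom0_bd raddfB piPhi pisg.
  by rewrite addrC subrK.
exists (pi n.+2 (hhom n.+1 (sg n.+1 x))); rewrite -(cmapE pi) hhom_bd !raddfB piPhi pisg.
have -> : pi n.+1 (hhom n (bd HC n (sg n.+1 x))) = 0.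
  by rewrite pih (cmapE pi) pisg x0 !raddf0.
by rewrite subr0 addrC subrK.
Qed.

End Homotopy.

(** * Shapiro's lemma *)

Lemma mult1 (G H : groupType) (f : {multiplicative G -> H}) : f 1%g = 1%g.
Proof. by apply: (mulgI (f 1%g)); rewrite -gmulfM !mulg1. Qed.

Lemma multV (G H : groupType) (f : {multiplicative G -> H}) g : f g^-1%g = (f g)^-1%g.
Proof. by apply: (mulgI (f g)); rewrite -gmulfM !mulgV mult1. Qed.

Definition trivial_action (H : groupType) : action H unit :=
  @Action H unit (fun _ s => s) (fun _ => erefl) (fun _ _ _ => erefl).

Definition point_complex (H : groupType) : complex := nerve_complex (trivial_action H).

Lemma point_map_subproof (H G : groupType) (i : {multiplicative H -> G}) k (s : unit) :
  exists c, trivial_action H k s = trivial_action G c s /\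
    forall g, i (k * g)%g = (c * i g)%g.
Proof. by exists (i k); split=> // g; rewrite gmulfM. Qed.

Definition point_map (H G : groupType) (i : {multiplicative H -> G}) :
    chain_map (point_complex H) (point_complex G) :=
  nerve_map (a := trivial_action H) (a' := trivial_action G) (F := fun _ => i)
    (f := id) (@point_map_subproof H G i).

Section Equivariant.
Variables (G G' : groupType) (S S' : choiceType) (a : action G S) (a' : action G' S').
Variables (u : {multiplicative G' -> G}) (v : S' -> S).
Hypothesis uvE : forall g s, v (a' g s) = a (u g) (v s).

Lemma equiv_map_subproof k s : exists c, v (a' k s) = a c (v s) /\
  forall g, u (k * g)%g = (c * u g)%g.
Proof. by exists (u k); split=> [|g]; rewrite ?uvE ?gmulfM. Qed.

Definition equiv_map : chain_map (nerve_complex a') (nerve_complex a) :=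
  nerve_map (F := fun _ => u) (f := v) equiv_map_subproof.

End Equivariant.

Section NerveComp.
Variables (G1 G2 G3 : groupType) (S1 S2 S3 : choiceType).
Variables (a1 : action G1 S1) (a2 : action G2 S2) (a3 : action G3 S3).
Variables (F : S1 -> G1 -> G2) (f : S1 -> S2) (F' : S2 -> G2 -> G3) (f' : S2 -> S3).
Variables (F3 : S1 -> G1 -> G3) (f3 : S1 -> S3).
Hypothesis FE : forall k s, exists c, f (a1 k s) = a2 c (f s) /\
  forall g, F (a1 k s) (k * g)%g = (c * F s g)%g.
Hypothesis FE' : forall k s, exists c, f' (a2 k s) = a3 c (f' s) /\
  forall g, F' (a2 k s) (k * g)%g = (c * F' s g)%g.
Hypothesis FE3 : forall k s, exists c, f3 (a1 k s) = a3 c (f3 s) /\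
  forall g, F3 (a1 k s) (k * g)%g = (c * F3 s g)%g.
Hypothesis H3 : forall s, exists c, f' (f s) = a3 c (f3 s) /\
  forall g, F' (f s) (F s g) = (c * F3 s g)%g.

Lemma nerve_map_comp n x :
  nerve_map FE' n (nerve_map FE n x) = nerve_map FE3 n x.
Proof.
rewrite [LHS]freeg_map_comp; apply: eq_freeg_map => b /=.
rewrite {2}/nmap (nmap_norm FE') /nmap; set e := expand b.
have [c [fc Fc]] := H3 e.2; rewrite -(norm_translate a3 c (hmap F3 f3 e)); congr norm.
rewrite /hmap /translate /= fc; congr pair.
by apply: eq_from_tnth => i; rewrite !tnth_map Fc.
Qed.

End NerveComp.

Section Shapiro.
Variables (G H : groupType) (S : choiceType) (a : action G S).
Variables (i : {multiplicative H -> G}) (s0 : S) (gam : S -> G).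
Hypothesis i_inj : injective i.
Hypothesis i_stab : forall g, a g s0 = s0 <-> exists h, i h = g.
Hypothesis gamE : forall s, a (gam s) s0 = s.

(** The right-hand side moves s0 to g^-1 s, then to s, then back to s0. *)
Lemma stab_coord_subproof s g : exists h,
  i h = ((gam s)^-1 * g * gam (a g^-1 s))%g.
Proof. by apply/i_stab; rewrite !actM gamE actKV -{2}[s]gamE actK. Qed.

Definition stab_coord s g : H := sval (cid (stab_coord_subproof s g)).

Lemma stab_coordE s g : i (stab_coord s g) = ((gam s)^-1 * g * gam (a g^-1 s))%g.
Proof. by rewrite /stab_coord; case: cid. Qed.

Lemma retraction_subproof k s : exists c,
  tt = trivial_action H c tt /\
  forall g, stab_coord (a k s) (k * g)%g = (c * stab_coord s g)%g.
Proof.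
have [|c cE] := (i_stab ((gam (a k s))^-1 * k * gam s)%g).1.
  by rewrite !actM gamE -{2}[a k s]gamE actK.
exists c; split=> // g; apply: i_inj; rewrite gmulfM !stab_coordE cE.
by rewrite invgM actM actK -!mulgA mulVKg.
Qed.

Definition retraction : chain_map (nerve_complex a) (point_complex H) :=
  nerve_map (a := a) (a' := trivial_action H) (F := stab_coord) (f := fun _ => tt)
    retraction_subproof.

Lemma i_stab_act h : a (i h) s0 = s0.
Proof. by apply/i_stab; exists h. Qed.

Lemma orbit_map_subproof g (s : unit) : s0 = a (i g) s0.
Proof. by rewrite i_stab_act. Qed.

Definition orbit_map : chain_map (point_complex H) (nerve_complex a) :=
  equiv_map (a' := trivial_action H) (v := fun _ : unit => s0) orbit_map_subproof.

(** Up to translation by [gam s], the composite is induced by g |-> g gam(g^-1 s), which commutes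
    with left translations, so [nerve_homotopy] applies. *)
Lemma orbit_retraction n (x : nerve_complex a n) : x \in @cyclep (nerve_complex a) n ->
  exists y, orbit_map n (retraction n x) = x + bd (nerve_complex a) n y.
Proof.
pose F s g := (g * gam (a g^-1 s))%g.
have FE k s g : F (a k s) (k * g)%g = (k * F s g)%g.
  by rewrite /F invgM actM actK mulgA.
move=> /(nerve_homotopy FE)[y yE]; exists y; rewrite -yE.
apply: nerve_map_comp => s; exists (gam s)^-1%g; split=> [|g].
  by rewrite -{2}[s]gamE actK.
by rewrite stab_coordE /F mulgA.
Qed.

End Shapiro.

Section Comparison.
Variables (G G' H H' : groupType) (S S' : choiceType).
Variables (a : action G S) (a' : action G' S').
Variables (i : {multiplicative H -> G}) (s0 : S) (gam : S -> G).
Hypothesis i_inj : injective i.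
Hypothesis i_stab : forall g, a g s0 = s0 <-> exists h, i h = g.
Hypothesis gamE : forall s, a (gam s) s0 = s.
Variables (i' : {multiplicative H' -> G'}) (s0' : S') (gam' : S' -> G').
Hypothesis i'_inj : injective i'.
Hypothesis i'_stab : forall g, a' g s0' = s0' <-> exists h, i' h = g.
Hypothesis gamE' : forall s, a' (gam' s) s0' = s.
Variables (u : {multiplicative G' -> G}) (v : S' -> S) (w : {multiplicative H' -> H}).
Hypothesis uvE : forall g s, v (a' g s) = a (u g) (v s).
Hypothesis v0 : v s0' = s0.
Hypothesis wE : forall h, i (w h) = u (i' h).
Hypothesis gamv : forall s, gam (v s) = u (gam' s).

Let uv := equiv_map uvE.
Let r := retraction i_inj i_stab gamE.
Let r' := retraction i'_inj i'_stab gamE'.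
Let j := orbit_map i_stab.
Let j' := orbit_map i'_stab.

(** The compatibility [gamv] of the representatives makes this square commute on chains, not only in
    homology. *)
Lemma retraction_equiv n x : r n (uv n x) = point_map w n (r' n x).
Proof.
have FE k s : exists c, tt = trivial_action H c tt /\
    forall g, w (stab_coord i'_stab gamE' (a' k s) (k * g)%g) =
      (c * w (stab_coord i'_stab gamE' s g))%g.
  have [c [_ cE]] := retraction_subproof i'_inj i'_stab gamE' k s.
  by exists (w c); split=> // g; rewrite cE gmulfM.
transitivity (nerve_map (a := a') (a' := trivial_action H)
    (F := fun s g => w (stab_coord i'_stab gamE' s g)) (f := fun _ => tt) FE n x).
  apply: nerve_map_comp => s; exists 1%g; split=> // g; rewrite mul1g; apply: i_inj.
  rewrite wE !stab_coordE gamv.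
  have -> : gam (a (u g)^-1%g (v s)) = u (gam' (a' g^-1%g s)).
    by rewrite -gamv uvE multV.
  by rewrite !gmulfM multV.
by symmetry; apply: nerve_map_comp => s; exists 1%g; split=> // g; rewrite mul1g.
Qed.

Lemma orbit_equiv n x : uv n (j' n x) = j n (point_map w n x).
Proof.
have FE k (s : unit) : exists c, s0 = a c s0 /\
    forall g, u (i' (k * g)%g) = (c * u (i' g))%g.
  exists (u (i' k)); split=> [|g]; last by rewrite !gmulfM.
  by rewrite -wE i_stab_act.
transitivity (nerve_map (a := trivial_action H') (a' := a)
    (F := fun _ g => u (i' g)) (f := fun _ => s0) FE n x).
  by apply: nerve_map_comp => s; exists 1%g; rewrite act1 v0; split=> // g; rewrite mul1g.
symmetry; apply: nerve_map_comp => s; exists 1%g.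
by rewrite act1; split=> // g; rewrite mul1g wE.
Qed.

(* The mapping cone of uv is acyclic in degree n + 1 as soon as that of w is. *)
Lemma comparison_acyclic n :
  (forall x, x \in @cyclep (point_complex H) n.+1 -> exists y z,
     y \in @cyclep (point_complex H') n.+1 /\
     x = point_map w n.+1 y + bd (point_complex H) n.+1 z) ->
  (forall y z, y \in @cyclep (point_complex H') n ->
     point_map w n y = bd (point_complex H) n z ->
     exists z', y = bd (point_complex H') n z') ->
  forall x x', bd (nerve_complex a) n x = uv n x' ->
    x' \in @cyclep (nerve_complex a') n ->
    exists y y', x = bd (nerve_complex a) n.+1 y + uv n.+1 y' /\
      x' = bd (nerve_complex a') n y'.
Proof.
move=> surj inj x x' dx cx'.
have [z'] : exists z, r' n x' = bd (point_complex H') n z.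
  apply: (inj _ (r n.+1 x)); first exact: cyclep_cmap.
  by rewrite -retraction_equiv -dx cmapE.
have [y0 y0E] := orbit_retraction i'_inj i'_stab gamE' cx'.
move/(congr1 (j' n)); rewrite y0E cmapE => /(canRL (addrK _)); rewrite -raddfB => x'E.
set b1 := (_ - y0) in x'E.
(* Injectivity for [w] has bounded x' by [b1]; what is left of x is a cycle, to which surjectivity
   for [w] applies one degree higher. *)
have cx1 : x - uv n.+1 b1 \in @cyclep (nerve_complex a) n.+1.
  by apply/cyclepS; rewrite raddfB dx x'E cmapE subrr.
have [y1 y1E] := orbit_retraction i_inj i_stab gamE cx1.
have [c' [d [cc' cE]]] := surj _ (cyclep_cmap r cx1).
move: y1E; rewrite cE raddfD -orbit_equiv (cmapE j) => xE.
exists (j n.+2 d - y1), (b1 + j' n.+1 c'); split; last first.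
  by rewrite raddfD -(cmapE j') ((cyclepS c').1 cc') raddf0 addr0.
rewrite raddfB raddfD -[LHS](subrK (uv n.+1 b1)).
rewrite -[X in X + _ = _](addrK (bd (nerve_complex a) n.+1 y1)) -xE.
by rewrite -[in LHS]addrA -[in LHS]addrA addrC -!addrA; do ?congr (_ + _); rewrite addrC.
Qed.

End Comparison.

(** * Comparison with the bar complexes of the definitions *)

Lemma boundariesP (C : complex) n (z : cycles C n) :
  z \in spanp (@boundaries C n) <-> exists y, val z = bd C n y.
Proof.
split=> [|zE]; last exact: mem_spanp.
move: z; apply: spanp_ind => [|x y [x' xE] [y' yE]|//]; first by exists 0; rewrite !raddf0.
by exists (x' - y'); rewrite !raddfB /= xE yE.
Qed.

Lemma image_relP (C D : complex) (f : chain_map C D) n x :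
  x \in spanp (@image_rel C D f n) <-> exists y, x = f n y.
Proof.
split=> [|xE]; last exact: mem_spanp.
move: x; apply: spanp_ind => [|x y [x' ->] [y' ->]|//]; first by exists 0; rewrite raddf0.
by exists (x' - y'); rewrite raddfB.
Qed.

Lemma homology_map_pi (C D : complex) (f : chain_map C D) n z :
  homology_map f n (quo_pi _ z) = quo_pi _ (Defs.cycle_map f z).
Proof. exact: quo_map_pi. Qed.

Section GroupComplex.
Variable G : groupType.

Definition std_norm_smap : simplicial_map (std_simplicial G) (nerve (trivial_action G)) :=
  @SimplicialMap (std_simplicial G) (nerve (trivial_action G))
    (fun n t => norm (trivial_action G) (t, tt))
    (fun n i t => esym (nface_norm (trivial_action G) i (t, tt))).

Definition std_norm : chain_map (std_resolution G) (point_complex G) :=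
  free_map std_norm_smap.

Definition std_class n : {additive std_resolution G n -> group_complex G n} := quo_pi _.

(** Every orbit of tuples has exactly one member starting with 1, so this is an isomorphism onto the
    coinvariants. It moves the hypotheses and the conclusion of the theorem to nerves. *)
Definition point_to_group n : {additive point_complex G n -> group_complex G n} :=
  std_class n \o freeg_map (fun b : n.-tuple G * unit => [tuple of 1%g :: b.1]).

Lemma point_to_group_norm n (y : std_resolution G n) :
  std_class n y = point_to_group n (std_norm n y).
Proof.
move: y; apply: freeg_ind => [|x y hx hy|t]; first by rewrite !raddf0.
  by rewrite !raddfB hx hy.
rewrite /point_to_group /= [std_norm n _]freeg_mapU freeg_mapU.
apply/esym/quo_pi_eq/mem_spanp; exists (thead t)^-1%g, << t >>.
rewrite freeg_mapU; congr (<< _ >> - _).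
have := congr1 fst (expand_norm (trivial_action G) (t, tt)).
exact.
Qed.

Lemma std_norm_act g n (y : std_resolution G n) :
  std_norm n (std_map (fun h => (g * h)%g) n y) = std_norm n y.
Proof.
rewrite [LHS]freeg_map_comp; apply: eq_freeg_map => t.
exact: (norm_translate (trivial_action G) g (t, tt)).
Qed.

Lemma std_norm_expand n (x : point_complex G n) :
  std_norm n (freeg_map (fun b : n.-tuple G * unit => [tuple of 1%g :: b.1]) x) = x.
Proof.
rewrite [LHS]freeg_map_comp; apply: freeg_map_id => -[b []].
exact: (expandK (trivial_action G) (b, tt)).
Qed.

(** [std_norm] kills the relations g m - m and is a left inverse of the insertion of 1. *)
Lemma point_to_group_inj n : injective (point_to_group n).
Proof.
move=> x y xy; apply/eqP; rewrite -subr_eq0.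
have : point_to_group n (x - y) = 0 by rewrite raddfB xy subrr.
set w := x - y => /quo_pi_eq0 w0; rewrite -[w]std_norm_expand; apply/eqP.
move: (freeg_map _ w) w0; apply: spanp_ind => [|u v hu hv|_ [g [m ->]]].
- exact: raddf0.
- by rewrite raddfB hu hv subrr.
by rewrite raddfB std_norm_act subrr.
Qed.

Lemma point_to_group_surj n (w : group_complex G n) : exists x, w = point_to_group n x.
Proof. by have [y ->] := quo_piP w; exists (std_norm n y); rewrite point_to_group_norm. Qed.

Lemma point_to_group_bd n (x : point_complex G n.+1) :
  point_to_group n (bd (point_complex G) n x) =
  bd (group_complex G) n (point_to_group n.+1 x).
Proof.
rewrite -[in LHS](std_norm_expand x) -(cmapE std_norm) -point_to_group_norm.
by rewrite /point_to_group /= /coinv_bd /coinv_map /= quo_map_pi.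
Qed.

Lemma point_to_group_cyclep n (x : point_complex G n) :
  point_to_group n x \in @cyclep (group_complex G) n <-> x \in @cyclep (point_complex G) n.
Proof.
case: n x => [//|n] x; split=> /cyclepS x0; apply/cyclepS.
  by apply: point_to_group_inj; rewrite point_to_group_bd x0 raddf0.
by rewrite -point_to_group_bd x0 raddf0.
Qed.

End GroupComplex.

Section GroupComplexMap.
Variables (G' G : groupType) (f : {multiplicative G' -> G}).

Lemma point_to_group_map n (x : point_complex G' n) :
  group_map f n (point_to_group G' n x) = point_to_group G n (point_map f n x).
Proof.
rewrite [LHS]quo_map_pi point_to_group_norm; congr (point_to_group G n _).
rewrite [LHS]freeg_map_comp [LHS]freeg_map_comp; apply: eq_freeg_map => -[b []] /=.
congr norm; congr pair; apply: val_inj.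
Qed.

Section Bij.
Variable n : nat.
Hypothesis bij : bijective (group_homology_map f n).

Lemma group_homology_bij_surj x : x \in @cyclep (point_complex G) n -> exists y z,
  y \in @cyclep (point_complex G') n /\
  x = point_map f n y + bd (point_complex G) n z.
Proof.
move=> cx; have [h _ hK] := bij.
have cx' := (point_to_group_cyclep x).2 cx.
have [z' zE] := quo_piP (h (quo_pi _ (Cycle cx'))).
have := hK (quo_pi _ (Cycle cx')); rewrite zE [LHS]homology_map_pi.
move=> /quo_pi_eqP/boundariesP[v]; rewrite raddfB => vE.
have {}vE : group_map f n (val z') - point_to_group G n x = bd (group_complex G) n v.
  exact: vE.
have [y yE] := point_to_group_surj (val z'); have [w wE] := point_to_group_surj v.
have cy : y \in @cyclep (point_complex G') n.
  by apply/point_to_group_cyclep; rewrite -yE; case: z' {zE vE yE}.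
exists y, (- w); split=> //; apply: point_to_group_inj.
rewrite raddfD -point_to_group_map point_to_group_bd !raddfN -wE -vE -yE.
by rewrite opprB addrC subrK.
Qed.

Lemma group_homology_bij_inj y z : y \in @cyclep (point_complex G') n ->
  point_map f n y = bd (point_complex G) n z ->
  exists z', y = bd (point_complex G') n z'.
Proof.
move=> cy yz; have cy' := (point_to_group_cyclep y).2 cy.
have h0 : group_homology_map f n (quo_pi _ (Cycle cy')) = group_homology_map f n 0.
  rewrite raddf0 [LHS]homology_map_pi; apply/quo_pi_eq0/boundariesP => /=.
  by exists (point_to_group _ _ z); rewrite point_to_group_map yz point_to_group_bd.
have /quo_pi_eq0/boundariesP[v vE] := bij_inj bij h0.
have {}vE : point_to_group G' n y = bd (group_complex G') n v by exact: vE.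
have [w wE] := point_to_group_surj v; exists w.
by apply: point_to_group_inj; rewrite vE wE point_to_group_bd.
Qed.

End Bij.

Definition rel_class n (al : rel_group_homology f n) (x : point_complex G n) : Prop :=
  exists c : cycles (coker_complex (group_map f)) n,
    val c = quo_pi _ (point_to_group G n x) /\ al = quo_pi _ c.

Lemma rel_class_total n al : exists x, @rel_class n al x.
Proof.
have [c ->] := quo_piP al; have [w wE] := quo_piP (val c).
by have [x xE] := point_to_group_surj w; exists x, c; rewrite wE xE.
Qed.

Lemma rel_classB n al be x y :
  @rel_class n al x -> @rel_class n be y -> rel_class (al - be) (x - y).
Proof.
move=> [c [cE ->]] [d [dE ->]]; exists (c - d); rewrite !raddfB /= cE dE.
by rewrite -!raddfB.
Qed.

Lemma rel_class_bd n al x : @rel_class n.+1 al x ->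
  exists x', bd (point_complex G) n x = point_map f n x'.
Proof.
move=> [c [cE _]]; have /cyclepS : val c \in cyclep (n := n.+1) by case: c {cE}.
rewrite cE [LHS]quo_map_pi => /quo_pi_eq0/image_relP[y yE].
have [x' x'E] := point_to_group_surj y; exists x'; apply: point_to_group_inj.
by rewrite point_to_group_bd yE x'E point_to_group_map.
Qed.

Lemma rel_class_ex n x x' : bd (point_complex G) n x = point_map f n x' ->
  exists al, @rel_class n.+1 al x.
Proof.
move=> xx'.
have c0 : (quo_pi _ (point_to_group G n.+1 x) : coker_complex (group_map f) n.+1)
    \in @cyclep (coker_complex (group_map f)) n.+1.
  apply/cyclepS; rewrite [LHS]quo_map_pi; apply/quo_pi_eq0/image_relP.
  by exists (point_to_group _ _ x'); rewrite -point_to_group_bd xx' point_to_group_map.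
by exists (quo_pi _ (Cycle c0)), (Cycle c0).
Qed.

Lemma rel_class0 n x : @rel_class n 0 x -> exists y y',
  x = bd (point_complex G) n y + point_map f n y'.
Proof.
move=> [c [cE /esym/quo_pi_eq0/boundariesP[y yE]]].
have [v vE] := quo_piP y; have [w wE] := point_to_group_surj v.
move: yE; rewrite cE vE [RHS]quo_map_pi => /quo_pi_eqP/image_relP[y' y'E].
have [w' w'E] := point_to_group_surj y'; exists w, w'; apply: point_to_group_inj.
rewrite raddfD -point_to_group_map point_to_group_bd -wE -w'E -y'E.
by rewrite addrC subrK.
Qed.

Lemma rel_class_eq0 n al y y' :
  @rel_class n al (bd (point_complex G) n y + point_map f n y') -> al = 0.
Proof.
move=> [c [cE ->]]; apply/quo_pi_eq0/boundariesP.
exists (quo_pi _ (point_to_group _ _ y)); rewrite cE [RHS]quo_map_pi.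
apply/quo_pi_eqP/image_relP; exists (point_to_group _ _ y').
by rewrite raddfD -point_to_group_map point_to_group_bd addrC addKr.
Qed.

End GroupComplexMap.

(** * Lines, edges and triangles *)

Section Geometry.
Variable A : comPzRingType.
Implicit Types (a b c d x y : A) (u v : 'cV[A]_2) (g h : SL2 A).

Definition cv a b : 'cV[A]_2 := \col_i if i == 0 then a else b.

Lemma cvE u : u = cv (u 0 0) (u 1 0).
Proof. by apply/colP; elim/ord2P; rewrite !mxE. Qed.

Lemma vec_infE : vec_inf A = cv 1 0.
Proof. by apply/colP; elim/ord2P; rewrite !mxE. Qed.

Lemma vec_zeroE : vec_zero A = cv 0 1.
Proof. by apply/colP; elim/ord2P; rewrite !mxE. Qed.

Lemma vec_ptE a : vec_pt a = cv 1 a.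
Proof. by apply/colP; elim/ord2P; rewrite !mxE /= ?mulr0 ?addr0 ?add0r ?mulr1. Qed.

Lemma mx2_cv a b c d x y : mx2 a b c d *m cv x y = cv (a * x + b * y) (c * x + d * y).
Proof.
apply/colP; elim/ord2P; rewrite !mxE !big_ord_recl big_ord0 !mxE /= addr0 //.
Qed.

Lemma scale_cv c a b : c *: cv a b = cv (c * a) (c * b).
Proof. by apply/colP; elim/ord2P; rewrite !mxE. Qed.

Lemma vdet_cv a b c d : vdet (cv a b) (cv c d) = a * d - c * b.
Proof. by rewrite /vdet !mxE. Qed.

Lemma SL2_cv g : val g = mx2 (g 0 0) (g 0 1) (g 1 0) (g 1 1).
Proof. by apply: eq_mx2; rewrite !mxE. Qed.

Lemma SL2_det g : g 0 0 * g 1 1 - g 0 1 * g 1 0 = 1.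
Proof. by rewrite -det_mx2E det_SL2. Qed.

Lemma vdet_SL2 g u v : vdet (val g *m u) (val g *m v) = vdet u v.
Proof.
rewrite [u]cvE [v]cvE SL2_cv !mx2_cv !vdet_cv -[RHS]mul1r -(SL2_det g).
move: (g 0 0) (g 0 1) (g 1 0) (g 1 1) (u 0 0) (u 1 0) (v 0 0) (v 1 0).
by move=> *; ring.
Qed.

Lemma line_eqP c u v : is_unit c -> v = c *: u -> line v = line u.
Proof. by move=> hc ->; apply: line_scale. Qed.

Lemma X_act_simplex1 n (s : X_simplex A n) : X_act_simplex 1%g s = s.
Proof.
apply: val_inj; apply: eq_from_tnth => i; rewrite tnth_map.
apply/seteqP; split=> w /= => [[w' hw' <-]|hw]; rewrite ?mul1mx //.
by exists w; rewrite ?mul1mx.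
Qed.

Lemma X_act_simplexM n g h (s : X_simplex A n) :
  X_act_simplex (g * h)%g s = X_act_simplex g (X_act_simplex h s).
Proof.
apply: val_inj; apply: eq_from_tnth => i; rewrite !tnth_map.
apply/seteqP; split=> w /= => [[w' hw' <-]|[w' [w'' hw'' <-] <-]].
  by exists (val h *m w'); [exists w' | rewrite mulmxA].
by exists w''; rewrite ?mulmxA.
Qed.

Definition X_action n : action (SL2 A) (X_simplex A n) :=
  @Action _ _ (fun g => @X_act_simplex A g n) (@X_act_simplex1 n) (@X_act_simplexM n).

Lemma X_vert_subproof u : unimodular u -> `[< X_admissible [tuple line u] >].
Proof.
move=> hu; apply/asboolP; exists (fun _ => u); split=> //.
  by case=> [[|//] ?]; rewrite (tnth_nth set0).
by case=> [[|//] ?] [[|//] ?].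
Qed.
Definition X_vert u (hu : unimodular u) : X_simplex A 0 := XSimplex (X_vert_subproof hu).

Lemma row_mx_colE u v i : (row_mx u v : 'M[A]_2) i 0 = u i 0 /\ (row_mx u v : 'M[A]_2) i 1 = v i 0.
Proof.
split; first by rewrite -[RHS](row_mxEl u v); congr (row_mx u v i _); apply: val_inj.
by rewrite -[RHS](row_mxEr u v); congr (row_mx u v i _); apply: val_inj.
Qed.

Lemma row_mxE2 u v : row_mx u v = mx2 (u 0 0) (v 0 0) (u 1 0) (v 1 0).
Proof.
by apply: eq_mx2; rewrite [RHS]mxE /=;
  [apply: (row_mx_colE u v 0).1 | apply: (row_mx_colE u v 0).2
  |apply: (row_mx_colE u v 1).1 | apply: (row_mx_colE u v 1).2].
Qed.

Lemma vdet_unimodular u v : is_unit (vdet u v) -> unimodular u /\ unimodular v.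
Proof.
move=> h; have h' : is_unit (vdet v u) by move/is_unitN: h; rewrite /vdet opprB.
have col (x y : 'cV[A]_2) : is_unit (vdet x y) -> unimodular x.
  move=> xy; exists (row_mx x y); split; first exact: invertible_row_mx.
  by apply/colP => i; rewrite mxE (row_mx_colE x y i).1.
by split; [apply: col h | apply: col h'].
Qed.

Lemma X_edge_subproof u v : is_unit (vdet u v) -> `[< X_admissible [tuple line u; line v] >].
Proof.
move=> h; have [hu hv] := vdet_unimodular h; apply/asboolP.
exists (tnth [tuple u; v]); split.
- by case=> [[|[|//]] ?]; rewrite (tnth_nth 0).
- by case=> [[|[|//]] ?]; rewrite !(tnth_nth set0) (tnth_nth 0).
case=> [[|[|//]] ?] [[|[|//]] ?] //= _; rewrite !(tnth_nth 0) /=.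
  exact: invertible_row_mx.
by apply: invertible_row_mx; move/is_unitN: h; rewrite /vdet opprB.
Qed.
Definition X_edge u v (h : is_unit (vdet u v)) : X_simplex A 1 :=
  XSimplex (X_edge_subproof h).

Lemma X_vert_eq u u' (h : unimodular u) (h' : unimodular u') :
  line u = line u' -> X_vert h = X_vert h'.
Proof. by move=> e1; apply: val_inj; apply: val_inj; rewrite /= e1. Qed.

Lemma X_act_edge g u v u' v' (h : is_unit (vdet u v)) (h' : is_unit (vdet u' v')) :
  line (val g *m u) = line u' -> line (val g *m v) = line v' ->
  X_act_simplex g (X_edge h) = X_edge h'.
Proof. by move=> e1 e2; apply: val_inj; apply: val_inj; rewrite /= !line_actE e1 e2. Qed.

Lemma X_act_vert g u u' (h : unimodular u) (h' : unimodular u') :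
  line (val g *m u) = line u' -> X_act_simplex g (X_vert h) = X_vert h'.
Proof. by move=> e1; apply: val_inj; apply: val_inj; rewrite /= !line_actE e1. Qed.

Lemma vdet_sym u v : is_unit (vdet u v) -> is_unit (vdet v u).
Proof. by move/is_unitN; rewrite /vdet opprB. Qed.

Lemma X_edge_face0 u v (h : is_unit (vdet u v)) (hv : unimodular v) :
  X_face ord0 (X_edge h) = X_vert hv.
Proof.
apply: val_inj; apply: eq_from_tnth => -[[|//] i].
by rewrite tnth_mktuple !(tnth_nth set0).
Qed.

Lemma X_edge_face1 u v (h : is_unit (vdet u v)) (hu : unimodular u) :
  X_face (fintype.lift ord0 ord0) (X_edge h) = X_vert hu.
Proof.
apply: val_inj; apply: eq_from_tnth => -[[|//] i].
by rewrite tnth_mktuple !(tnth_nth set0).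
Qed.

(** Dividing the second column by the determinant makes the determinant 1 and moves neither line. *)
Lemma invertible2_SL2_lines (M : 'M[A]_2) : invertible2 M -> exists g,
  line (val g *m vec_inf A) = line (col 0 M) /\
  line (val g *m vec_zero A) = line (col 1 M).
Proof.
move=> [N [/(congr1 determinant)]]; rewrite det_mulmx det1 => MN _.
have dd : M 0 0 * (\det N * M 1 1) - (\det N * M 0 1) * M 1 0 = 1.
  rewrite -MN (det_mx2E M); move: (\det N) (M 0 0) (M 1 1) (M 0 1) (M 1 0) => *; ring.
exists (SL2Mx (SL2_mx2_subproof dd)); rewrite /= vec_infE vec_zeroE !mx2_cv.
rewrite !(mulr0, mulr1, addr0, add0r); split.
  by congr line; apply/colP; elim/ord2P; rewrite !mxE.
apply: (@line_eqP (\det N)); first by exists (\det M); rewrite mulrC.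
by apply/colP; elim/ord2P; rewrite !mxE.
Qed.

Definition X_inf : X_simplex A 0 := X_vert (vdet_unimodular (vdet_inf_zero A)).1.
Definition X_zero : X_simplex A 0 := X_vert (vdet_unimodular (vdet_inf_zero A)).2.
Definition edge_iz : X_simplex A 1 := X_edge (vdet_inf_zero A).
Definition edge_zi : X_simplex A 1 := X_edge (vdet_zero_inf A).

Lemma X_vertP (s : X_simplex A 0) : exists u (hu : unimodular u), s = X_vert hu.
Proof.
case: s => t /= /[dup] /asboolP[v [vu vt _]] adm.
exists (v ord0), (vu ord0); apply: val_inj; apply: eq_from_tnth => -[[|//] i] /=.
by rewrite (_ : Ordinal i = ord0) ?vt ?(tnth_nth set0) //; apply: val_inj.
Qed.

Lemma X_edgeP (s : X_simplex A 1) : exists u v (h : is_unit (vdet u v)), s = X_edge h.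
Proof.
case: s => t /= /[dup] /asboolP[v [vu vt vi]] adm.
have h : is_unit (vdet (v 0) (v 1)).
  have [N [/(congr1 determinant) + _]] := vi 0 1 isT.
  rewrite det_mulmx det1 row_mxE2 det_mx2E !mxE /= => MN.
  by exists (\det N); rewrite /vdet.
exists (v 0), (v 1), h; apply: val_inj; apply: eq_from_tnth.
by elim/ord2P; rewrite /= vt (tnth_nth set0).
Qed.

Lemma X_vert_trans (s : X_simplex A 0) : exists g, X_act_simplex g X_inf = s.
Proof.
have [u [hu ->]] := X_vertP s; have [M [Mi uE]] := hu.
have [g [g0 g1]] := invertible2_SL2_lines Mi; exists g.
by apply: X_act_vert; rewrite g0 uE.
Qed.

Lemma X_edge_trans2 u v (h : is_unit (vdet u v)) : exists g,
  X_act_simplex g edge_iz = X_edge h /\ X_act_simplex g edge_zi = X_edge (vdet_sym h).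
Proof.
have [g [g0 g1]] := invertible2_SL2_lines (invertible_row_mx h); exists g.
have c0 : col 0 (row_mx u v) = u by apply/colP => i; rewrite mxE (row_mx_colE u v i).1.
have c1 : col 1 (row_mx u v) = v by apply/colP => i; rewrite mxE (row_mx_colE u v i).2.
by split; apply: X_act_edge; rewrite ?g0 ?g1 ?c0 ?c1.
Qed.

Lemma X_edge_trans (s : X_simplex A 1) : exists g, X_act_simplex g edge_iz = s.
Proof.
by have [u [v [h ->]]] := X_edgeP s; have [g [gE _]] := X_edge_trans2 h; exists g.
Qed.

Lemma edge_iz_face0 : X_face ord0 edge_iz = X_zero.
Proof. exact: X_edge_face0. Qed.

Lemma edge_iz_face1 : X_face (fintype.lift ord0 ord0) edge_iz = X_inf.
Proof. exact: X_edge_face1. Qed.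

Lemma edge_zi_face0 : X_face ord0 edge_zi = X_inf.
Proof. by rewrite [LHS](X_edge_face0 _ (vdet_unimodular (vdet_inf_zero A)).1). Qed.

Lemma edge_zi_face1 : X_face (fintype.lift ord0 ord0) edge_zi = X_zero.
Proof. by rewrite [LHS](X_edge_face1 _ (vdet_unimodular (vdet_inf_zero A)).2). Qed.

Lemma X_bd0U (e : X_simplex A 1) : bd (X_complex A) 0 << e >> =
  << X_face ord0 e : X_simplicial A 0 >> - << X_face (fintype.lift ord0 ord0) e >>.
Proof.
rewrite free_bdU !big_ord_recl big_ord0 addr0 expr0 scale1r expr1 scaleN1r //.
Qed.

Lemma X_bd1_inf_zero a (ha : is_unit a) :
  bd (X_complex A) 1 << X_inf_zero ha >> =
  << X_edge (vdet_zero_pt a) : X_simplicial A 1 >> - << X_edge (vdet_inf_pt ha) >>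
  + << edge_iz >>.
Proof.
rewrite free_bdU !big_ord_recl big_ord0 addr0 expr0 scale1r expr1 scaleN1r addrA.
rewrite -[X in _ + X *: _]/((-1) ^+ 2) sqrrN expr1n scale1r.
by congr (<< _ >> - << _ >> + << _ >>); apply: val_inj; rewrite /= omit3.
Qed.

Lemma X_bd1_zero_inf a (ha : is_unit a) :
  bd (X_complex A) 1 << X_zero_inf ha >> =
  << X_edge (vdet_inf_pt ha) : X_simplicial A 1 >> - << X_edge (vdet_zero_pt a) >>
  + << edge_zi >>.
Proof.
rewrite free_bdU !big_ord_recl big_ord0 addr0 expr0 scale1r expr1 scaleN1r addrA.
rewrite -[X in _ + X *: _]/((-1) ^+ 2) sqrrN expr1n scale1r.
by congr (<< _ >> - << _ >> + << _ >>); apply: val_inj; rewrite /= omit3.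
Qed.

(** The edges through a cancel, so all the [psi1_pair] are lifts of one cycle h to triangles, and
    psi_1(a) is the difference of two such lifts. *)
Lemma X_bd1_pair a (ha : is_unit a) :
  bd (X_complex A) 1 (psi1_pair ha) =
  << edge_iz : X_simplicial A 1 >> + << edge_zi >>.
Proof.
rewrite /psi1_pair raddfD X_bd1_inf_zero X_bd1_zero_inf addrACA.
by rewrite -[X in _ + X + _]opprB subrr add0r.
Qed.

End Geometry.

(** * Exactness of the complex of lines *)

Section Exactness.
Variable A : comPzRingType.
Implicit Types (g h : SL2 A) (u v : word A).

Let X1 := {freeg (X_simplex A 1)}.
Local Notation act n g := (actf (X_action A n) g).

Lemma X_bd_act n g (x : X_complex A n.+1) :
  bd (X_complex A) n (act n.+1 g x) = act n g (bd (X_complex A) n x).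
Proof. exact: (esym (cmapE (X_act g) x)). Qed.

Lemma actU n g (s : X_simplex A n) : act n g << s >> = << X_act_simplex g s >>.
Proof. exact: freeg_mapU. Qed.

Definition bounds (z : X1) : Prop := exists y, z = bd (X_complex A) 1 y.

Lemma bounds0 : bounds 0.
Proof. by exists 0; rewrite raddf0. Qed.

Lemma boundsB y z : bounds y -> bounds z -> bounds (y - z).
Proof. by move=> [y' ->] [z' ->]; exists (y' - z'); rewrite raddfB. Qed.

Lemma boundsN z : bounds z -> bounds (- z).
Proof. by rewrite -sub0r; apply/boundsB/bounds0. Qed.

Lemma boundsD y z : bounds y -> bounds z -> bounds (y + z).
Proof. by move=> hy /boundsN; rewrite -{2}[z]opprK; apply: boundsB. Qed.

Lemma bounds_act g z : bounds z -> bounds (act 1 g z).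
Proof. by move=> [y ->]; exists (act 2 g y); rewrite X_bd_act. Qed.

Lemma bounds_trans y z w : bounds (y - z) -> bounds (z - w) -> bounds (y - w).
Proof. by move=> h1 /(boundsD h1); rewrite addrA subrK. Qed.

Lemma bounds_edge_sym (a b : 'cV[A]_2) (ab : is_unit (vdet a b)) :
  bounds (<< X_edge ab >> + << X_edge (vdet_sym ab) >>).
Proof.
have [g [<- <-]] := X_edge_trans2 ab; rewrite -!actU -raddfD; apply: bounds_act.
by exists (psi1_pair (is_unit1 A)); rewrite X_bd1_pair.
Qed.

Lemma bounds_iz_zi : bounds (<< edge_iz A >> + << edge_zi A >>).
Proof. by exists (psi1_pair (is_unit1 A)); rewrite X_bd1_pair. Qed.

Definition letter (p : A * bool) : SL2 A := if p.2 then (E2 p.1)^-1%g else E2 p.1.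

(** E(x) sends 0 to oo, so E(x)(0, oo) is an edge from oo to E(x) oo, while E(x)^-1 oo = 0 is
    reached from oo by running (0, oo) backwards. *)
Definition letter_path (p : A * bool) : X1 :=
  if p.2 then - << edge_zi A >> else act 1 (E2 p.1) << edge_zi A >>.

(* A word in the E(x) traces a path in the graph of lines, from oo to g oo. *)
Fixpoint word_path (u : word A) : X1 :=
  if u is p :: v then letter_path p + act 1 (letter p) (word_path v) else 0.

Local Notation ev := (word_eval (@E2 A)).

Lemma word_path_cons p u :
  word_path (p :: u) = letter_path p + act 1 (letter p) (word_path u).
Proof. by []. Qed.

Lemma ev_cons p u : ev (p :: u) = (letter p * ev u)%g.
Proof. exact: big_cons. Qed.

Lemma ev_nil : ev [::] = 1%g.
Proof. exact: big_nil. Qed.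

Lemma ev_cat u v : ev (u ++ v) = (ev u * ev v)%g.
Proof. exact: big_cat. Qed.

Lemma word_path_cat u v : word_path (u ++ v) = word_path u + act 1 (ev u) (word_path v).
Proof.
elim: u => [|p u IH]; first by rewrite add0r ev_nil actf1.
by rewrite cat_cons !word_path_cons IH ev_cons raddfD actfM addrA.
Qed.

Lemma E2_X_zero x : X_act_simplex (E2 x) (X_zero A) = X_inf A.
Proof.
apply: X_act_vert; rewrite /= vec_infE vec_zeroE mx2_cv.
by rewrite !(mulr0, mulr1, addr0, add0r).
Qed.

Lemma letter_path_bd p :
  bd (X_complex A) 0 (letter_path p) = << X_act_simplex (letter p) (X_inf A) >> - << X_inf A >>.
Proof.
case: p => x []; rewrite /letter /letter_path.
  rewrite raddfN [bd _ _ _]X_bd0U opprB edge_zi_face0 edge_zi_face1.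
  by rewrite -[in RHS](E2_X_zero x) -X_act_simplexM mulVg X_act_simplex1 E2_X_zero.
rewrite X_bd_act [bd _ _ _]X_bd0U edge_zi_face0 edge_zi_face1 raddfB !actU.
by rewrite E2_X_zero.
Qed.

Lemma word_path_bd u :
  bd (X_complex A) 0 (word_path u) = << X_act_simplex (ev u) (X_inf A) >> - << X_inf A >>.
Proof.
elim: u => [|p u IH]; first by rewrite raddf0 ev_nil X_act_simplex1 subrr.
rewrite word_path_cons raddfD letter_path_bd X_bd_act IH raddfB !actU ev_cons.
by rewrite X_act_simplexM addrC subrKA.
Qed.

Lemma word_path_rcons u x :
  word_path (u ++ Ew x) = word_path u + act 1 (ev (u ++ Ew x)) << edge_zi A >>.
Proof.
by rewrite word_path_cat word_path_cons raddf0 addr0 ev_cat actfM ev_cons ev_nil mulg1.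
Qed.

Lemma mx2_mul (a b c d a' b' c' d' : A) :
  mx2 a b c d *m mx2 a' b' c' d' =
  mx2 (a * a' + b * c') (a * b' + b * d') (c * a' + d * c') (c * b' + d * d').
Proof. by apply: eq_mx2; rewrite mulmx2E !mxE. Qed.

Lemma ev_Dw (a b : A) : a * b = 1 -> val (ev (Dw a b)) = mx2 a 0 0 b.
Proof.
move=> ab; rewrite !ev_cons ev_nil mulg1 /letter /= !mx2_mul.
have abC : b * a = 1 by rewrite mulrC.
by congr mx2; rewrite ?(mulrNN, ab, abC, mulr1, mulr0, mulN1r, mulrN, mulNr, mul0r, mul1r,
  opprK, addr0, add0r, addNr, subrr, oppr0, mulrDr).
Qed.

Lemma diag_edge_zi g (a b : A) : a * b = 1 -> val g = mx2 a 0 0 b ->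
  X_act_simplex g (edge_zi A) = edge_zi A.
Proof.
move=> ab gE; apply: X_act_edge; rewrite gE ?vec_infE ?vec_zeroE mx2_cv.
  by apply: (@line_eqP _ b); rewrite ?scale_cv; [exists a; rewrite mulrC | congr cv; ring].
by apply: (@line_eqP _ a); rewrite ?scale_cv; [exists b | congr cv; ring].
Qed.

(** The path visits oo, the point b, 0 and oo again. Up to reversals of edges it is minus the
    boundary of the triangle (oo, 0, b). *)
Lemma bounds_Dw (a b : A) : a * b = 1 -> bounds (word_path (Dw a b)).
Proof.
move=> ab; have ba : b * a = 1 by rewrite mulrC.
have ub : is_unit b by exists a.
have e3 : act 1 (ev (Dw a b)) << edge_zi A >> = << edge_zi A >>.
  by rewrite actU (diag_edge_zi ab) // ev_Dw.
have e1 : act 1 (E2 (- a)) << edge_zi A >> = << X_edge (vdet_inf_pt ub) >>.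
  rewrite actU; congr << _ >>; apply: X_act_edge; rewrite /= ?vec_infE ?vec_zeroE ?vec_ptE mx2_cv.
    by congr line; congr cv; ring.
  apply: (@line_eqP _ (- a)); first by apply: is_unitN; exists b.
  by rewrite scale_cv !mulNr ab; congr cv; ring.
have e2 : act 1 (E2 (- a) * E2 (- b))%g << edge_zi A >> =
    << X_edge (vdet_sym (vdet_zero_pt b)) >>.
  rewrite actU; congr << _ >>; apply: X_act_edge;
    rewrite /= ?vec_infE ?vec_zeroE ?vec_ptE mx2_mul mx2_cv.
    apply: (@line_eqP _ (- a)); first by apply: is_unitN; exists b.
    by rewrite scale_cv !mulNr ab; congr cv; ring.
  apply: (@line_eqP _ b) => //; rewrite scale_cv; congr cv; last ring.
  by rewrite !mulr0 !addr0 mulr1 mulrNN ab mul1r subrr.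
have -> : word_path (Dw a b) = act 1 (E2 (- a)) << edge_zi A >>
    + act 1 (E2 (- a) * E2 (- b))%g << edge_zi A >>
    + act 1 (ev (Dw a b)) << edge_zi A >>.
  rewrite !word_path_cons raddf0 addr0 /letter_path /letter raddfD -!actfM addrA.
  by rewrite !ev_cons ev_nil mulg1 mulgA.
rewrite e1 e2 e3.
have := boundsB (boundsD (bounds_edge_sym (vdet_zero_pt b)) bounds_iz_zi)
  (ex_intro _ << X_inf_zero ub >> erefl).
rewrite X_bd1_inf_zero; congr bounds.
set p := << _ >>; set q := << _ >>; set r := << edge_iz A >>; set t := << edge_zi A >>.
set w := << _ >>.
rewrite opprD opprB !addrA [LHS](ACl (5*2*4*(1*6)*(3*7)))/=.

by rewrite !subrr !addr0.
Qed.

Hypothesis A_universal : universal_GE2_ring A.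

Lemma ev_surj g : exists u, ev u = g.
Proof. exact: A_universal.1. Qed.

(** In the first relation the last edges agree, since both words have the same value; the path of
    E(x)E(0) goes along one edge and back, and D(-1) traces a closed triangle. In the second, D(a)
    fixes (0, oo), so the edges of the two letters E agree and only closed triangles remain. In the
    third everything is a closed triangle. *)
Lemma bounds_rel u v : GE2_rel u v -> bounds (word_path u - word_path v).
Proof.
move=> R; have evE : ev u = ev v by apply/A_universal.2/pe_rel.
case: R evE => {u v} [x y|x a a' aa'|a a' b b' aa' bb'] evE.
- rewrite catA in evE *; rewrite !word_path_rcons evE opprD addrACA subrr addr0.
  apply: boundsB.
    rewrite word_path_cons raddf0 addr0 !ev_cons ev_nil mulg1.
    have -> : act 1 (letter (x, false) * letter (0, false))%g << edge_zi A >> =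
              act 1 (E2 x) << edge_iz A >>.
      rewrite actfM; congr (actf _ _ _); rewrite actU; congr << _ >>.
      apply: X_act_edge; rewrite /= ?vec_infE ?vec_zeroE mx2_cv.
        by congr line; congr cv; ring.
      apply: (@line_eqP _ (- 1)); first exact/is_unitN/is_unit1.
      by rewrite scale_cv; congr cv; ring.
    by rewrite /letter_path /= -raddfD addrC; apply/bounds_act/bounds_iz_zi.
  by apply: bounds_Dw; rewrite mulrNN mulr1.
- have a'a : a' * a = 1 by rewrite mulrC.
  rewrite word_path_rcons -evE word_path_cat word_path_cons raddf0 addr0.
  rewrite ev_cat actfM [act 1 (ev (Dw a a')) _]actU (diag_edge_zi aa') ?ev_Dw //.
  rewrite [word_path (Dw a' a) + _]addrC ev_cons ev_nil mulg1.
  rewrite -[letter_path _]/(act 1 (letter (x, false)) << edge_zi A >>).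
  rewrite opprD addrACA subrr add0r; apply: boundsB; last exact: bounds_Dw.
  exact/bounds_act/bounds_Dw.
- rewrite word_path_cat; apply: boundsB; last first.
    by apply: bounds_Dw; rewrite mulrACA aa' bb' mulr1.
  by apply: boundsD; [apply: bounds_Dw|apply/bounds_act/bounds_Dw].
Qed.

Lemma bounds_presented u v : presented_eq (@GE2_rel A) u v ->
  bounds (word_path u - word_path v).
Proof.
elim=> {u v} [u v|x b|u u' v v' hu IHu hv IHv|u|u v _ IH|u v w _ IH1 _ IH2].
- exact: bounds_rel.
- rewrite !word_path_cons raddf0 addr0 subr0.
  have -> : letter_path (x, b) + act 1 (letter (x, b)) (letter_path (x, ~~ b)) = 0.
    case: b.
      rewrite -[LHS]/(- << edge_zi A >> + act 1 (E2 x)^-1%g (act 1 (E2 x) << edge_zi A >>)).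
      by rewrite -actfM mulVg actf1 addNr.
    rewrite -[LHS]/(act 1 (E2 x) << edge_zi A >> + act 1 (E2 x) (- << edge_zi A >>)).
    by rewrite raddfN subrr.
  exact: bounds0.
- rewrite !word_path_cat ((A_universal.2 u u').2 hu) opprD addrACA -raddfB.
  by apply: boundsD => //; apply: bounds_act.
- by rewrite subrr; apply: bounds0.
- by rewrite -opprB; apply: boundsN.
exact: bounds_trans IH1 IH2.
Qed.

(** Completeness of the relations makes the chosen word irrelevant modulo boundaries ([path_toE]),
    so paths compose as in [path_toM]. *)
Definition path_to g : X1 := word_path (sval (cid (ev_surj g))).

Lemma path_toE u : bounds (word_path u - path_to (ev u)).
Proof.
rewrite /path_to; case: cid => v /= vE; apply: bounds_presented.
by apply/A_universal.2.
Qed.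

Lemma path_to_bd g :
  bd (X_complex A) 0 (path_to g) = << X_act_simplex g (X_inf A) >> - << X_inf A >>.
Proof. by rewrite /path_to; case: cid => v /= vE; rewrite word_path_bd vE. Qed.

Lemma path_toM g h : bounds (path_to (g * h)%g - (path_to g + act 1 g (path_to h))).
Proof.
have [u <-] := ev_surj g; have [v <-] := ev_surj h; rewrite -ev_cat.
apply: (bounds_trans (y := _)); first by rewrite -opprB; apply/boundsN/path_toE.
rewrite word_path_cat opprD addrACA -raddfB.
by apply: boundsD; [|apply: bounds_act]; apply: path_toE.
Qed.

Lemma path_to_E2 x : bounds (path_to (E2 x) - act 1 (E2 x) << edge_zi A >>).
Proof.
have := path_toE (Ew x); rewrite !ev_cons ev_nil mulg1 /= raddf0 addr0.
by move=> /boundsN; rewrite opprB.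
Qed.

Lemma stab_X_inf g : X_act_simplex g (X_inf A) = X_inf A -> g 1 0 = 0.
Proof.
move=> /(congr1 (fun s => tnth (val s) ord0)).
rewrite tnth_map !(tnth_nth set0) /= line_actE vec_infE SL2_cv mx2_cv => lE.
have : line (cv 1 0) (cv (g 0 0 * 1 + g 0 1 * 0) (g 1 0 * 1 + g 1 1 * 0)).
  by rewrite -lE; exists 1; rewrite ?scale1r.
move=> [a _]; rewrite scale_cv mulr0 => /(congr1 (fun v : 'cV[A]_2 => v 1 0)).
by rewrite !mxE /= mulr1 mulr0 addr0.
Qed.

(** g is upper triangular, hence D(a) E(x) E(0)^-1: the last two factors have upper right corner -x,
    which D(a) multiplies by a, whence x = - b g_01. D(a) traces a closed triangle, and E(x) E(0)^-1
    an edge and its reverse. *)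
Lemma path_to_stab g : X_act_simplex g (X_inf A) = X_inf A -> bounds (path_to g).
Proof.
move=> /stab_X_inf g10; have := SL2_det g; rewrite g10 mulr0 subr0 => ab.
set a := g 0 0 in ab; set b := g 1 1 in ab.
have ba : b * a = 1 by rewrite mulrC.
pose u := Dw a b ++ [:: (- (b * g 0 1), false); (0, true)].
have uE : ev u = g.
  apply: val_inj; rewrite /u ev_cat SL2_valM ev_Dw // !ev_cons ev_nil mulg1 /letter /=.
  rewrite /adj2 !mxE /= mx2_mul mx2_mul [RHS]SL2_cv g10 -/a -/b.
  congr mx2; rewrite ?(mulr0, mulr1, addr0, add0r, mul0r, mulrN1, opprK, oppr0) //.
  by rewrite ?mulrN ?opprK mulrA ab mul1r.
have := path_toE u; rewrite uE => /boundsN; rewrite opprB => /bounds_trans pE.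
rewrite -[path_to g]subr0; apply: pE; rewrite subr0 /u word_path_cat.
apply: boundsD; first exact: bounds_Dw.
rewrite !word_path_cons raddf0 addr0 /letter_path /letter /= raddfN subrr raddf0.
exact: bounds0.
Qed.

Definition potential (s : X_simplex A 0) : X1 := path_to (sval (cid (X_vert_trans s))).

Lemma potentialE g : bounds (potential (X_act_simplex g (X_inf A)) - path_to g).
Proof.
rewrite /potential; case: cid => k /= kE.
have := path_toM k (k^-1 * g)%g; rewrite mulVKg => /boundsN; rewrite opprB.
rewrite addrAC => h; have := boundsB h (bounds_act k (path_to_stab (g := (k^-1 * g)%g) _)).
rewrite addrK; apply.
by rewrite X_act_simplexM -kE -X_act_simplexM mulVg X_act_simplex1.
Qed.

(** Write e = g (0, oo) with g = g0 E(0). Its tail is g0 oo and its tip is g oo, and by [path_toM]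
    the path to g is the path to g0 followed by e. *)
Lemma potential_edge (e : X_simplex A 1) : bounds (<< e >>
  - (potential (X_face ord0 e) - potential (X_face (fintype.lift ord0 ord0) e))).
Proof.
have [g0 g0E] := X_edge_trans e; pose g := (g0 * E2 0)%g.
have ziE : X_act_simplex (E2 0) (edge_zi A) = edge_iz A.
  apply: X_act_edge; rewrite /= ?vec_infE ?vec_zeroE mx2_cv.
    by congr line; congr cv; ring.
  apply: (@line_eqP _ (- 1)); first exact/is_unitN/is_unit1.
  by rewrite scale_cv; congr cv; ring.
have eE : e = X_act_simplex g (edge_zi A) by rewrite X_act_simplexM ziE.
rewrite eE -!X_act_face edge_zi_face0 edge_zi_face1.
have -> : X_act_simplex g (X_zero A) = X_act_simplex g0 (X_inf A).
  by rewrite X_act_simplexM E2_X_zero.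
have h1 := potentialE g; have h2 := potentialE g0.
have h3 := path_toM g0 (E2 0); have h4 := bounds_act g0 (path_to_E2 0).
rewrite raddfB -actfM actU -/g in h3 h4.
have := boundsN (boundsB (boundsD (boundsD h1 h3) h4) h2); congr bounds.
rewrite !opprB !opprD !opprK.
set p1 := potential _; set q := path_to g; set q0 := path_to g0.
set p0 := potential _; set x := actf _ _ _; set y := << _ >>.
rewrite !addrA [LHS](ACl ((9*1*3)*(2*6)*(4*5)*(7*8)))/=.
by rewrite addNr !subrr !addr0.
Qed.

(** Replacing each edge by its difference of potentials changes z by a boundary and yields the
    potential of the boundary of z, which is 0. *)
Lemma X_exact1 (z : X_complex A 1) : bd (X_complex A) 0 z = 0 ->
  exists y, z = bd (X_complex A) 1 y.
Proof.
move=> z0; rewrite -[exists y, _]/(bounds z) -[z]subr0.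
rewrite -[0](raddf0 (flift potential)) -z0.
move: z {z0}; apply: freeg_ind => [|x y hx hy|e].
- by rewrite !raddf0 addr0; apply: bounds0.
- rewrite !raddfB; have := boundsB hx hy; congr bounds.
  by rewrite !opprD !opprK addrACA.
rewrite X_bd0U; have := potential_edge e; congr bounds; congr (_ - _).
by apply/esym/(etrans (raddfB (flift potential) _ _)); congr (_ - _); apply: fliftU.
Qed.

Lemma X_exact0 (z : X_complex A 0) : freeg_map (fun _ => tt) z = 0 ->
  exists y, z = bd (X_complex A) 0 y.
Proof.
move=> z0; pose c : {additive {freeg unit} -> {freeg (X_simplex A 0)}} :=
  freeg_map (fun _ => X_inf A).
have : exists y, z - c (freeg_map (fun _ => tt) z) = bd (X_complex A) 0 y.
  move: z {z0}; apply: freeg_ind => [|x y [x' hx] [y' hy]|s].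
  - by exists 0; rewrite !raddf0 addr0.
  - exists (x' - y'); rewrite (raddfB (bd _ _)) -hx -hy (raddfB (freeg_map _)) (raddfB c).
    by rewrite !opprD !opprK addrACA.
  have [g gE] := X_vert_trans s; exists (path_to g).
  by rewrite path_to_bd gE !freeg_mapU.
by rewrite z0 raddf0 subr0.
Qed.

End Exactness.

(** * The invariant rho *)

Section Units.
Variable A : comPzRingType.

Record units := Units { units_pair :> A * A; _ : units_pair.1 * units_pair.2 == 1 }.
HB.instance Definition _ := [isSub for units_pair].
HB.instance Definition _ := [Choice of units by <:].

Lemma unitsP (x : units) : (val x).1 * (val x).2 = 1.
Proof. by case: x => x /= /eqP. Qed.

Lemma units_inj (x y : units) : (val x).1 = (val y).1 -> x = y.
Proof.
move: (unitsP x) (unitsP y); case: x y => [[a b] h] [[c d] h'] /= ab cd ac.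
apply: val_inj; rewrite /= ac; congr pair; rewrite -[b]mul1r -cd -ac.
by rewrite mulrC mulrA [b * a]mulrC ab mul1r.
Qed.

Lemma units_one_subproof : (1 : A, 1 : A).1 * (1 : A, 1 : A).2 == 1.
Proof. by rewrite mulr1. Qed.
Definition units_one := Units units_one_subproof.

Lemma units_mul_subproof (x y : units) :
  ((val x).1 * (val y).1, (val x).2 * (val y).2).1 *
  ((val x).1 * (val y).1, (val x).2 * (val y).2).2 == 1.
Proof. by rewrite /= mulrACA !unitsP mulr1. Qed.
Definition units_mul x y := Units (units_mul_subproof x y).

Lemma units_inv_subproof (x : units) :
  ((val x).2, (val x).1).1 * ((val x).2, (val x).1).2 == 1.
Proof. by rewrite /= mulrC unitsP. Qed.
Definition units_inv x := Units (units_inv_subproof x).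

Lemma units_mulA : associative units_mul.
Proof. by move=> x y z; apply: units_inj; rewrite /= mulrA. Qed.
Lemma units_mulC : commutative units_mul.
Proof. by move=> x y; apply: units_inj; rewrite /= mulrC. Qed.
Lemma units_mul1 : left_id units_one units_mul.
Proof. by move=> x; apply: units_inj; rewrite /= mul1r. Qed.
Lemma units_mulV : left_inverse units_one units_inv units_mul.
Proof. by move=> x; apply: units_inj; rewrite /= mulrC unitsP. Qed.

(* The unit group, written additively. *)
HB.instance Definition _ :=
  GRing.isZmodule.Build units units_mulA units_mulC units_mul1 units_mulV.

Definition uval (x : units) : A := (val x).1.

Lemma uvalD x y : uval (x + y) = uval x * uval y. Proof. by []. Qed.
Lemma uval0 : uval 0 = 1. Proof. by []. Qed.

Lemma is_unitP a : is_unit a -> exists x, uval x = a.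
Proof. by move=> [b /eqP ab]; exists (Units (units_pair := (a, b)) ab). Qed.

Lemma uval_unit x : is_unit (uval x).
Proof. by exists (val x).2; apply: unitsP. Qed.

Lemma uval_inj : injective uval.
Proof. exact: units_inj. Qed.

Lemma unimodular_cancel (u : 'cV[A]_2) c d : unimodular u -> c *: u = d *: u -> c = d.
Proof.
move=> [M [[N [_ NM]] ->]] /(congr1 (fun w => (N *m w) 0 0)).
rewrite -!scalemxAr !mxE -!/(col 0 M).
have -> : \sum_j N 0 j * col 0 M j 0 = 1.
  transitivity ((N *m M) 0 0); last by rewrite NM !mxE.
  by rewrite mxE; apply: eq_bigr => j _; rewrite mxE.
by rewrite !mulr1.
Qed.

Lemma line_scaleP (u v : 'cV[A]_2) : unimodular u -> line u = line v ->
  exists x : units, u = uval x *: v.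
Proof.
move=> hu uv.
have [a _ aE] : line v u by rewrite -uv; exists 1; rewrite ?scale1r.
have [b _ bE] : line u v by rewrite uv; exists 1; rewrite ?scale1r.
have [x xE] : exists x, uval x = a.
  by apply: is_unitP; exists b; apply: (unimodular_cancel hu); rewrite -scalerA bE aE scale1r.
by exists x; rewrite xE.
Qed.

Definition rep (s : X_simplex A 0) : 'cV[A]_2 := sval (cid (X_vertP s)).

Lemma rep_unimodular s : unimodular (rep s).
Proof. by rewrite /rep; case: cid => u [hu]. Qed.

Lemma repE s : s = X_vert (rep_unimodular s).
Proof.
have [hu sE] : exists hu : unimodular (rep s), s = X_vert hu := svalP (cid (X_vertP s)).
by apply: etrans sE _; apply: X_vert_eq.
Qed.

Lemma tnth_rep s : tnth (val s) ord0 = line (rep s).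
Proof.
transitivity (tnth (val (X_vert (rep_unimodular s))) ord0); first by rewrite -repE.
by rewrite (tnth_nth set0).
Qed.

Lemma line_rep u (hu : unimodular u) : line (rep (X_vert hu)) = line u.
Proof. by rewrite -tnth_rep. Qed.

Lemma lambda_subproof (g : SL2 A) s : exists x : units,
  val g *m rep (X_act_simplex g^-1%g s) = uval x *: rep s.
Proof.
apply: line_scaleP.
  have [M [Mi ->]] := rep_unimodular (X_act_simplex g^-1%g s).
  exists (val g *m M); rewrite !colE mulmxA; split=> //.
  by apply: invertible2M => //; apply: invertible2_SL2.
have := congr1 (fun s : X_simplex A 0 => tnth (val s) ord0) (actKV (X_action A 0) g s).
by rewrite tnth_map !tnth_rep line_actE.
Qed.

Definition lambda (g : SL2 A) s : units := sval (cid (lambda_subproof g s)).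

Lemma lambdaE (g : SL2 A) s : val g *m rep (X_act_simplex g^-1%g s) = uval (lambda g s) *: rep s.
Proof. by rewrite /lambda; case: cid. Qed.

Lemma lambda_uniq (g : SL2 A) s c :
  val g *m rep (X_act_simplex g^-1%g s) = c *: rep s -> uval (lambda g s) = c.
Proof. by rewrite lambdaE; apply/unimodular_cancel/rep_unimodular. Qed.

(** The cocycle rule, which makes [rho] vanish on boundaries. *)
Lemma lambdaM (g h : SL2 A) s : lambda (g * h)%g s = lambda g s + lambda h (X_act_simplex g^-1%g s).
Proof.
apply/uval_inj/lambda_uniq; rewrite uvalD invgM X_act_simplexM SL2_valM -mulmxA lambdaE.
by rewrite -scalemxAr lambdaE scalerA mulrC.
Qed.

Lemma vdet_scale (a b : A) u v : vdet (a *: u) (b *: v) = a * b * vdet u v.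
Proof.
rewrite /vdet !mxE; move: (u 0 0) (u 1 0) (v 0 0) (v 1 0) => *; ring.
Qed.

Lemma edge_det_subproof (e : X_simplex A 1) : exists x : units,
  uval x = vdet (rep (X_face (fintype.lift ord0 ord0) e)) (rep (X_face ord0 e)).
Proof.
have [u [v [h ->]]] := X_edgeP e; have [hu hv] := vdet_unimodular h.
rewrite (X_edge_face0 h hv) (X_edge_face1 h hu); apply: is_unitP.
have [x ->] := line_scaleP (rep_unimodular _) (line_rep hu).
have [y ->] := line_scaleP (rep_unimodular _) (line_rep hv).
have [b hb] := h; have [c hc] := uval_unit x; have [d hd] := uval_unit y.
exists (b * (c * d)); rewrite vdet_scale.
transitivity ((vdet u v * b) * ((uval x * c) * (uval y * d))).
  by move: (uval x) (uval y) (vdet u v) => *; ring.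
by rewrite hb hc hd !mulr1.
Qed.

Definition edge_det e : units := sval (cid (edge_det_subproof e)).

Local Notation tail e := (X_face (fintype.lift ord0 ord0) e).
Local Notation tip e := (X_face ord0 e).

Lemma edge_detE e : uval (edge_det e) = vdet (rep (tail e)) (rep (tip e)).
Proof. by rewrite /edge_det; case: cid. Qed.

(** g has determinant 1, so the determinant of the chosen generators of the two ends changes only by
    their scale factors. Thus the product of [lambda] at the two ends is a coboundary. *)
Lemma edge_det_act (g : SL2 A) e :
  edge_det (X_act_simplex g^-1%g e) = lambda g (tail e) + lambda g (tip e) + edge_det e.
Proof.
apply: uval_inj; rewrite !uvalD !edge_detE -!X_act_face -(vdet_SL2 g) !lambdaE.
exact: vdet_scale.
Qed.

Local Notation K := (fun p => nerve_complex (X_action A p)).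

(* H_1(SL_2, X_1) -> A^x: lambda g L compares chosen generators of L and of g^-1 L. *)
Definition rho : {additive K 1%N 1%N -> units} :=
  flift (fun b : 1.-tuple (SL2 A) * X_simplex A 1 => lambda (thead b.1) (tail b.2)).

Lemma rhoU t e : rho << (t, e) >> = lambda (thead t) (tail e).
Proof. exact: fliftU. Qed.

Lemma tuple1E (T : Type) (t : 1.-tuple T) : t = [tuple thead t].
Proof. by apply: eq_from_tnth => i; rewrite ord1 tnth0. Qed.

Lemma tuple2E (T : Type) (t : 2.-tuple T) : t = [tuple tnth t 0; tnth t 1].
Proof. by apply: eq_from_tnth; elim/ord2P. Qed.

Lemma rho_bd (x : K 1%N 2%N) : rho (bd (K 1%N) 1 x) = 0.
Proof.
rewrite -[LHS]/((rho \o bd (K 1%N) 1 : {additive _ -> _}) x).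
rewrite -[RHS]/((\0 : {additive K 1%N 2%N -> units}) x).
move: x; apply: freeg_additive_eq => -[t e].
rewrite -[LHS]/(rho (bd (K 1%N) 1 << (t, e) >>)) -[RHS]/(0 : units).
rewrite -tensU (tuple2E t) nerve_bd1 /actf freeg_mapU !tensU raddfD raddfB !rhoU.
rewrite !theadE -X_act_face; set g := tnth t 0; set h := tnth t 1.
have -> : lambda h (tail e) =
    lambda g (tail e) + lambda (g^-1 * h)%g (X_act_simplex g^-1%g (tail e)).
  by rewrite -lambdaM mulVKg.
by rewrite opprD addrCA subrr addr0 addNr.
Qed.

(** Let rho' use the tip of an edge where rho uses the tail. The difference rho' - rho factors
    through the boundary of edges, which vanishes for coefficients in Z_1; the sum rho + rho'
    factors through [bd] by [edge_det_act]. So rho' = rho and twice rho is 0. *)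
Lemma rho_cycle (x : K 1%N 1%N) : hat (bd (X_complex A) 0) x = 0 ->
  bd (K 1%N) 0 x = 0 -> rho x + rho x = 0.
Proof.
move=> x1 x2.
pose rho' : {additive K 1%N 1%N -> units} :=
  flift (fun b : 1.-tuple (SL2 A) * X_simplex A 1 => lambda (thead b.1) (tip b.2)).
pose Lam : {additive K 0%N 1%N -> units} :=
  flift (fun b : 1.-tuple (SL2 A) * X_simplex A 0 => lambda (thead b.1) b.2).
pose Det : {additive K 1%N 0%N -> units} :=
  flift (fun b : 0.-tuple (SL2 A) * X_simplex A 1 => edge_det b.2).
have h1 y : rho' y - rho y = Lam (hat (bd (X_complex A) 0) y).
  rewrite -[LHS]/((rho' \- rho : {additive _ -> _}) y).
  rewrite -[RHS]/((Lam \o hat (bd (X_complex A) 0) : {additive _ -> _}) y).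
  move: y; apply: freeg_additive_eq => -[t e].
  rewrite -[RHS]/(Lam (hat (bd (X_complex A) 0) << (t, e) >>)).
  rewrite -[X in hat _ X]tensU hat_tens X_bd0U raddfB !tensU raddfB.
  by congr (_ - _); rewrite [LHS]fliftU [RHS]fliftU.
have h2 y : rho y + rho' y = Det (bd (K 1%N) 0 y).
  rewrite -[LHS]/((rho \+ rho' : {additive _ -> _}) y).
  rewrite -[RHS]/((Det \o bd (K 1%N) 0 : {additive _ -> _}) y).
  move: y; apply: freeg_additive_eq => -[t e].
  rewrite -[RHS]/(Det (bd (K 1%N) 0 << (t, e) >>)).
  rewrite -[X in bd _ _ X]tensU (tuple1E t) nerve_bd0 /actf freeg_mapU !tensU raddfB.
  rewrite [X in _ = X - _]fliftU [X in _ = _ - X]fliftU edge_det_act addrK.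
  by congr (_ + _); apply: fliftU.
have /eqP := h1 x; rewrite x1 raddf0 subr_eq0 => /eqP e.
by rewrite -{2}e h2 x2 raddf0.
Qed.

Lemma minus1_subproof : (-1 : A) * -1 - 0 * 0 = 1.
Proof. by ring. Qed.
Definition minus1 : SL2 A := SL2Mx (SL2_mx2_subproof minus1_subproof).

Lemma minus1_val : val minus1 = - 1%:M.
Proof. by apply: eq_mx2; rewrite !mxE //= oppr0. Qed.

Lemma minus1_mul n (u : 'M[A]_(2, n)) : val minus1 *m u = (-1) *: u.
Proof. by rewrite minus1_val mulNmx mul1mx scaleN1r. Qed.

Lemma X_act_minus1 n (s : X_simplex A n) : X_act_simplex minus1 s = s.
Proof.
apply: val_inj; apply: eq_from_tnth => i; rewrite tnth_map.
case: s => t /= /asboolP[v [_ -> _]]; rewrite line_actE minus1_mul.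
by apply: line_scale; apply/is_unitN/is_unit1.
Qed.

Lemma minus1V : minus1^-1%g = minus1.
Proof.
apply: (mulgI minus1); rewrite mulgV; apply: val_inj.
by rewrite SL2_valM minus1_mul minus1_val scaleN1r opprK.
Qed.

Lemma minus1C (g : SL2 A) : (minus1 * g = g * minus1)%g.
Proof. by apply: val_inj; rewrite !SL2_valM minus1_mul minus1_val mulmxN mulmx1 scaleN1r. Qed.

(** The element -1 of A^x ([uneg1E]); in this additive notation it is 0 exactly when -1 = 1 in A. *)
Definition uneg1 : units := lambda minus1 (X_inf A).

Lemma lambda_minus1 s : uval (lambda minus1 s) = -1.
Proof. by apply: lambda_uniq; rewrite minus1V X_act_minus1 minus1_mul. Qed.

Lemma uneg1E : uval uneg1 = -1.
Proof. exact: lambda_minus1. Qed.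

Lemma rho_minus1 (z : X_complex A 1) :
  rho (tens [tuple minus1] z) = uneg1 *~ deg z.
Proof.
move: z; apply: freeg_ind => [|x y hx hy|e]; first by rewrite !raddf0 ?mulr0z.
  by rewrite !raddfB hx hy ?mulrzBr.
rewrite tensU rhoU degU mulr1z; apply: uval_inj.
by rewrite theadE lambda_minus1 uneg1E.
Qed.

Definition hyper : X_complex A 1 := << edge_iz A >> + << edge_zi A >>.

Lemma rep_inf : exists x : units, rep (X_inf A) = uval x *: cv 1 0.
Proof.
by rewrite -vec_infE; apply: line_scaleP; [apply: rep_unimodular | apply: line_rep].
Qed.

Lemma rep_zero : exists x : units, rep (X_zero A) = uval x *: cv 0 1.
Proof.
by rewrite -vec_zeroE; apply: line_scaleP; [apply: rep_unimodular | apply: line_rep].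
Qed.

Lemma rho_hyper (g : SL2 A) : rho (tens [tuple g] hyper) = lambda g (X_inf A) + lambda g (X_zero A).
Proof. by rewrite raddfD !tensU raddfD !rhoU theadE edge_iz_face1 edge_zi_face1. Qed.

Lemma diag_lines (g : SL2 A) a b : a * b = 1 -> val g = mx2 a 0 0 b ->
  line (val g *m vec_inf A) = line (vec_inf A) /\
  line (val g *m vec_zero A) = line (vec_zero A).
Proof.
move=> ab gE; rewrite gE vec_infE vec_zeroE !mx2_cv; split.
  by apply: (@line_eqP _ a); rewrite ?scale_cv; [exists b | congr cv; ring].
by apply: (@line_eqP _ b); rewrite ?scale_cv; [exists a; rewrite mulrC | congr cv; ring].
Qed.

Lemma anti_lines (g : SL2 A) a b : a * b = 1 -> val g = mx2 0 a (- b) 0 ->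
  line (val g *m vec_inf A) = line (vec_zero A) /\
  line (val g *m vec_zero A) = line (vec_inf A).
Proof.
move=> ab gE; rewrite gE vec_infE vec_zeroE !mx2_cv; split.
  apply: (@line_eqP _ (- b)); rewrite ?scale_cv; last by congr cv; ring.
  by apply: is_unitN; exists a; rewrite mulrC.
by apply: (@line_eqP _ a); rewrite ?scale_cv; [exists b | congr cv; ring].
Qed.

Lemma diag_inf (g : SL2 A) a b : a * b = 1 -> val g = mx2 a 0 0 b ->
  X_act_simplex g (X_inf A) = X_inf A /\ X_act_simplex g (X_zero A) = X_zero A.
Proof. by move=> ab /(diag_lines ab)[gi gz]; split; apply: X_act_vert. Qed.

Lemma anti_inf (g : SL2 A) a b : a * b = 1 -> val g = mx2 0 a (- b) 0 ->
  X_act_simplex g (X_inf A) = X_zero A /\ X_act_simplex g (X_zero A) = X_inf A.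
Proof. by move=> ab /(anti_lines ab)[gi gz]; split; apply: X_act_vert. Qed.

Lemma diag_edge (g : SL2 A) a b : a * b = 1 -> val g = mx2 a 0 0 b ->
  X_act_simplex g (edge_iz A) = edge_iz A /\ X_act_simplex g (edge_zi A) = edge_zi A.
Proof. by move=> ab /(diag_lines ab)[gi gz]; split; apply: X_act_edge. Qed.

Lemma anti_edge (g : SL2 A) a b : a * b = 1 -> val g = mx2 0 a (- b) 0 ->
  X_act_simplex g (edge_iz A) = edge_zi A /\ X_act_simplex g (edge_zi A) = edge_iz A.
Proof. by move=> ab /(anti_lines ab)[gi gz]; split; apply: X_act_edge. Qed.

Lemma act_eqV n (g : SL2 A) (s t : X_simplex A n) :
  X_act_simplex g s = t -> X_act_simplex g^-1%g t = s.
Proof. by move=> <-; rewrite -X_act_simplexM mulVg X_act_simplex1. Qed.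

Lemma rho_hyper_diag (g : SL2 A) a b : a * b = 1 -> val g = mx2 a 0 0 b ->
  rho (tens [tuple g] hyper) = 0.
Proof.
move=> ab gE; have [/act_eqV gi /act_eqV gz] := diag_inf ab gE.
have [x xE] := rep_inf; have [y yE] := rep_zero.
apply: uval_inj; rewrite rho_hyper uvalD uval0 -ab; congr (_ * _); apply: lambda_uniq.
  by rewrite gi gE xE scale_cv mx2_cv !scale_cv; congr cv; ring.
by rewrite gz gE yE scale_cv mx2_cv !scale_cv; congr cv; ring.
Qed.

Lemma rho_hyper_anti (g : SL2 A) a b : a * b = 1 -> val g = mx2 0 a (- b) 0 ->
  rho (tens [tuple g] hyper) = uneg1.
Proof.
move=> ab gE; have [/act_eqV gi /act_eqV gz] := anti_inf ab gE.
have [x xE] := rep_inf; have [y yE] := rep_zero.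
apply: uval_inj; rewrite rho_hyper uvalD uneg1E.
have [x' hx] := uval_unit x; have [y' hy] := uval_unit y.
(* The chosen generators of oo and 0 are x e_1 and y e_2. Their scale factors cancel in the product
   of the two values, which leaves a (-b) = -1. *)
rewrite (@lambda_uniq g (X_inf A) (a * uval y * x')); last first.
  rewrite gz gE xE yE scale_cv mx2_cv !scale_cv; congr cv; try ring.
  by rewrite !mulr0 !mulr1 add0r -mulrA [x' * _]mulrC hx mulr1.
rewrite (@lambda_uniq g (X_zero A) (- b * uval x * y')); last first.
  rewrite gi gE xE yE scale_cv mx2_cv !scale_cv; congr cv; try ring.
  by rewrite !mulr0 !mulr1 addr0 -[RHS]mulrA [y' * _]mulrC hy mulr1.
transitivity (- ((a * b) * (uval x * x') * (uval y * y'))).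
  by move: (uval x) (uval y) => *; ring.
by rewrite ab hx hy !mulr1.
Qed.

End Units.

(** * The monomial group *)

Section EquivTens.
Variables (G G' : groupType) (S S' : choiceType) (a : action G S) (a' : action G' S').
Variables (u : {multiplicative G' -> G}) (v : S' -> S).
Hypothesis uvE : forall g s, v (a' g s) = a (u g) (v s).

Lemma equiv_nmap n (x : n.-tuple G' * S') :
  nmap a (fun _ => u) v x = (map_tuple u x.1, v x.2).
Proof.
rewrite -[RHS](expandK a); congr norm; congr pair; apply: val_inj.
by rewrite /= mult1.
Qed.

Lemma equiv_map_tens n (t : n.-tuple G') z :
  equiv_map uvE n (tens t z) = tens (map_tuple u t) (freeg_map v z).
Proof.
rewrite -[LHS]/(freeg_map _ (freeg_map _ z)) -[RHS]/(freeg_map _ (freeg_map v z)).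
rewrite !freeg_map_comp; apply: eq_freeg_map => s /=; exact: equiv_nmap.
Qed.

End EquivTens.

Lemma point_map_id (G : groupType) n (x : point_complex G n) :
  point_map (idfun : {multiplicative G -> G}) n x = x.
Proof.
apply: freeg_map_id => -[t s] /=.
rewrite (equiv_nmap (trivial_action G) (idfun : {multiplicative G -> G}) id).
by congr pair; apply: eq_from_tnth => i; rewrite tnth_map.
Qed.

Lemma point_map_inj (G' G : groupType) (f : {multiplicative G' -> G}) n :
  injective f -> injective (point_map f n).
Proof.
move=> fI; apply: freeg_map_inj => -[t s] [t' s'] /=.
rewrite !(equiv_nmap (trivial_action G) f id) => -[tt' ->]; congr pair.
by apply: val_inj; apply: (inj_map fI).
Qed.

Section Monomial.
Variable A : comPzRingType.
Hypothesis A_nontrivial : (1 : A) <> 0.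

Lemma SM2P (g : SM2 A) : exists a b : A, a * b = 1 /\
  (val (val g) = mx2 a 0 0 b \/ val (val g) = mx2 0 a (- b) 0).
Proof. by case: g => g /= /asboolP. Qed.

Definition SM2_swap (g : SM2 A) : bool := val (val g) 0 0 == 0.

Lemma unit_neq0 (a b : A) : a * b = 1 -> (a == 0) = false.
Proof. by move=> ab; apply/eqP => a0; apply: A_nontrivial; rewrite -ab a0 mul0r. Qed.

Lemma SM2_swap_diag (g : SM2 A) (a b : A) :
  a * b = 1 -> val (val g) = mx2 a 0 0 b -> SM2_swap g = false.
Proof. by move=> ab gE; rewrite /SM2_swap gE !mxE /= (unit_neq0 ab). Qed.

Lemma SM2_swap_anti (g : SM2 A) (a b : A) :
  val (val g) = mx2 0 a (- b) 0 -> SM2_swap g.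
Proof. by move=> gE; rewrite /SM2_swap gE !mxE /= eqxx. Qed.

Lemma SM2_swap1 : SM2_swap 1%g = false.
Proof. by apply: (@SM2_swap_diag _ 1 1); rewrite ?mulr1 //; apply: eq_mx2; rewrite !mxE. Qed.

Lemma SM2_swapM g h : SM2_swap (g * h)%g = SM2_swap g (+) SM2_swap h.
Proof.
have [a [b [ab gE]]] := SM2P g; have [c [d [cd hE]]] := SM2P h.
have dc : d * c = 1 by rewrite mulrC.
have ghE : val (val (g * h)%g) = val (val g) *m val (val h) by [].
case: gE => gE; case: hE => hE; move: ghE; rewrite gE hE mx2_mul => ghE.
- rewrite (SM2_swap_diag ab gE) (SM2_swap_diag cd hE) /=.
  apply: (@SM2_swap_diag _ (a * c) (b * d)); first by rewrite mulrACA ab cd mulr1.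
  by rewrite ghE; congr mx2; ring.
- rewrite (SM2_swap_diag ab gE) (SM2_swap_anti hE) /=.
  by apply: (@SM2_swap_anti _ (a * c) (b * d)); rewrite ghE; congr mx2; ring.
- rewrite (SM2_swap_anti gE) (SM2_swap_diag cd hE) /=.
  by apply: (@SM2_swap_anti _ (a * d) (b * c)); rewrite ghE; congr mx2; ring.
rewrite (SM2_swap_anti gE) (SM2_swap_anti hE) /=.
apply: (@SM2_swap_diag _ (- (a * d)) (- (b * c))).
  by rewrite mulrNN mulrACA ab dc mulr1.
by rewrite ghE; congr mx2; ring.
Qed.

Definition SM2_act (g : SM2 A) (b : bool) := b (+) SM2_swap g.

Lemma SM2_act1 b : SM2_act 1%g b = b.
Proof. by rewrite /SM2_act SM2_swap1 addbF. Qed.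

Lemma SM2_actM g h b : SM2_act (g * h)%g b = SM2_act g (SM2_act h b).
Proof. by rewrite /SM2_act SM2_swapM [SM2_swap g (+) _]addbC addbA. Qed.

(* SM_2 permutes {oo, 0}, with oo and 0 coded by false and true; it also permutes
   the edges (oo, 0) and (0, oo), coded by their first vertices. *)
Definition SM2_action : action (SM2 A) bool := Action SM2_act1 SM2_actM.

Definition bool_vert (b : bool) : X_simplex A 0 := if b then X_zero A else X_inf A.
Definition bool_edge (b : bool) : X_simplex A 1 := if b then edge_zi A else edge_iz A.

Lemma bool_vertE g b :
  bool_vert (SM2_action g b) = X_action A 0 (SM2_incl A g) (bool_vert b).
Proof.
have [x [y [xy [gE|gE]]]] := SM2P g; rewrite /= /SM2_act.
  rewrite (SM2_swap_diag xy gE) addbF.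
  by case: b; [rewrite [RHS](diag_inf xy gE).2 | rewrite [RHS](diag_inf xy gE).1].
rewrite (SM2_swap_anti gE) addbT.
by case: b; [rewrite [RHS](anti_inf xy gE).2 | rewrite [RHS](anti_inf xy gE).1].
Qed.

Lemma bool_edgeE g b :
  bool_edge (SM2_action g b) = X_action A 1 (SM2_incl A g) (bool_edge b).
Proof.
have [x [y [xy [gE|gE]]]] := SM2P g; rewrite /= /SM2_act.
  rewrite (SM2_swap_diag xy gE) addbF.
  by case: b; [rewrite [RHS](diag_edge xy gE).2 | rewrite [RHS](diag_edge xy gE).1].
rewrite (SM2_swap_anti gE) addbT.
by case: b; [rewrite [RHS](anti_edge xy gE).2 | rewrite [RHS](anti_edge xy gE).1].
Qed.

Lemma X_inf_neq_zero : X_inf A <> X_zero A.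
Proof.
move=> /(congr1 (fun s => tnth (val s) ord0)); rewrite !(tnth_nth set0) /= => iz.
have : line (vec_zero A) (vec_inf A) by rewrite -iz; exists 1; rewrite ?scale1r.
rewrite vec_infE vec_zeroE => -[a _]; rewrite scale_cv.
move=> /(congr1 (fun u : 'cV[A]_2 => u 0 0)); rewrite !mxE /= mulr0 => h.
exact: A_nontrivial.
Qed.

Lemma bool_vert_inj : injective bool_vert.
Proof. by case=> -[] // /esym; [move=> /X_inf_neq_zero | move=> /esym/X_inf_neq_zero]. Qed.

Lemma bool_edge_face1 b : X_face (fintype.lift ord0 ord0) (bool_edge b) = bool_vert b.
Proof. by case: b; [apply: edge_zi_face1 | apply: edge_iz_face1]. Qed.

Lemma bool_edge_face0 b : X_face ord0 (bool_edge b) = bool_vert (~~ b).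
Proof. by case: b; [apply: edge_zi_face0 | apply: edge_iz_face0]. Qed.

Lemma bool_edge_inj : injective bool_edge.
Proof. by move=> b c bc; apply: bool_vert_inj; rewrite -!bool_edge_face1 bc. Qed.

Definition T2_incl : {multiplicative T2 A -> SL2 A} := (val : T2 A -> SL2 A).
Definition B2_incl : {multiplicative B2 A -> SL2 A} := (val : B2 A -> SL2 A).

Lemma T2P (t : T2 A) : exists a b : A, a * b = 1 /\ val (val t) = mx2 a 0 0 b.
Proof.
case: t => g /= /andP[/eqP g01 /eqP g10]; exists (g 0 0), (g 1 1); split.
  by rewrite -(SL2_det g) g01 mul0r subr0.
by rewrite [LHS]SL2_cv g01 g10.
Qed.

Lemma diag_T2 (g : SL2 A) (a b : A) : val g = mx2 a 0 0 b -> g \in @SL2_diag A.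
Proof. by move=> gE; rewrite unfold_in /SL2_diag gE !mxE /= eqxx. Qed.

Lemma T2_monomial (t : T2 A) : val t \in @SL2_monomial A.
Proof.
have [a [b [ab tE]]] := T2P t; rewrite unfold_in; apply/asboolP.
by exists a, b; split=> //; left.
Qed.

Definition T2_to_SM2 (t : T2 A) : SM2 A := MkSM2 (T2_monomial t).

Lemma T2_to_SM2_morph : {morph T2_to_SM2 : s t / (s * t)%g}.
Proof. by move=> s t; apply: val_inj. Qed.
HB.instance Definition _ := isMultiplicative.Build (T2 A) (SM2 A) T2_to_SM2 T2_to_SM2_morph.

Lemma SM2_stab g : SM2_action g false = false <-> exists t, T2_to_SM2 t = g.
Proof.
rewrite /= /SM2_act /=; split=> [gs|[t <-]].
  have [a [b [ab [gE|gE]]]] := SM2P g; last by rewrite (SM2_swap_anti gE) in gs.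
  by exists (MkT2 (diag_T2 gE)); apply: val_inj.
by have [a [b [ab tE]]] := T2P t; apply: (SM2_swap_diag ab).
Qed.

Lemma edge_stab g : X_action A 1 g (edge_iz A) = edge_iz A <-> exists t, T2_incl t = g.
Proof.
split=> [ge|[t <-]]; last first.
  by have [a [b [ab tE]]] := T2P t; apply: (diag_edge ab tE).1.
have g10 : g 1 0 = 0.
  by apply: stab_X_inf; rewrite -[in RHS]edge_iz_face1 -ge -X_act_face edge_iz_face1.
have g01 : g 0 1 = 0.
  have : X_act_simplex g (X_zero A) = X_zero A.
    by rewrite -[in RHS]edge_iz_face0 -ge -X_act_face edge_iz_face0.
  move=> /(congr1 (fun s => tnth (val s) ord0)).
  rewrite tnth_map !(tnth_nth set0) /= line_actE vec_zeroE SL2_cv mx2_cv => lE.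
  have : line (cv 0 1) (cv (g 0 0 * 0 + g 0 1 * 1) (g 1 0 * 0 + g 1 1 * 1)).
    by rewrite -lE; exists 1; rewrite ?scale1r.
  move=> [a _]; rewrite scale_cv mulr0 => /(congr1 (fun v : 'cV[A]_2 => v 0 0)).
  by rewrite !mxE /= mulr1 mulr0 add0r.
have gE : val g = mx2 (g 0 0) 0 0 (g 1 1) by rewrite [LHS]SL2_cv g10 g01.
by exists (MkT2 (diag_T2 gE)).
Qed.

Lemma vert_stab g : X_action A 0 g (X_inf A) = X_inf A <-> exists t, B2_incl t = g.
Proof.
split=> [/stab_X_inf g10|[t <-]].
  have gB : g \in @SL2_upper A by rewrite unfold_in /SL2_upper g10.
  by exists (MkB2 gB).
case: t => k /= /eqP g10; have := SL2_det k; rewrite g10 mulr0 subr0 => ab.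
apply: X_act_vert; rewrite SL2_cv g10 vec_infE mx2_cv.
apply: (@line_eqP _ (k 0 0)); first by exists (k 1 1).
by rewrite scale_cv; congr cv; ring.
Qed.

Lemma weyl_subproof0 : (0 : A) * 0 - 1 * -1 = 1.
Proof. by ring. Qed.
Lemma weyl_subproof : SL2Mx (SL2_mx2_subproof weyl_subproof0) \in @SL2_monomial A.
Proof. by rewrite unfold_in; apply/asboolP; exists 1, 1; split; [rewrite mulr1 | right]. Qed.
Definition weyl : SM2 A := MkSM2 weyl_subproof.

Lemma weylE : val (val weyl) = mx2 0 1 (- 1) 0.
Proof. by []. Qed.

Definition bool_gam (b : bool) : SM2 A := if b then weyl else 1%g.

Lemma bool_gamE b : SM2_action (bool_gam b) false = b.
Proof. by case: b; rewrite /= /SM2_act ?SM2_swap1 // (SM2_swap_anti weylE). Qed.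

(** Supplies the compatibility asked for by [retraction_equiv]: on the two simplices coming from
    [bool] the representatives are those of SM_2, elsewhere they are arbitrary. *)
Lemma extend_gam (S : choiceType) (a : action (SL2 A) S) s0 (v : bool -> S) :
  injective v -> (forall s, exists g, a g s0 = s) -> v false = s0 ->
  (forall g s, v (SM2_action g s) = a (SM2_incl A g) (v s)) ->
  exists gam, (forall s, a (gam s) s0 = s) /\
    forall b, gam (v b) = SM2_incl A (bool_gam b).
Proof.
move=> vI tr v0 vE.
have /choice[gam gamP] s : exists g, a g s0 = s /\
    forall b, v b = s -> g = SM2_incl A (bool_gam b).
  have [[b bs]|nb] := pselect (exists b, v b = s).
    exists (SM2_incl A (bool_gam b)); split.
      by rewrite -v0 -vE bool_gamE.
    by move=> c cs; congr (SM2_incl A (bool_gam _)); apply: vI; rewrite bs cs.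
  have [g gE] := tr s; exists g; split=> // b bs; case: nb; by exists b.
by exists gam; split=> [s|b]; [case: (gamP s) | case: (gamP (v b)) => _; apply].
Qed.

Definition bool_to_X1 := equiv_map (u := SM2_incl A) bool_edgeE.
Definition bool_to_X0 := equiv_map (u := SM2_incl A) bool_vertE.

(** (x, x') is a cycle of the mapping cone of f, and the conclusion says that it bounds, up to the
    sign of y'. *)
Definition cone_acyclic (C C' : complex) (f : chain_map C' C) n :=
  forall x x', bd C n x = f n x' -> x' \in @cyclep C' n ->
  exists y y', x = bd C n.+1 y + f n.+1 y' /\ x' = bd C' n y'.

(** The edge (oo, 0) has stabilizer T in both groups, so the comparison map of stabilizers is the
    identity. *)
Lemma cone_X1_acyclic n : cone_acyclic bool_to_X1 n.
Proof.
have [gam [gamE gamv]] :=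
  extend_gam (a := X_action A 1) bool_edge_inj (@X_edge_trans A) erefl bool_edgeE.
apply: (comparison_acyclic (H := T2 A) (H' := T2 A) (i := T2_incl) val_inj edge_stab gamE
  (i' := T2_to_SM2 : {multiplicative _ -> _}) (w := idfun : {multiplicative _ -> _})
  _ SM2_stab bool_gamE) => //.
- by move=> s t /(congr1 val) st; apply: val_inj.
- by move=> x cx; exists x, 0; rewrite raddf0 addr0 point_map_id.
by move=> y z _; rewrite point_map_id => ->; exists z.
Qed.

Hypothesis A_TB : forall i : nat, (i <= 3)%N ->
  bijective (group_homology_map (@T2_to_B2 A) i).

(** The line oo has stabilizer B in SL_2 and T in SM_2. Injectivity is used for i = n and
    surjectivity for i = n + 1, whence n <= 2. *)
Lemma cone_X0_acyclic n : (n <= 2)%N -> cone_acyclic bool_to_X0 n.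
Proof.
move=> n2.
have [gam [gamE gamv]] :=
  extend_gam (a := X_action A 0) bool_vert_inj (@X_vert_trans A) erefl bool_vertE.
apply: (comparison_acyclic (H := B2 A) (H' := T2 A) (i := B2_incl) val_inj vert_stab gamE
  (i' := T2_to_SM2 : {multiplicative _ -> _}) (w := @T2_to_B2 A : {multiplicative _ -> _})
  _ SM2_stab bool_gamE) => //.
- by move=> s t /(congr1 val) st; apply: val_inj.
- by apply: group_homology_bij_surj; apply: A_TB.
by apply: group_homology_bij_inj; apply: A_TB; apply: leq_trans n2 _.
Qed.

End Monomial.

(** * Mapping cones and dimension shifting *)

Section Cone.
Variables (C C' : complex) (f : chain_map C' C).

(* The mapping cone of f, with C_{n+1} + C'_n in degree n. *)
Definition cone_bd n (x : (C n.+2 * C' n.+1)%type) : (C n.+1 * C' n)%type :=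
  (bd C n.+1 x.1 - f n.+1 x.2, - bd C' n x.2).

Lemma cone_bd_is_additive n : zmod_morphism (@cone_bd n).
Proof.
move=> [x x'] [y y']; congr pair; rewrite /= !raddfB //.
by rewrite addrACA.
Qed.
HB.instance Definition _ n :=
  GRing.isZmodMorphism.Build (C n.+2 * C' n.+1)%type (C n.+1 * C' n)%type (@cone_bd n)
    (@cone_bd_is_additive n).

Lemma cone_bdK n x : cone_bd (n := n) (cone_bd (n := n.+1) x) = 0.
Proof.
by congr pair; rewrite /= ?raddfB !raddfN ?opprK !bdK ?cmapE ?sub0r ?addNr.
Qed.

Definition cone : complex :=
  @Complex (fun n => (C n.+1 * C' n)%type : zmodType) (fun n => @cone_bd n) cone_bdK.

Lemma cone_bd0P n x x' : bd cone n (x, x') = 0 ->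
  bd C n.+1 x = f n.+1 x' /\ bd C' n x' = 0.
Proof.
move=> [/eqP + /eqP]; rewrite oppr_eq0 subr_eq0 => /eqP-> /eqP->; by split.
Qed.

(** The last differential of the cone, onto the term C_0 that the shifted indexing of [cone] leaves
    out. *)
Definition cone_end (x : cone 0) : C 0 := bd C 0 x.1 - f 0 x.2.

Lemma cone_end_bd x : cone_end (bd cone 0 x) = 0.
Proof. by rewrite /cone_end /= raddfB !raddfN ?opprK bdK cmapE sub0r addNr. Qed.

Lemma cone_acyclic0 : cone_acyclic f 0 -> forall x, cone_end x = 0 ->
  exists y, x = bd cone 0 y.
Proof.
move=> ac [x x'] /eqP; rewrite /cone_end subr_eq0 /= => /eqP/ac[//|y [y' [-> ->]]].
by exists (y, - y'); rewrite /= /cone_bd /= !raddfN !opprK.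
Qed.

Lemma cone_acyclicS n : cone_acyclic f n.+1 -> forall x, bd cone n x = 0 ->
  exists y, x = bd cone n.+1 y.
Proof.
move=> ac [x x'] [/eqP]; rewrite subr_eq0 => /eqP/ac xx' /eqP; rewrite oppr_eq0 => x0.
have [//|y [y' [-> ->]]] := xx'.
by exists (y, - y'); rewrite /= /cone_bd /= !raddfN !opprK.
Qed.

End Cone.

Section ConeMap.
Variables (C C' D D' : complex) (f : chain_map C' C) (g : chain_map D' D).
Variables (p : chain_map C D) (p' : chain_map C' D').
Hypothesis pE : forall n x, p n (f n x) = g n (p' n x).

Definition cone_fun n (x : cone f n) : cone g n := (p n.+1 x.1, p' n x.2).

Lemma cone_fun_is_additive n : zmod_morphism (@cone_fun n).
Proof. by move=> [x x'] [y y']; rewrite /cone_fun /= !raddfB. Qed.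
HB.instance Definition _ n :=
  GRing.isZmodMorphism.Build (cone f n) (cone g n) (@cone_fun n) (@cone_fun_is_additive n).

Lemma cone_funE n x : cone_fun (bd (cone f) n x) = bd (cone g) n (cone_fun x).
Proof. by rewrite /= /cone_bd /cone_fun /= raddfB raddfN !cmapE pE. Qed.

Definition cone_map : chain_map (cone f) (cone g) :=
  @ChainMap (cone f) (cone g) (fun n => @cone_fun n) cone_funE.

End ConeMap.

Section Shift.
Variables (Mm M0 M1 : complex) (P0 : chain_map M0 Mm) (P1 : chain_map M1 M0).
Variables (V : zmodType) (e : M1 0 -> V).
Hypothesis PP : forall n x, P0 n (P1 n x) = 0.
Hypothesis P0_surj : forall n x, exists y, x = P0 n y.
Hypothesis P_exact : forall n x, P0 n x = 0 -> exists y, x = P1 n y.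
Hypothesis e_bd : forall x, e (bd M1 0 x) = 0.
Hypothesis M1_0 : forall x, e x = 0 -> exists y, x = bd M1 0 y.
Hypothesis M1_1 : forall x, bd M1 0 x = 0 -> exists y, x = bd M1 1 y.
Hypothesis M0_1 : forall x, bd M0 0 x = 0 -> exists y, x = bd M0 1 y.
Hypothesis M0_2 : forall x, bd M0 1 x = 0 -> exists y, x = bd M0 2 y.

(* Two connecting homomorphisms of 0 -> ker P1 -> M1 -> M0 -> Mm -> 0, as an
   additive relation. *)
Definition shift (x : Mm 2) (k : M1 0) : Prop := exists x0 x1,
  [/\ x = P0 2 x0, bd M0 1 x0 = P1 1 x1 & bd M1 0 x1 = k].

Lemma shift_total x : bd Mm 1 x = 0 -> exists k, shift x k.
Proof.
have [x0 ->] := P0_surj x => h.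
have [|x1 x1E] := @P_exact 1 (bd M0 1 x0); first by rewrite cmapE.
by exists (bd M1 0 x1), x0, x1.
Qed.

Lemma shift_im x k : shift x k -> P1 0 k = 0 /\ e k = 0.
Proof. by move=> [x0 [x1 [_ h <-]]]; rewrite cmapE -h bdK e_bd. Qed.

Lemma shift_surj k : P1 0 k = 0 -> e k = 0 -> exists x, bd Mm 1 x = 0 /\ shift x k.
Proof.
move=> k0 /M1_0[x1 kE]; have [|x0 x0E] := @M0_1 (P1 1 x1); first by rewrite -cmapE -kE.
by exists (P0 2 x0); split; [rewrite -cmapE -x0E PP | exists x0, x1].
Qed.

Lemma shiftB x k y l : shift x k -> shift y l -> shift (x - y) (k - l).
Proof.
move=> [x0 [x1 [-> hx <-]]] [y0 [y1 [-> hy <-]]].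
by exists (x0 - y0), (x1 - y1); rewrite !raddfB hx hy.
Qed.

Lemma shift_bd w k : shift (bd Mm 2 w) k -> exists m, P1 1 m = 0 /\ k = bd M1 0 m.
Proof.
move=> [x0 [x1 [xE h <-]]]; have [w0 wE] := P0_surj w.
have [|w1 w1E] := @P_exact 2 (x0 - bd M0 2 w0).
  by rewrite raddfB -xE wE cmapE subrr.
exists (x1 - bd M1 1 w1); rewrite !raddfB bdK subr0 cmapE -w1E raddfB bdK subr0.
by rewrite -h subrr.
Qed.

Lemma shift_bd_inv x m : P1 1 m = 0 -> shift x (bd M1 0 m) -> exists w, x = bd Mm 2 w.
Proof.
move=> m0 [x0 [x1 [-> h hm]]].
have [|w1 w1E] := @M1_1 (x1 - m); first by rewrite raddfB hm subrr.
have [|w0 w0E] := @M0_2 (x0 - P1 2 w1).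
  by rewrite raddfB h -cmapE -w1E raddfB m0 subr0 subrr.
by exists (P0 3 w0); rewrite -cmapE -w0E raddfB PP subr0.
Qed.

End Shift.

Section Boole.

(** The boundary of the edge whose first vertex is coded by b. Its kernel is generated by the sum of
    both edges, the image of [bool_sum], which is the source of h. *)
Definition bool_bd : {additive {freeg bool} -> {freeg bool}} :=
  flift (fun b => << ~~ b >> - << b >>).
Definition bool_sum : {additive {freeg unit} -> {freeg bool}} :=
  flift (fun _ => << false >> + << true >>).

Lemma bool_exact1 x : bool_bd x = 0 -> exists y, x = bool_sum y.
Proof.
move=> x0.
pose p : {additive {freeg bool} -> {freeg unit}} := flift (fun b => if b then 0 else << tt >>).
pose j : {additive {freeg unit} -> {freeg bool}} := flift (fun _ => << true >>).
exists (p x); apply/eqP; rewrite -subr_eq0; apply/eqP.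
transitivity (j (p (bool_bd x))); last by rewrite x0 !raddf0.
rewrite -[LHS]/((idfun \- (bool_sum \o p) : {additive _ -> _}) x).
rewrite -[RHS]/((j \o p \o bool_bd : {additive _ -> _}) x).
move: x {x0}; apply: freeg_additive_eq => -[].
  rewrite -[LHS]/(<< true >> - bool_sum (p << true >>)) -[RHS]/(j (p (bool_bd << true >>))).
  rewrite [p << true >>]fliftU [bool_bd _]fliftU (raddfB p) ![p << _ >>]fliftU.
  by rewrite !raddf0 !addr0 [RHS]fliftU.
rewrite -[LHS]/(<< false >> - bool_sum (p << false >>)) -[RHS]/(j (p (bool_bd << false >>))).
rewrite [p << false >>]fliftU [bool_bd _]fliftU (raddfB p) ![p << _ >>]fliftU.
by rewrite !(raddf0, add0r) raddfN [j _]fliftU [bool_sum _]fliftU opprD addrA subrr add0r.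
Qed.

Lemma bool_exact0 x : freeg_map (fun _ => tt) x = 0 -> exists y, x = bool_bd y.
Proof.
move=> x0.
pose p : {additive {freeg bool} -> {freeg bool}} := flift (fun b => if b then 0 else << true >>).
pose j : {additive {freeg unit} -> {freeg bool}} := flift (fun _ => << true >>).
exists (p x); apply/eqP; rewrite -subr_eq0; apply/eqP.
transitivity (j (freeg_map (fun _ => tt) x)); last by rewrite x0 raddf0.
rewrite -[LHS]/((idfun \- (bool_bd \o p) : {additive _ -> _}) x).
rewrite -[RHS]/((j \o freeg_map (fun _ => tt) : {additive _ -> _}) x).
move: x {x0}; apply: freeg_additive_eq => b.
rewrite -[LHS]/(<< b >> - bool_bd (p << b >>)) -[RHS]/(j (freeg_map (fun _ => tt) << b >>)).
rewrite freeg_mapU [j _]fliftU [p _]fliftU; case: b; first by rewrite (raddf0 bool_bd) subr0.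
by rewrite [bool_bd _]fliftU opprB addrC subrK.
Qed.

Lemma bool_sum_bd x : bool_bd (bool_sum x) = 0.
Proof.
move: x; apply: freeg_ind => [|x y hx hy|s]; first by rewrite !raddf0.
  by rewrite !raddfB hx hy subrr.
by rewrite [bool_sum _]fliftU raddfD ![bool_bd _]fliftU /= addrC subrKA subrr.
Qed.

End Boole.

Section Augmentation.
Variables (G : groupType) (S : choiceType) (a : action G S).

Lemma aug_act g (x : {freeg S}) : freeg_map (fun _ => tt) (actf a g x) =
  actf (trivial_action G) g (freeg_map (fun _ => tt) x).
Proof. by rewrite /actf !freeg_map_comp; apply: eq_freeg_map. Qed.

Definition aug_map : chain_map (nerve_complex a) (point_complex G) := hat_map aug_act.

Lemma aug_surj (s : S) n (x : point_complex G n) : exists y, x = aug_map n y.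
Proof.
exists (hat (freeg_map (fun _ => s)) x).
move: x; apply: tens_ind => [|x y hx hy|t x]; first by rewrite !raddf0.
  by rewrite [in RHS]raddfB [in RHS]raddfB -hx -hy.
rewrite -[RHS]/(hat (freeg_map (fun _ => tt)) (hat (freeg_map (fun _ => s)) (tens t x))).
by rewrite !hat_tens freeg_map_comp freeg_map_id // => -[].
Qed.

End Augmentation.

Section ActfTens.
Variables (G : groupType) (S : choiceType) (a : action G S).
Local Notation K := (nerve_complex a).

Lemma bd0_tens g z : bd K 0 (tens [tuple g] z) = tens [tuple] (actf a g^-1%g z - z).
Proof. by rewrite nerve_bd0 raddfB. Qed.

Lemma tens_mul g h z : actf a g^-1%g z = z ->
  tens [tuple (g * h)%g] z = tens [tuple g] z + tens [tuple h] z
    - bd K 1 (tens [tuple g; (g * h)%g] z).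
Proof.
by move=> gz; rewrite nerve_bd1 gz mulKg opprD opprB [RHS]addrC addrA subrK subrK.
Qed.

Lemma tens1 z : tens [tuple 1%g] z = bd K 1 (tens [tuple 1%g; 1%g] z).
Proof. by rewrite nerve_bd1 invg1 mulg1 actf1 subrr add0r. Qed.

Lemma actfV_fix g z : actf a g z = z -> actf a g^-1%g z = z.
Proof. by move=> gz; rewrite -[in LHS]gz -actfM mulVg actf1. Qed.

End ActfTens.

(** * From relative classes to one-cycles with coefficients in Z_1 *)

Section Reduction.
Variable A : comPzRingType.
Hypothesis A_universal : universal_GE2_ring A.
Hypothesis A_nontrivial : (1 : A) <> 0.
Hypothesis A_TB : forall i : nat, (i <= 3)%N ->
  bijective (group_homology_map (@T2_to_B2 A) i).

Local Notation K p := (nerve_complex (X_action A p)).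
Local Notation act n g := (actf (X_action A n) g).
Local Notation del p := (hat (bd (X_complex A) p)).

Definition del_map p : chain_map (K p.+1) (K p) :=
  hat_map (fun g x => @X_bd_act A p g x).

Lemma del_bd p n (x : K p.+1 n.+1) : del p (bd (K p.+1) n x) = bd (K p) n (del p x).
Proof. exact: (cmapE (del_map p)). Qed.

Lemma bool_bd_act g x : bool_bd (actf (SM2_action A_nontrivial) g x) =
  actf (SM2_action A_nontrivial) g (bool_bd x).
Proof.
move: x; apply: freeg_ind => [|x y hx hy|b]; first by rewrite !raddf0.
  by rewrite !raddfB hx hy.
rewrite /actf freeg_mapU ![bool_bd _]fliftU raddfB !freeg_mapU.
by rewrite /= /SM2_act addNb.
Qed.

Definition bool_del_map := hat_map bool_bd_act.

Lemma bool_to_X1_tens n t x : bool_to_X1 A_nontrivial n (tens t x) =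
  tens (map_tuple val t) (freeg_map (@bool_edge A) x).
Proof. exact: equiv_map_tens. Qed.

Lemma bool_to_X0_tens n t x : bool_to_X0 A_nontrivial n (tens t x) =
  tens (map_tuple val t) (freeg_map (@bool_vert A) x).
Proof. exact: equiv_map_tens. Qed.

Lemma bool_del_map_tens n t x : bool_del_map n (tens t x) = tens t (bool_bd x).
Proof. exact: hat_tens. Qed.

Lemma del_map_tens p n t x : del_map p n (tens t x) = tens t (bd (X_complex A) p x).
Proof. exact: hat_tens. Qed.

Lemma aug_map_tens (G : groupType) (S : choiceType) (a : action G S) n t x :
  aug_map a n (tens t x) = tens t (freeg_map (fun _ => tt) x).
Proof. exact: hat_tens. Qed.

Lemma point_map_tens n t x :
  point_map (SM2_incl A) n (tens t x) = tens (map_tuple val t) x.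
Proof.
rewrite [LHS](equiv_map_tens (a := trivial_action _) (a' := trivial_action _) (v := id)) //.
by rewrite freeg_map_id.
Qed.

Lemma del_bool n x :
  del_map 0 n (bool_to_X1 A_nontrivial n x) =
  bool_to_X0 A_nontrivial n (bool_del_map n x).
Proof.
move: x; apply: tens_ind => [|x y hx hy|t x]; first by rewrite !raddf0.
  by rewrite !raddfB hx hy.
rewrite bool_to_X1_tens bool_del_map_tens del_map_tens bool_to_X0_tens; congr (tens _ _).
move: x; apply: freeg_ind => [|x y hx hy|b]; first by rewrite !raddf0.
  by rewrite !raddfB hx hy.
rewrite [bool_bd _]fliftU raddfB !freeg_mapU X_bd0U.
by rewrite bool_edge_face0 bool_edge_face1.
Qed.

Lemma aug_bool n x :
  aug_map (X_action A 0) n (bool_to_X0 A_nontrivial n x) =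
  point_map (SM2_incl A) n (aug_map (SM2_action A_nontrivial) n x).
Proof.
move: x; apply: tens_ind => [|x y hx hy|t x]; first by rewrite !raddf0.
  by rewrite !raddfB hx hy.
rewrite bool_to_X0_tens !aug_map_tens point_map_tens; congr (tens _ _).
by rewrite freeg_map_comp; apply: eq_freeg_map.
Qed.

Let P0 := cone_map (@aug_bool).
Let P1 := cone_map (@del_bool).

Lemma PP n x : P0 n (P1 n x) = 0.
Proof.
case: x => x x'; congr pair.
  rewrite -[LHS]/(hat (freeg_map (fun _ => tt)) (del 0 x)).
  apply: hat_comp0 => y; move: y; apply: freeg_ind => [|y z hy hz|e]; first by rewrite !raddf0.
    by rewrite !raddfB hy hz subrr.
  by rewrite X_bd0U raddfB !freeg_mapU subrr.
rewrite -[LHS]/(hat (freeg_map (fun _ => tt)) (hat bool_bd x')).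
apply: hat_comp0 => y; move: y; apply: freeg_ind => [|y z hy hz|e]; first by rewrite !raddf0.
  by rewrite !raddfB hy hz subrr.
by rewrite [bool_bd _]fliftU raddfB !freeg_mapU subrr.
Qed.

Lemma P0_surj n x : exists y, x = P0 n y.
Proof.
case: x => x x'; have [y ->] := aug_surj (X_action A 0) (X_inf A) x.
by have [y' ->] := aug_surj (SM2_action A_nontrivial) false x'; exists (y, y').
Qed.

Lemma P_exact n x : P0 n x = 0 -> exists y, x = P1 n y.
Proof.
case: x => x x' [hx hx'].
have [y yE] := hat_exact (@X_exact0 A A_universal) hx.
have [y' y'E] := hat_exact bool_exact0 hx'.
by exists (y, y'); rewrite yE y'E.
Qed.

Definition hyper_chain n : {additive {freeg (n.-tuple (SM2 A) * unit)} -> K 1%N n} :=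
  bool_to_X1 A_nontrivial n \o hat bool_sum.

Lemma hyper_chain_tens n t : hyper_chain n << (t, tt) >> = tens (map_tuple val t) (hyper A).
Proof.
rewrite -[LHS]/(bool_to_X1 A_nontrivial n (hat bool_sum << (t, tt) >>)) -tensU.
rewrite hat_tens bool_to_X1_tens [bool_sum _]fliftU raddfD !freeg_mapU /hyper.
by congr (tens _ _).
Qed.

(* The isomorphism of H_3(SL_2, SM_2) with H_1(SL_2, Z_1) modulo the classes of
   hyper (x) g, g in SM_2, as a relation between classes and one-cycles. *)
Definition Rel (al : H_SL2_SM2 A 3) (k : K 1%N 1%N) : Prop :=
  exists x x', [/\ rel_class al x,
    bd (point_complex (SL2 A)) 2 x = point_map (SM2_incl A) 2 x' &
    shift P0 P1 (x, x') (k, 0)].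

Let fI n : injective (point_map (SM2_incl A) n) := @point_map_inj _ _ (SM2_incl A) n val_inj.

Let e := @cone_end _ _ (bool_to_X1 A_nontrivial).
Let M1_0 := cone_acyclic0 (@cone_X1_acyclic A A_nontrivial 0).
Let M1_1 := cone_acyclicS (@cone_X1_acyclic A A_nontrivial 1).
Let M0_1 := cone_acyclicS (@cone_X0_acyclic A A_nontrivial A_TB 1 isT).
Let M0_2 := cone_acyclicS (@cone_X0_acyclic A A_nontrivial A_TB 2 isT).

Lemma freeg_double0 (T : choiceType) (x : {freeg T}) : x + x = 0 -> x = 0.
Proof.
move=> xx; apply/eqP/freeg_eqP => t; have := congr1 (coeff t) xx.
by rewrite coeffD coeff0; move: (coeff t x) => c; lia.
Qed.

Lemma K0_inj (T : Type) (S : choiceType) : injective (fun b : 0.-tuple T * S => b.2).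
Proof. by move=> [t s] [t' s'] /= ->; rewrite [t]tuple0 [t']tuple0. Qed.

(** The double shift gives a pair (k, k') where k' is an integer multiple of h and [bd k] is the
    image of k'. Boundaries have augmentation 0 and h has augmentation 2, so k' = 0. *)
Lemma Rel_total al : exists k, Rel al k.
Proof.
have [x xE] := rel_class_total al; have [x' x'E] := rel_class_bd xE.
have dx' : bd (point_complex (SM2 A)) 1 x' = 0.
  by apply: fI; rewrite cmapE -x'E bdK raddf0.
have [|[k k'] kE] := shift_total P0_surj P_exact (x := (x, x')).
  by rewrite /= /cone_bd /= x'E subrr dx' oppr0.
suff k'0 : k' = 0 by exists k, x, x'; rewrite k'0 in kE.
have [[_ k'1] /= ke] := shift_im (e := e) (@cone_end_bd _ _ _) kE.
have [l lE] := hat_exact bool_exact1 k'1.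
pose eps (S : choiceType) : {additive {freeg (0.-tuple (SL2 A) * S)} -> {freeg unit}} :=
  freeg_map (fun _ => tt).
have epsd y : eps _ (bd (K 1%N) 0 y) = 0.
  move: y; apply: tens_ind => [|y z hy hz|t y]; first by rewrite !raddf0.
    by rewrite !raddfB hy hz subrr.
  rewrite (tuple1E t) bd0_tens raddfB /eps raddfB /tens /actf !freeg_map_comp.
  by rewrite (eq_freeg_map (g := fun _ => tt)) ?subrr.
have : eps _ (bool_to_X1 A_nontrivial 0 k') = 0.
  by rewrite -(epsd k); move/eqP: ke; rewrite /cone_end subr_eq0 => /eqP ->.
rewrite lE.
have -> : eps _ (bool_to_X1 A_nontrivial 0 (hat bool_sum l)) =
    freeg_map (fun b => b.2) l + freeg_map (fun b => b.2) l.
  move: l {lE}; apply: freeg_ind => [|y z hy hz|[t []]]; first by rewrite !raddf0 addr0.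
    by rewrite !raddfB hy hz opprD addrACA.
  rewrite [bool_to_X1 _ _ _](hyper_chain_tens t) /hyper raddfD !tensU raddfD.
  by rewrite /eps !freeg_mapU.
move=> /freeg_double0 l0; have -> : l = 0.
  by apply: (freeg_map_inj (@K0_inj _ _)); rewrite l0 raddf0.
exact: raddf0.
Qed.

Lemma Rel_cycle al k : Rel al k -> del 0 k = 0 /\ bd (K 1%N) 0 k = 0.
Proof.
move=> [x [x' [_ _ /(shift_im (e := e) (@cone_end_bd _ _ _))[[k0 _]]]]].
by rewrite /e /cone_end /= raddf0 subr0.
Qed.

Lemma Rel_ex k : del 0 k = 0 -> bd (K 1%N) 0 k = 0 -> exists al, Rel al k.
Proof.
move=> k0 dk; have k0' : P1 0 (k, 0) = 0 by congr pair; rewrite //= raddf0.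
have ek : e (k, 0) = 0 by rewrite /e /cone_end /= dk raddf0 subrr.
have [[x x'] [/cone_bd0P[xx' _] xk]] := shift_surj PP M1_0 M0_1 k0' ek.
have [al alE] := rel_class_ex xx'.
by exists al, x, x'.
Qed.

Lemma RelB al be k l : Rel al k -> Rel be l -> Rel (al - be) (k - l).
Proof.
move=> [x [x' [hx xx' xk]]] [y [y' [hy yy' yl]]]; exists (x - y), (x' - y').
split; [exact: rel_classB | by rewrite !raddfB xx' yy' |].
by have := shiftB xk yl; rewrite (_ : (k, 0) - (l, 0) = (k - l, 0)) //; congr pair; apply: subrr.
Qed.

Lemma Rel0_chain k : Rel 0 k -> exists m l,
  del 0 m = 0 /\ k = bd (K 1%N) 1 m + hyper_chain 1 l.
Proof.
move=> [x [x' [/rel_class0[y [y' xE]] xx' xk]]].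
have x'E : x' = bd _ 2 y'.
  by apply: fI; rewrite cmapE -xx' xE raddfD bdK add0r.
have xxE : (x, x') = bd (cone (point_map (SM2_incl A))) 2 (y, - y').
  by congr pair; rewrite /= !raddfN !opprK.
rewrite xxE in xk; have [[m m'] [[m0 m'0] [kE _]]] := shift_bd P0_surj P_exact xk.
have [l lE] := hat_exact bool_exact1 m'0.
by exists m, (- l); split=> //; rewrite kE lE raddfN.
Qed.

Lemma bool_sum_act (g : SM2 A) x : bool_sum (actf (trivial_action (SM2 A)) g x) =
  actf (SM2_action A_nontrivial) g (bool_sum x).
Proof.
rewrite /actf freeg_map_id //.
move: x; apply: freeg_ind => [|x y hx hy|s]; first by rewrite !raddf0.
  by rewrite !raddfB -hx -hy.
rewrite [bool_sum _]fliftU raddfD !freeg_mapU /= /SM2_act.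
by case: (SM2_swap g); rewrite //= addrC.
Qed.

Lemma Rel_eq0_chain al m l : del 0 m = 0 ->
  Rel al (bd (K 1%N) 1 m + hyper_chain 1 l) -> al = 0.
Proof.
move=> m0 [x [x' [hx _ xk]]].
have dl : bd (nerve_complex (SM2_action A_nontrivial)) 0 (hat bool_sum l) = 0.
  rewrite -(hat_bd bool_sum_act) (_ : bd (point_complex _) 0 l = 0) ?raddf0 //.
  move: l {xk}; apply: tens_ind => [|y z hy hz|t y]; first by rewrite raddf0.
    by rewrite raddfB hy hz subrr.
  by rewrite (tuple1E t) bd0_tens /actf freeg_map_id // subrr raddf0.
have kE : (bd (K 1%N) 1 m + hyper_chain 1 l, 0) =
    bd (cone (bool_to_X1 A_nontrivial)) 0 (m, - hat bool_sum l).
  by congr pair; rewrite /= !raddfN opprK // dl.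
have m0' : P1 1 (m, - hat bool_sum l) = 0.
  congr pair => //; rewrite -[LHS]/(hat bool_bd (- hat bool_sum l)) raddfN.
  by rewrite (hat_comp0 bool_sum_bd) oppr0.
rewrite kE in xk; have [[y y'] [xE _]] := shift_bd_inv PP M1_1 M0_2 m0' xk.
by move: hx; rewrite xE /= -raddfN; apply: rel_class_eq0.
Qed.

Lemma hyper_act (g : SM2 A) : act 1 (val g) (hyper A) = hyper A.
Proof.
rewrite /hyper raddfD !actU; have [a [b [ab [gE|gE]]]] := SM2P g.
  by rewrite (diag_edge ab gE).1 (diag_edge ab gE).2.
by rewrite (anti_edge ab gE).1 (anti_edge ab gE).2 addrC.
Qed.

Lemma bd_hyper : bd (X_complex A) 0 (hyper A) = 0.
Proof.
by rewrite /hyper raddfD !X_bd0U edge_iz_face0 edge_iz_face1 edge_zi_face0 edge_zi_face1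
  addrC subrKA subrr.
Qed.

Lemma del_tens n (t : n.-tuple (SL2 A)) z :
  bd (X_complex A) 0 z = 0 -> del 0 (tens t z) = 0.
Proof. by move=> z0; rewrite hat_tens z0 raddf0. Qed.

(** SM_2 fixes [hyper], so on classes g |-> g (x) hyper is a homomorphism. Hence any combination of
    such classes is a single one ([hyper_chain_single]). *)
Lemma hyper_mul (g h : SM2 A) : exists m, del 0 m = 0 /\
  tens [tuple val (g * h)%g] (hyper A) =
  tens [tuple val g] (hyper A) + tens [tuple val h] (hyper A) + bd (K 1%N) 1 m.
Proof.
exists (- tens [tuple val g; (val g * val h)%g] (hyper A)).
rewrite raddfN (del_tens _ bd_hyper) oppr0; split=> //; rewrite raddfN.
exact: (tens_mul _ (actfV_fix (hyper_act g))).
Qed.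

Lemma hyper_one : exists m, del 0 m = 0 /\
  tens [tuple val (1%g : SM2 A)] (hyper A) = bd (K 1%N) 1 m.
Proof.
exists (tens [tuple 1%g; 1%g] (hyper A)); rewrite (del_tens _ bd_hyper); split=> //.
exact: tens1.
Qed.

Lemma hyper_div (g h : SM2 A) : exists m, del 0 m = 0 /\
  tens [tuple val g] (hyper A) - tens [tuple val h] (hyper A) =
  tens [tuple val (g * h^-1)%g] (hyper A) + bd (K 1%N) 1 m.
Proof.
have [m [m0 mE]] := hyper_mul (g * h^-1)%g h.
by exists m; split=> //; rewrite mulgVK in mE; rewrite mE addrAC addrK.
Qed.

Lemma hyper_chain_single l : exists (g : SM2 A) m, del 0 m = 0 /\
  hyper_chain 1 l = tens [tuple val g] (hyper A) + bd (K 1%N) 1 m.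
Proof.
move: l; apply: freeg_ind => [|x y [g [m [m0 hx]]] [g' [m' [m'0 hy]]]|[t []]].
- have [m [m0 mE]] := hyper_one; exists 1%g, (- m).
  by rewrite !raddfN m0 oppr0 raddf0 mE subrr.
- have [m1 [m10 m1E]] := hyper_div g g'; exists (g * g'^-1)%g, (m1 + (m - m')).
  rewrite !raddfD !raddfN m0 m'0 m10 oppr0 !addr0; split=> //.
  by rewrite hx hy opprD addrACA m1E -addrA [in LHS]/hyper raddfD.
exists (thead t), 0; rewrite !raddf0 addr0; split=> //.
rewrite hyper_chain_tens; congr (tens _ _); apply: eq_from_tnth => i.
by rewrite ord1 tnth_map tnth0.
Qed.

Lemma Rel0 k : Rel 0 k -> exists (g : SM2 A) m,
  del 0 m = 0 /\ k = tens [tuple val g] (hyper A) + bd (K 1%N) 1 m.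
Proof.
move=> /Rel0_chain[m [l [m0 ->]]]; have [g [m' [m'0 ->]]] := hyper_chain_single l.
exists g, (m + m'); rewrite !raddfD m0 m'0 addr0; split=> //.
by rewrite addrCA.
Qed.

Lemma Rel_eq0 al (g : SM2 A) m : del 0 m = 0 ->
  Rel al (tens [tuple val g] (hyper A) + bd (K 1%N) 1 m) -> al = 0.
Proof.
move=> m0; have -> : tens [tuple val g] (hyper A) = hyper_chain 1 << ([tuple g], tt) >>.
  rewrite hyper_chain_tens; congr (tens _ _); apply: eq_from_tnth => i.
  by rewrite ord1 tnth_map !tnth0.
by rewrite addrC; apply: Rel_eq0_chain.
Qed.

End Reduction.

(** * Coinvariants and one-cycles of a permutation module *)

Section ZeroChains.
Variables (G : groupType) (S : choiceType) (a : action G S).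
Local Notation K := (nerve_complex a).

Lemma tens_inj (T S' : choiceType) (t : T) : injective (@tens T S' t).
Proof. by apply: freeg_map_inj => s s' []. Qed.

Lemma zero_chainP (w : K 0%N) : exists z, w = tens [tuple] z.
Proof.
move: w; apply: tens_ind => [|x y [x' ->] [y' ->]|t x]; first by exists 0; rewrite raddf0.
  by exists (x' - y'); rewrite raddfB.
by exists x; rewrite [t]tuple0.
Qed.

Lemma bd0_coinv (y : K 1%N) z : bd K 0%N y = tens [tuple] z ->
  z \in spanp [set m' | exists g m, m' = actf a g m - m].
Proof.
have snd_tens w : freeg_map (fun b : 0.-tuple G * S => b.2) (tens [tuple] w) = w.
  by rewrite [LHS]freeg_map_comp freeg_map_id.
move=> yz; rewrite -[z]snd_tens -yz.
move: y {z yz}; apply: tens_ind => [|x y hx hy|t x]; first by rewrite !raddf0 rpred0.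
  by rewrite !raddfB rpredB.
rewrite (tuple1E t) bd0_tens snd_tens; apply: mem_spanp.
by exists (thead t)^-1%g, x.
Qed.

Lemma coinv_bd0 z : z \in spanp [set m' | exists g m, m' = actf a g m - m] ->
  exists y, bd K 0%N y = tens [tuple] z.
Proof.
move: z; apply: spanp_ind => [|x y [x' hx] [y' hy]|_ [g [m ->]]].
- by exists 0; rewrite !raddf0.
- by exists (x' - y'); rewrite !raddfB hx hy.
by exists (tens [tuple g^-1%g] m); rewrite bd0_tens invgK.
Qed.

Lemma orbit_reps (s0 : S) : exists (r : S -> S) (gam : S -> G),
  (forall s, a (gam s) (r s) = s) /\ (forall g s, r (a g s) = r s).
Proof.
pose O (s : S) : set S := fun t => exists g, a g t = s.
(* Choosing a point for each set, not for each s, gives all points of an orbit the same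
   representative, since their orbits are equal as sets. *)
have /choice[f fP] (U : set S) : exists t, (exists x, U x) -> U t.
  have [[x Ux]|nU] := pselect (exists x, U x); first by exists x.
  by exists s0 => /nU.
have /choice[gam gamE] s : exists g, a g (f (O s)) = s.
  by apply: (fP (O s)); exists s, 1%g; rewrite act1.
exists (fun s => f (O s)), gam; split=> // g s; congr f.
apply/seteqP; split=> t [h ht].
  by exists (g^-1 * h)%g; rewrite actM ht actK.
by exists (g * h)%g; rewrite actM ht.
Qed.

(* Degree one of Shapiro's lemma: a one-cycle is carried by the stabilizers. *)
Lemma cycle1_stab (P : K 1%N -> Prop) :
  S -> P 0 -> (forall x y, P x -> P y -> P (x - y)) -> (forall m, P (bd K 1%N m)) ->
  (forall g s, a g s = s -> P << ([tuple g], s) >>) ->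
  forall x, bd K 0%N x = 0 -> P x.
Proof.
move=> s0 P0 PB Pbd Pst x x0; have [r [gam [gamE rE]]] := orbit_reps s0.
have PN y : P y -> P (- y) by rewrite -sub0r; apply: PB.
have PD y z : P y -> P z -> P (y + z) by move=> Py /PN; rewrite -{2}[z]opprK; apply: PB.
pose b : {additive K 0%N -> K 1%N} := flift (fun c => << ([tuple gam c.2], c.2) >>).
(* As bd x = 0, adding b (bd x) changes nothing; it joins both ends of each (g; s) to the orbit
   representative, and modulo boundaries only the loop [sg] at r s remains. *)
rewrite -[x]addr0 -[0](raddf0 b) -x0.
move: x {x0}; apply: tens_ind => [|x y hx hy|t x]; first by rewrite !raddf0 addr0.
  by rewrite !raddfB addrACA -opprD; apply: PB.
move: x; apply: freeg_ind => [|x y hx hy|s]; first by rewrite !raddf0 addr0.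
  by rewrite !raddfB addrACA -opprD; apply: PB.
rewrite (tuple1E t) bd0_tens (_ : actf a _ << s >> = << a (thead t)^-1%g s >>); last first.
  exact: freeg_mapU.
rewrite (raddfB (tens _)) !tensU (raddfB b) ![b _]fliftU /=.
set g := thead t; set s' := a g^-1%g s.
have rs' : r s' = r s by rewrite /s' rE.
pose sg := ((gam s)^-1 * g * gam s')%g.
have sgE : a sg (r s) = r s.
  by rewrite /sg !actM -{1}rs' gamE /s' actKV -{2}[s]gamE actK.
have P2 h k u : P (<< ([tuple (h * k)%g], u) >> - << ([tuple h], u) >>
    - << ([tuple k], a h^-1%g u) >>).
  have := PN _ (Pbd (tens [tuple h; (h * k)%g] << u >>)).
  rewrite nerve_bd1 mulKg /actf freeg_mapU !tensU; congr P.
  by rewrite opprD opprB addrAC; rewrite -!addrA; congr (_ + _); rewrite addrC.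
have h1 := P2 (gam s)^-1%g (g * gam s')%g (r s); rewrite mulgA -/sg invgK gamE in h1.
have h2 := P2 g (gam s') s; rewrite -/s' in h2.
have h3 := P2 (gam s) (gam s)^-1%g s.
have gs : a (gam s)^-1%g s = r s by rewrite -{2}[s]gamE actK.
rewrite mulgV gs in h3.
have h4 : P << ([tuple 1%g], s) >>.
  by rewrite -tensU (tens1 a); apply: Pbd.
have := PD _ _ (PB _ _ (PB _ _ (PB _ _ h3 h1) h2) h4) (Pst _ _ sgE); congr P.
set I := << ([tuple 1%g], s) >>; set Z := << ([tuple gam s], s) >>.
set U := << ([tuple sg], r s) >>; set W := << ([tuple (gam s)^-1%g], r s) >>.
set V := << ([tuple (g * gam s')%g], s) >>; set X := << ([tuple g], s) >>.
set Y := << ([tuple gam s'], s') >>.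
rewrite !opprD !opprK !addrA.
rewrite [LHS](ACl ((8*9*2)*(1*10)*(3*5)*(4*11)*(6*7)))/=.
by rewrite !subrr !addNr !addr0.
Qed.

End ZeroChains.

(** * The map to RP *)

Section Triangles.
Variable A : comPzRingType.
Implicit Types (a b : A) (g : SL2 A).

Lemma X_act_triple g u v w u' v' w' uv uw vw uv' uw' vw' :
  line (val g *m u) = line u' -> line (val g *m v) = line v' ->
  line (val g *m w) = line w' ->
  X_act_simplex g (@X_triple A u v w uv uw vw) = @X_triple A u' v' w' uv' uw' vw'.
Proof. by move=> e1 e2 e3; apply: val_inj; apply: val_inj; rewrite /= !line_actE e1 e2 e3. Qed.

Lemma X_tripleP (s : X_simplex A 2) : exists u v w uv uw vw, s = @X_triple A u v w uv uw vw.
Proof.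
case: s => t /= /[dup] /asboolP[v [vu vt vi]] adm.
have h i j : i != j -> is_unit (vdet (v i) (v j)).
  move=> ij; have [N [/(congr1 determinant) + _]] := vi i j ij.
  rewrite det_mulmx det1 row_mxE2 det_mx2E !mxE /= => MN.
  by exists (\det N); rewrite /vdet.
pose i1 : 'I_3 := Ordinal (isT : 1 < 3)%N; pose i2 : 'I_3 := Ordinal (isT : 2 < 3)%N.
exists (v ord0), (v i1), (v i2), (h ord0 i1 isT), (h ord0 i2 isT), (h i1 i2 isT).
apply: val_inj; apply: eq_from_tnth => -[[|[|[|//]]] hi] /=; rewrite vt (tnth_nth set0) /=;
  by congr (line (v _)); apply: val_inj.
Qed.

Lemma is_unitMr a b : is_unit (a * b) -> is_unit b.
Proof. by move=> [c abc]; exists (a * c); rewrite mulrCA mulrA. Qed.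

(** Once the first two lines are oo and 0, a generator of the third has two unit entries, and a is
    their quotient. *)
Lemma X_triangle_trans (s : X_simplex A 2) : exists g a (ha : is_unit a),
  X_act_simplex g (X_inf_zero ha) = s.
Proof.
have [u [v [w [uv [uw [vw ->]]]]]] := X_tripleP s.
have [g []] := invertible2_SL2_lines (invertible_row_mx uv).
have -> : col 0 (row_mx u v) = u by apply/colP => i; rewrite mxE (row_mx_colE u v i).1.
have -> : col 1 (row_mx u v) = v by apply/colP => i; rewrite mxE (row_mx_colE u v i).2.
move=> gu gv; have [hu hv] := vdet_unimodular uv.
have [x xE] := line_scaleP hu (esym gu); have [y yE] := line_scaleP hv (esym gv).
pose w' := val g^-1%g *m w.
have wE : w = val g *m w' by rewrite /w' mulmxA -SL2_valM mulgV mul1mx.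
have hq : is_unit (w' 1 0).
  apply: (@is_unitMr (uval x)); move: uw.
  rewrite xE wE -[val g *m w']scale1r vdet_scale vdet_SL2 mulr1 vec_infE [w' in vdet _ w']cvE.
  by rewrite vdet_cv mul1r mulr0 subr0.
have hp : is_unit (w' 0 0).
  apply: (@is_unitMr (- uval y)); move: vw.
  rewrite yE wE -[val g *m w']scale1r vdet_scale vdet_SL2 mulr1 vec_zeroE [w' in vdet _ w']cvE.
  by rewrite vdet_cv mul0r mulr1 sub0r mulrN mulNr.
have [p' pp] := hp; have [q' qq] := hq.
have ha : is_unit (w' 1 0 * p').
  by exists (q' * w' 0 0); rewrite mulrACA qq mul1r mulrC.
exists g, (w' 1 0 * p'), ha; apply: X_act_triple => //.
rewrite wE; symmetry; apply: (line_eqP hp); rewrite scalemxAr; congr (_ *m _).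
by rewrite vec_ptE scale_cv mulr1 mulrCA pp mulr1 -cvE.
Qed.

Hypothesis A_mu2 : forall x : mu2 A, x = 1 :> A \/ x = -1 :> A.

Lemma sqr1_cases a : a * a = 1 -> a = 1 \/ a = -1.
Proof.
move=> aa; have a2 : a ^+ 2 == 1 by rewrite expr2 aa.
exact: (A_mu2 (Mu2 a2)).
Qed.

(** A conjugate of g fixes oo, 0 and a unit point a, so it is a scalar c with c^2 = 1; both possible
    scalars are central. *)
Lemma X_triangle_stab g (s : X_simplex A 2) : X_act_simplex g s = s ->
  g = 1%g \/ g = minus1 A.
Proof.
have [k [a [ha <-]]] := X_triangle_trans s; move=> gs.
pose h := (k^-1 * g * k)%g.
have hs : X_act_simplex h (X_inf_zero ha) = X_inf_zero ha.
  by rewrite !X_act_simplexM gs -X_act_simplexM mulVg X_act_simplex1.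
have gE : g = (k * h * k^-1)%g by rewrite /h !mulgA mulgV mul1g mulgK.
have ln (i : 'I_3) : line_act h (tnth (val (X_inf_zero ha)) i) = tnth (val (X_inf_zero ha)) i.
  by rewrite -[in RHS]hs tnth_map.
have h10 : h 1 0 = 0.
  have := ln ord0; rewrite !(tnth_nth set0) /= line_actE vec_infE SL2_cv mx2_cv => lE.
  have [b _] : line (cv 1 0) (cv (h 0 0 * 1 + h 0 1 * 0) (h 1 0 * 1 + h 1 1 * 0)).
    by rewrite -lE; exists 1; rewrite ?scale1r.
  rewrite scale_cv mulr0 => /(congr1 (fun v : 'cV[A]_2 => v 1 0)).
  by rewrite !mxE /= mulr1 mulr0 addr0.
have h01 : h 0 1 = 0.
  have := ln (Ordinal (isT : 1 < 3)%N).
  rewrite !(tnth_nth set0) /= line_actE vec_zeroE SL2_cv mx2_cv => lE.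
  have [b _] : line (cv 0 1) (cv (h 0 0 * 0 + h 0 1 * 1) (h 1 0 * 0 + h 1 1 * 1)).
    by rewrite -lE; exists 1; rewrite ?scale1r.
  rewrite scale_cv mulr0 => /(congr1 (fun v : 'cV[A]_2 => v 0 0)).
  by rewrite !mxE /= mulr1 mulr0 add0r.
have hh : h 0 0 = h 1 1.
  have := ln (Ordinal (isT : 2 < 3)%N).
  rewrite !(tnth_nth set0) /= line_actE vec_ptE SL2_cv h10 h01 mx2_cv => lE.
  have [b _] : line (cv 1 a) (cv (h 0 0 * 1 + 0 * a) (0 * 1 + h 1 1 * a)).
    by rewrite -lE; exists 1; rewrite ?scale1r.
  rewrite scale_cv => /[dup] /(congr1 (fun v : 'cV[A]_2 => v 0 0)) +
    /(congr1 (fun v : 'cV[A]_2 => v 1 0)).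
  rewrite !mxE /= !(mul0r, mulr1, addr0, add0r) => -> ba; have [a' aa'] := ha.
  by rewrite -[LHS]mulr1 -aa' mulrA ba -mulrA aa' mulr1.
have := SL2_det h; rewrite h10 mulr0 subr0 -hh => /sqr1_cases h1.
have hE c : h 0 0 = c -> val h = c%:M.
  by move=> hc; rewrite [LHS]SL2_cv h10 h01 -hh hc; apply: eq_mx2; rewrite !mxE.
case: h1 => /hE h1; [left | right]; rewrite gE.
  have -> : h = 1%g by apply: val_inj; rewrite h1.
  by rewrite mulg1 mulgV.
have -> : h = minus1 A by apply: val_inj; rewrite h1 minus1_val -[LHS]scalemx1 scaleN1r.
by rewrite -minus1C mulgK.
Qed.

End Triangles.

Lemma cycle_bd (C : complex) n (c : cycles C n.+1) : bd C n (val c) = 0.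
Proof. by apply/cyclepS; case: c. Qed.

Section Delta.
Variable A : comPzRingType.
Hypothesis A_universal : universal_GE2_ring A.

Local Notation K p := (nerve_complex (X_action A p)).
Local Notation act n g := (actf (X_action A n) g).
Local Notation del p := (hat (bd (X_complex A) p)).

Definition rp_class : {additive cycles (X_complex A) 2 -> RP A} := quo_pi _.

Lemma rp_classP q : exists c, q = rp_class c.
Proof. exact: quo_piP. Qed.

(* The connecting map H_1(SL_2, Z_1) -> H_0(SL_2, Z_2) = RP, as a relation. *)
Definition Delta (k : K 1%N 1%N) (q : RP A) : Prop :=
  exists (y : K 2%N 1%N) (c : cycles (X_complex A) 2),
  [/\ del 1 y = k, bd (K 2%N) 0 y = tens [tuple] (val c) & q = rp_class c].

Lemma DeltaB k q l r : Delta k q -> Delta l r -> Delta (k - l) (q - r).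
Proof.
move=> [y [c [<- yc ->]]] [z [d [<- zd ->]]]; exists (y - z), (c - d).
by rewrite !raddfB yc zd.
Qed.

Lemma Delta_total k : del 0 k = 0 -> bd (K 1%N) 0 k = 0 -> exists q, Delta k q.
Proof.
move=> k0 dk; have [y yE] := hat_exact (@X_exact1 A A_universal) k0.
have [z zE] := zero_chainP (a := X_action A 2) (bd (K 2%N) 0 y).
have zc : (z : X_complex A 2) \in @cyclep (X_complex A) 2.
  apply/(@cyclepS (X_complex A) 1); apply: (@tens_inj (0.-tuple (SL2 A)) _ [tuple]).
  by rewrite raddf0 -hat_tens -zE del_bd -yE.
by exists (rp_class (Cycle zc)), y, (Cycle zc).
Qed.

Lemma Delta_im k q : Delta k q -> Z_to_X_coinv A 2 q = 0.
Proof.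
move=> [y [c [_ yc ->]]]; rewrite [LHS]quo_map_pi; apply/quo_pi_eq0.
exact: bd0_coinv yc.
Qed.

Lemma Delta_surj q : Z_to_X_coinv A 2 q = 0 ->
  exists k, [/\ del 0 k = 0, bd (K 1%N) 0 k = 0 & Delta k q].
Proof.
have [c ->] := rp_classP q; rewrite [X in X = 0 -> _]quo_map_pi => /quo_pi_eq0 c0.
have [y yE] := coinv_bd0 (a := X_action A 2) c0.
exists (del 1 y); split; last by exists y, c.
  by apply: hat_comp0 => x; apply: (@bdK (X_complex A) 0).
rewrite -del_bd yE hat_tens; exact: etrans (congr1 (tens _) (cycle_bd c)) (raddf0 _).
Qed.

Lemma Delta_bd m : del 0 m = 0 -> Delta (bd (K 1%N) 1 m) 0.
Proof.
move=> m0; have [m2 ->] := hat_exact (@X_exact1 A A_universal) m0.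
by exists (bd (K 2%N) 1 m2), 0; rewrite del_bd bdK !raddf0.
Qed.

(** A lift of 0 has its coefficients in Z_2, so its boundary consists of relations g m - m with m in
    Z_2, not merely in X_2. *)
Lemma Delta_uniq q : Delta 0 q -> q = 0.
Proof.
move=> [y [c [/hat_ker[r [h [h0 yE]]] yc ->]]]; apply/quo_pi_eq0.
have hc t : (h t : X_complex A 2) \in @cyclep (X_complex A) 2.
  exact/(@cyclepS (X_complex A) 1).
have -> : c = \sum_(t <- r) (Z_act 2 (thead t)^-1%g (Cycle (hc t)) - Cycle (hc t)).
  apply: val_inj; apply: (@tens_inj (0.-tuple (SL2 A)) _ [tuple]).
  rewrite -yc yE !raddf_sum; apply: eq_bigr => t _.
  by rewrite {1}(tuple1E t) bd0_tens raddfB.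
by apply: rpred_sum => t _; apply: mem_spanp; exists (thead t)^-1%g, (Cycle (hc t)).
Qed.

Lemma Delta_minus1 y : Delta (tens [tuple minus1 A] (bd (X_complex A) 1 y)) 0.
Proof.
exists (tens [tuple minus1 A] y), 0; rewrite hat_tens; split; rewrite ?raddf0 //.
rewrite bd0_tens minus1V (_ : act 2 _ y = y) ?subrr ?raddf0 //.
by apply: freeg_map_id => s; apply: X_act_minus1.
Qed.

Hypothesis A_mu2 : forall x : mu2 A, x = 1 :> A \/ x = -1 :> A.

(** When the class in RP is 0, the lift y can be corrected by a chain with coefficients in Z_2 to a
    one-cycle over X_2. Such a cycle is carried by the stabilizers 1 and -1 of triangles. *)
Lemma Delta_ker k : Delta k 0 -> exists y m, del 0 m = 0 /\
  k = tens [tuple minus1 A] (bd (X_complex A) 1 y) + bd (K 1%N) 1 m.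
Proof.
move=> [y [c [<- yc /esym/quo_pi_eq0 c0]]].
have [l [l0 lE]] : exists l, del 1 l = 0 /\ bd (K 2%N) 0 l = tens [tuple] (val c).
  move: c c0 {yc}; apply: spanp_ind => [|x z [x' [x0 xE]] [z' [z0 zE]]|_ [g [m ->]]].
  - by exists 0; rewrite !raddf0.
  - by exists (x' - z'); rewrite !raddfB x0 z0 xE zE subrr.
  exists (tens [tuple g^-1%g] (val m)); rewrite hat_tens bd0_tens invgK; split=> //.
  exact: etrans (congr1 (tens _) (cycle_bd m)) (raddf0 _).
pose P (x : K 2%N 1%N) := exists z m, x = tens [tuple minus1 A] z + bd (K 2%N) 1 m.
have [z [m zE]] : P (y - l).
  apply: cycle1_stab; last by rewrite raddfB yc lE subrr.
  - exact: X_inf_zero (is_unit1 A).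
  - by exists 0, 0; rewrite !raddf0 addr0.
  - move=> x x' [z [m ->]] [z' [m' ->]]; exists (z - z'), (m - m').
    by rewrite !raddfB opprD addrACA.
  - by move=> m; exists 0, m; rewrite raddf0 add0r.
  move=> g s /(X_triangle_stab A_mu2)[->|->].
    exists 0, (tens [tuple 1%g; 1%g] << s >>).
    by rewrite raddf0 add0r -tensU (tens1 (X_action A 2)).
  by exists << s >>, 0; rewrite tensU raddf0 addr0.
exists z, (del 1 m); split; first by apply: hat_comp0 => x; apply: (@bdK (X_complex A) 0).
by rewrite -del_bd -hat_tens -raddfD -zE raddfB l0 subr0.
Qed.

End Delta.

(** * The exact sequence *)

Section Final.
Variable A : comPzRingType.
Hypothesis A_universal : universal_GE2_ring A.
Hypothesis A_nontrivial : (1 : A) <> 0.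
Hypothesis A_TB : forall i : nat, (i <= 3)%N ->
  bijective (group_homology_map (@T2_to_B2 A) i).
Hypothesis A_mu2 : forall x : mu2 A, x = 1 :> A \/ x = -1 :> A.

Local Notation K p := (nerve_complex (X_action A p)).
Local Notation act n g := (actf (X_action A n) g).
Local Notation del p := (hat (bd (X_complex A) p)).
Local Notation Rel := (Rel A_nontrivial).
Local Notation hyp g := (tens [tuple val g] (hyper A)).

Lemma Rel_hyper (g : SM2 A) m : del 0 m = 0 -> Rel 0 (hyp g + bd (K 1%N) 1 m).
Proof.
move=> m0; have [al alE] : exists al, Rel al (hyp g + bd (K 1%N) 1 m).
  apply: Rel_ex => //.
    by rewrite raddfD (del_tens _ (bd_hyper A)) del_bd m0 raddf0 addr0.
  rewrite raddfD bd0_tens (actfV_fix (hyper_act g)) subrr raddf0 add0r.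
  exact: bdK.
by rewrite -{1}(Rel_eq0 A_TB m0 alE).
Qed.

Lemma Rel_bd_eq0 al m : del 0 m = 0 -> Rel al (bd (K 1%N) 1 m) -> al = 0.
Proof.
move=> m0 h; have [m' [m'0 m'E]] := hyper_one A.
apply: (Rel_eq0 A_TB (g := 1%g) (m := m - m')) => //; first by rewrite raddfB m0 m'0 subrr.
by rewrite m'E raddfB addrC subrK.
Qed.

Lemma uneg1_double : uneg1 A + uneg1 A = 0.
Proof. by apply: uval_inj; rewrite uvalD uneg1E mulrNN mulr1. Qed.

Lemma rho_cases al k : Rel al k -> rho A k = 0 \/ rho A k = uneg1 A.
Proof.
move=> /Rel_cycle[k0 dk]; have /(congr1 (@uval A)) := rho_cycle k0 dk.
by rewrite uvalD => /(sqr1_cases A_mu2)[h|h]; [left | right]; apply: uval_inj;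
  rewrite h ?uneg1E.
Qed.

Lemma Rel_rho_total al : exists k, Rel al k /\ rho A k = 0.
Proof.
have [k kE] := Rel_total A_universal A_nontrivial al.
have [rk|rk] := rho_cases kE; first by exists k.
exists (k - hyp (weyl A)); split.
  rewrite -[al]subr0 -[hyp _]addr0 -(raddf0 (bd (K 1%N) 1)).
  by apply: RelB => //; apply: Rel_hyper; rewrite raddf0.
rewrite raddfB rk (@rho_hyper_anti _ _ 1 1) ?subrr ?mulr1 //.
Qed.

(** A subgroup of RP by [chi0] and [chiB]. By [Delta_sq] and [Delta_hyper_sq] its elements are
    precisely the psi_1(a^2), so sums of these need no separate treatment. *)
Definition chi (q : RP A) : Prop := exists t : SM2 A, rho A (hyp t) = 0 /\ Delta (hyp t) q.

Lemma chi0 : chi 0.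
Proof.
have [m [m0 mE]] := hyper_one A; exists 1%g; rewrite mE rho_bd; split=> //.
exact: Delta_bd.
Qed.

Lemma chiB q r : chi q -> chi r -> chi (q - r).
Proof.
move=> [t [t0 tq]] [u [u0 ur]]; have [m [m0 mE]] := hyper_div t u.
exists (t * u^-1)%g; have -> : hyp (t * u^-1)%g = hyp t - hyp u - bd (K 1%N) 1 m.
  by rewrite mE addrK.
rewrite !(raddfB (rho A)) t0 u0 rho_bd !subr0; split=> //.
rewrite -[q - r]subr0; apply: DeltaB; last exact: Delta_bd.
exact: DeltaB.
Qed.

Let p1 : X_complex A 2 := psi1_pair (is_unit1 A).

Lemma psi1_pair_diag (g : SL2 A) a b (ha : is_unit a) : a * b = 1 -> val g = mx2 a 0 0 b ->
  act 2 g^-1%g p1 = psi1_pair (is_unitX 2 ha).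
Proof.
move=> ab gE; have [gi gz] := diag_lines ab gE.
suff [h1 h2] : X_act_simplex g (X_inf_zero (is_unitX 2 ha)) = X_inf_zero (is_unit1 A) /\
    X_act_simplex g (X_zero_inf (is_unitX 2 ha)) = X_zero_inf (is_unit1 A).
  by rewrite /p1 /psi1_pair raddfD ![actf _ _ _]freeg_mapU -h1 -h2 /= -!X_act_simplexM
    mulVg !X_act_simplex1.
have gp : line (val g *m vec_pt (a ^+ 2)) = line (vec_pt 1).
  rewrite !vec_ptE gE mx2_cv; apply: (line_eqP ha); rewrite scale_cv.
  by congr cv; rewrite ?mul0r ?mulr0 ?mulr1 ?addr0 ?add0r // expr2 mulrA [b * a]mulrC ab mul1r.
by split; apply: X_act_triple.
Qed.

(** g sends the point b^2 to -1, so it matches the lift at b^2 with [p1] once -1 = 1. *)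
Lemma psi1_pair_anti (g : SL2 A) a b (hb : is_unit b) : a * b = 1 ->
  val g = mx2 0 a (- b) 0 -> uneg1 A = 0 ->
  act 2 g^-1%g p1 = psi1_pair (is_unitX 2 hb).
Proof.
move=> ab gE u0; have N1 : (-1 : A) = 1 by rewrite -uneg1E u0.
have ba : b * a = 1 by rewrite mulrC.
have [gi gz] := anti_lines ab gE.
suff [h1 h2] : X_act_simplex g (X_inf_zero (is_unitX 2 hb)) = X_zero_inf (is_unit1 A) /\
    X_act_simplex g (X_zero_inf (is_unitX 2 hb)) = X_inf_zero (is_unit1 A).
  by rewrite /p1 /psi1_pair raddfD !freeg_mapU /= -h1 -h2 -!X_act_simplexM
    mulVg !X_act_simplex1 addrC.
have gp : line (val g *m vec_pt (b ^+ 2)) = line (vec_pt 1).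
  rewrite !vec_ptE gE mx2_cv; apply: (line_eqP hb); rewrite scale_cv; congr cv.
    by rewrite mul0r add0r expr2 mulrA ab mul1r mulr1.
  by rewrite mul0r addr0 !mulr1 -[LHS]mulN1r N1 mul1r.
by split; apply: X_act_triple.
Qed.


(* SM_2 moves the parameter of the lift p1 of hyper by squares, up to sign. *)
Lemma Delta_hyper_sq (g : SM2 A) q : rho A (hyp g) = 0 -> Delta (hyp g) q ->
  exists a (ha : is_unit a), q = psi1 (is_unitX 2 ha).
Proof.
move=> g0 gq.
suff [a [ha E]] : exists a (ha : is_unit a), act 2 (val g)^-1%g p1 = psi1_pair (is_unitX 2 ha).
  exists a, ha; apply/eqP; rewrite -subr_eq0; apply/eqP; apply: Delta_uniq.
  rewrite -(subrr (hyp g)); apply: DeltaB => //.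
  exists (tens [tuple val g] p1), (psi1_cycle (is_unitX 2 ha)); split=> //.
    by rewrite hat_tens X_bd1_pair.
  by rewrite bd0_tens E.
have [a [b [ab [gE|gE]]]] := SM2P g.
  have ha : is_unit a by exists b.
  by exists a, ha; apply: psi1_pair_diag gE.
have hb : is_unit b by exists a; rewrite mulrC.
(* For antidiagonal g the value of rho is -1, so its vanishing forces -1 = 1. *)
exists b, hb; apply: (psi1_pair_anti _ ab gE).
by rewrite -(rho_hyper_anti ab gE).
Qed.

Lemma Delta_sq a (ha : is_unit a) : exists g : SM2 A,
  rho A (hyp g) = 0 /\ Delta (hyp g) (psi1 (is_unitX 2 ha)).
Proof.
have [b ab] := ha; have dg : a * b - 0 * 0 = 1 by rewrite mulr0 subr0.
pose g := SL2Mx (SL2_mx2_subproof dg).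
have gm : g \in @SL2_monomial A.
  by rewrite unfold_in; apply/asboolP; exists a, b; split=> //; left.
exists (MkSM2 gm); rewrite (@rho_hyper_diag _ _ a b) //; split=> //.
exists (tens [tuple g] p1), (psi1_cycle (is_unitX 2 ha)); split=> //.
  by rewrite hat_tens X_bd1_pair.
by rewrite bd0_tens (psi1_pair_diag (a := a) (b := b) ha).
Qed.

(* -1 is central, so that (-1) (x) z only depends on the class of z modulo SL_2. *)
Lemma minus1_act (g : SL2 A) z : bd (X_complex A) 0 z = 0 -> exists m,
  del 0 m = 0 /\ tens [tuple minus1 A] (act 1 g z) - tens [tuple minus1 A] z = bd (K 1%N) 1 m.
Proof.
move=> z0; have gz0 : bd (X_complex A) 0 (act 1 g z) = 0 by rewrite X_bd_act z0 raddf0.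
exists (tens [tuple minus1 A; (minus1 A * g)%g] (act 1 g z)
   - tens [tuple g; (minus1 A * g)%g] (act 1 g z)).
rewrite !raddfB !(del_tens _ gz0) subrr; split=> //; rewrite !nerve_bd1 mulKg minus1C mulKg.
rewrite -(actfM _ g^-1%g) mulVg actf1 minus1V (_ : act 1 (minus1 A) (act 1 g z) = act 1 g z).
  rewrite !opprD opprK !addrA [RHS](ACl ((3*4)*(1*6)*(5*2)))/=.
  by rewrite !subrr !addr0.
by apply: freeg_map_id => s; apply: X_act_minus1.
Qed.

Lemma minus1_double z : bd (X_complex A) 0 z = 0 -> exists m, del 0 m = 0 /\
  tens [tuple minus1 A] z + tens [tuple minus1 A] z = bd (K 1%N) 1 m.
Proof.
move=> z0; have mz : act 1 (minus1 A)^-1%g z = z.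
  by rewrite minus1V; apply: freeg_map_id => s; apply: X_act_minus1.
have mm : (minus1 A * minus1 A = 1)%g by rewrite -{2}minus1V mulgV.
have := tens_mul (minus1 A) mz; rewrite mm (tens1 (X_action A 1)).
move=> /eqP; rewrite eq_sym subr_eq => /eqP ->.
exists (tens [tuple 1%g; 1%g] z + tens [tuple minus1 A; 1%g] z).
by rewrite !raddfD !(del_tens _ z0) addr0.
Qed.

Lemma Rel_minus1 z : bd (X_complex A) 0 z = 0 -> exists al, Rel al (tens [tuple minus1 A] z).
Proof.
move=> z0; apply: Rel_ex => //; first exact: del_tens.
rewrite bd0_tens minus1V (_ : act 1 _ z = z) ?subrr ?raddf0 //.
by apply: freeg_map_id => s; apply: X_act_minus1.
Qed.

Lemma deg_freeg_map (S T : choiceType) (f : S -> T) x : deg (freeg_map f x) = deg x.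
Proof.
move: x; apply: freeg_ind => [|x y hx hy|s]; first by rewrite raddf0 !deg0.
  by rewrite (raddfB (freeg_map f)) !degB hx hy.
by rewrite freeg_mapU !degU.
Qed.

Definition gw_class : {additive cycles (X_complex A) 1 -> GW A} := quo_pi _.

(** SL_2 is transitive on edges, so the coinvariants of X_1 are Z through the degree. *)
Lemma fund_ideal_deg z : gw_class z \in kerp (Z_to_X_coinv A 1) <-> deg (val z) = 0.
Proof.
have deg0S x : x \in spanp (coinv_rel (fun g : SL2 A => X_act g 1%N)) -> deg x = 0.
  move: x; apply: spanp_ind => [|x y hx hy|_ [g [m ->]]]; first exact: deg0.
    by rewrite degB hx hy subrr.
  by rewrite degB [X in X - _]deg_freeg_map subrr.
have degS x : x - << edge_iz A >> *~ deg x \in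
    spanp (coinv_rel (fun g : SL2 A => X_act g 1%N)).
  move: x; apply: freeg_ind => [|x y hx hy|e].
  - by rewrite deg0 mulr0z subr0 rpred0.
  - by rewrite degB mulrzBr opprD opprK addrACA [- y + _]addrC -[X in _ + X]opprB rpredB.
  rewrite degU mulr1z; apply: mem_spanp; have [g gE] := X_edge_trans e.
  by exists g, << edge_iz A >>; rewrite -gE; congr (_ - _); apply/esym/freeg_mapU.
rewrite unfold_in /kerp [Z_to_X_coinv _ _ _]quo_map_pi.
split=> [/eqP/quo_pi_eq0/deg0S //|z0]; apply/eqP/quo_pi_eq0.
by have := degS (val z); rewrite z0 mulr0z subr0.
Qed.

Lemma phi_ex : exists phi : {additive fund_ideal A -> H_SL2_SM2 A 3},
  forall i z, val i = gw_class z -> Rel (phi i) (tens [tuple minus1 A] (val z)).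
Proof.
have [||al [z [z0 zR]]|phi phiE] := @rel_additive (fund_ideal A) (H_SL2_SM2 A 3)
    (fun i al => exists z, val i = gw_class z /\ Rel al (tens [tuple minus1 A] (val z))).
- move=> i; have [z zE] := quo_piP (val i).
  by have [al alE] := Rel_minus1 (cycle_bd z); exists al, z.
- move=> i al j be [z [zE zR]] [w [wE wR]]; exists (z - w).
  split; first by rewrite (raddfB gw_class) -zE -wE; apply: raddfB.
  by rewrite !raddfB; apply: RelB.
- have [m [m0 mE]] : exists m, del 0 m = 0 /\ tens [tuple minus1 A] (val z) = bd (K 1%N) 1 m.
    move/esym/quo_pi_eq0: z0 => {zR}; move: z; apply: spanp_ind.
    + by exists 0; rewrite !raddf0.
    + move=> x y [m [m0 mE]] [m' [m'0 m'E]]; exists (m - m').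
      by rewrite !raddfB m0 m'0 mE m'E subrr.
    move=> _ [g [w ->]]; have [m [m0 mE]] := minus1_act g (cycle_bd w).
    by exists m; split=> //; rewrite -mE !raddfB.
  by rewrite mE in zR; apply: Rel_bd_eq0 zR.
exists phi => i z zE; have [al alE] := Rel_minus1 (cycle_bd z).
have /phiE -> // : exists z, val i = gw_class z /\ Rel al (tens [tuple minus1 A] (val z)).
by exists z.
Qed.

Lemma Delta_RP1 k q : Delta k q -> exists q1 : RP1 A, val q1 = q.
Proof.
move=> /Delta_im q0; have qk : q \in kerp (Z_to_X_coinv A 2) by rewrite unfold_in /kerp q0.
by exists (Ker qk).
Qed.

Lemma RP1_Delta (q : RP1 A) : exists k, [/\ del 0 k = 0, bd (K 1%N) 0 k = 0 & Delta k (val q)].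
Proof. by case: q => q /= /eqP; apply: Delta_surj. Qed.

Definition mod_class : {additive RP1 A -> RP1_mod_psi1 A} := quo_pi _.

Lemma Rel0_Delta (k : K 1%N 1%N) (q : RP A) : Rel 0 k -> Delta k q -> exists g : SM2 A,
  Delta (hyp g) q /\ rho A (hyp g) = rho A k.
Proof.
move=> /(Rel0 A_universal)[g [m [m0 ->]]] kq; exists g; split; last first.
  by rewrite (raddfD (rho A)) rho_bd addr0.
rewrite -[hyp g](addrK (bd (K 1%N) 1 m)) -[q]subr0.
by apply: DeltaB => //; apply: Delta_bd.
Qed.

Lemma mod_map_ex : exists g : {additive H_SL2_SM2 A 3 -> RP1_mod_psi1 A},
  forall al r, g al = r <-> exists k (q : RP1 A),
    [/\ Rel al k, rho A k = 0, Delta k (val q) & r = mod_class q].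
Proof.
have [||r [k [q [kR k0 kq ->]]]|g gE] := @rel_additive (H_SL2_SM2 A 3) (RP1_mod_psi1 A)
  (fun al r => exists k (q : RP1 A),
    [/\ Rel al k, rho A k = 0, Delta k (val q) & r = mod_class q]).
- move=> al; have [k [kR k0]] := Rel_rho_total al.
  have [k1 k2] := Rel_cycle kR; have [q kq] := Delta_total A_universal k1 k2.
  by have [q1 q1E] := Delta_RP1 kq; exists (mod_class q1), k, q1; rewrite q1E.
- move=> al r be s [k [q [kR k0 kq ->]]] [l [u [lR l0 lu ->]]].
  exists (k - l), (q - u); rewrite !raddfB k0 l0 subrr; split=> //.
    exact: RelB.
  exact: DeltaB.
- have [g [gq g0]] := Rel0_Delta kR kq; rewrite k0 in g0.
  have [a [ha qE]] := Delta_hyper_sq g0 gq.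
  by apply/quo_pi_eq0/mem_spanp; exists a, ha; apply: val_inj.
by exists g => al r; split=> /gE.
Qed.

Lemma int_half (d : int) : exists l : int, d = l + l \/ d = l + l + 1.
Proof.
case: d => n; have := odd_double_half n => hn.
  by exists (n./2 : int); move: hn; case: (odd n) => /= h; [right | left]; lia.
by exists (- (n./2.+1 : int)); move: hn; case: (odd n) => /= h; [left | right]; lia.
Qed.

Lemma uneg1_even d : uneg1 A <> 0 -> uneg1 A *~ d = 0 -> exists l : int, d = l + l.
Proof.
move=> u0; have [l [->|->]] := int_half d; first by exists l.
by rewrite !mulrzDr -mulrzDl uneg1_double mul0rz add0r mulr1z => /u0.
Qed.

Let t1 : X_complex A 2 := << X_inf_zero (is_unit1 A) >>.
(** An element of Z_1 of degree 1. The chain (-1) (x) s1 has rho = -1 and is killed by [Delta], so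
    subtracting it corrects rho without changing the image in RP. *)
Let s1 : X_complex A 1 := bd (X_complex A) 1 t1.

Lemma deg_s1 : deg s1 = 1.
Proof. by rewrite /s1 X_bd1_inf_zero degD degB !degU. Qed.

Lemma bd_s1 : bd (X_complex A) 0 s1 = 0.
Proof. exact: bdK. Qed.

Lemma RelD al be k l : Rel al k -> Rel be l -> Rel (al + be) (k + l).
Proof.
move=> hk hl; have h0 := RelB hk hk; rewrite !subrr in h0.
by have := RelB hk (RelB h0 hl); rewrite !sub0r !opprK.
Qed.

Lemma minus1_one : uneg1 A = 0 -> minus1 A = 1%g.
Proof.
move=> u0; apply: val_inj; rewrite minus1_val -scaleN1r.
by rewrite -uneg1E u0 uval0 scale1r.
Qed.

Lemma chi_span (q : RP1 A) : mod_class q = 0 -> chi (val q).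
Proof.
move=> /quo_pi_eq0; move: q; apply: spanp_ind => [|x y|_ [a [ha ->]]].
- exact: chi0.
- exact: chiB.
exact: Delta_sq.
Qed.

(** Modulo h (x) t and a boundary, k is (-1) (x) z with z the boundary of y. If -1 <> 1, vanishing
    of rho makes the degree of z even, and z can be moved into I(A). If -1 = 1, the chain (-1) (x) z
    is itself a boundary. *)
Lemma Rel_phi_eq (phi : {additive fund_ideal A -> H_SL2_SM2 A 3}) :
  (forall i z, val i = gw_class z -> Rel (phi i) (tens [tuple minus1 A] (val z))) ->
  forall al k (t : SM2 A), Rel al k -> rho A k = 0 -> rho A (hyp t) = 0 -> Delta (k - hyp t) 0 ->
  al = 0 \/ uneg1 A <> 0 /\ exists i, al = phi i.
Proof.
move=> phiE al k t kR k0 t0 /(Delta_ker A_mu2)[y [m [m0 /eqP]]].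
rewrite subr_eq => /eqP kE.
have [u0|u0] := pselect (uneg1 A = 0).
  left; move: kR; rewrite kE (minus1_one u0) (tens1 (X_action A 1)) -raddfD addrC.
  by apply: Rel_eq0 => //; rewrite raddfD m0 del_tens ?addr0 //; apply: bdK.
have [|l lE] := uneg1_even (d := deg (bd (X_complex A) 1 y)) u0.
  by have := congr1 (rho A) kE; rewrite k0 !(raddfD (rho A)) rho_minus1 rho_bd t0 !addr0.
right; split=> //.
(* The boundary of y has degree 2 l and that of [t1] has degree 1. The part removed appears twice,
   so it contributes only a boundary by [minus1_double]. *)
pose y' := t1 *~ l; pose y0 : X_complex A 2 := y - (y' + y').
have dy0 : deg (bd (X_complex A) 1 y0) = 0.
  rewrite /y0 raddfB degB lE raddfD degD /y' raddfMz.
  by rewrite (raddfMz (@deg _)) /= deg_s1 intz subrr.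
have cy0 : bd (X_complex A) 1 y0 \in @cyclep (X_complex A) 1 by apply: cyclep_bd.
pose i := Ker ((fund_ideal_deg (Cycle cy0)).2 dy0); exists i.
have iR := phiE i (Cycle cy0) erefl.
have [|m' [m'0 m'E]] := @minus1_double (bd (X_complex A) 1 y'); first exact: bdK.
apply/eqP; rewrite -subr_eq0; apply/eqP.
have := RelB kR iR; rewrite kE.
have e0 : tens [tuple minus1 A] (bd (X_complex A) 1 y0) =
    tens [tuple minus1 A] (bd (X_complex A) 1 y) - bd (K 1%N) 1 m'.
  have -> : bd (X_complex A) 1 y0 =
      bd (X_complex A) 1 y - (bd (X_complex A) 1 y' + bd (X_complex A) 1 y').
    by apply: etrans (raddfB _ _ _) _; congr (_ - _); apply: raddfD.
  by apply: etrans (raddfB _ _ _) _; congr (_ - _); apply: etrans (raddfD _ _ _) m'E.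
have -> : tens [tuple minus1 A] (bd (X_complex A) 1 y) + bd (K 1%N) 1 m + hyp t -
    tens [tuple minus1 A] (val (Cycle cy0)) = hyp t + bd (K 1%N) 1 (m + m').
  rewrite [X in _ - X]e0 (raddfD (bd _ 1)) opprB.
  set p := tens _ (bd _ _ y); set q := hyp t.
  by rewrite !addrA [LHS](ACl (3*2*4*(1*5)))/= subrr addr0.
by apply: Rel_eq0 => //; rewrite raddfD m0 m'0 addr0.
Qed.

Lemma mu2_cases (x : mu2 A) : x = 0 \/ val x = -1.
Proof. by case: (A_mu2 x) => h; [left; apply: val_inj | right]. Qed.

Lemma mu2_val0 : val (0 : mu2 A) = 1. Proof. by []. Qed.

(** mu_2 has at most two elements, so linearity in the second variable amounts to 2 phi = 0. If -1 =
    1 the tensor product is 0, hence the condition in the last clause. *)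
Lemma tensor_map_ex (phi : {additive fund_ideal A -> H_SL2_SM2 A 3}) :
  (forall i, phi i + phi i = 0) ->
  exists f : {additive tensor (fund_ideal A) (mu2 A) -> H_SL2_SM2 A 3},
    (forall al, (exists x, f x = al) -> exists i, al = phi i) /\
    (uneg1 A <> 0 -> forall i, exists x, f x = phi i).
Proof.
move=> phi2.
pose F : {additive {freeg (fund_ideal A * mu2 A)} -> H_SL2_SM2 A 3} :=
  flift (fun p => if p.2 == 0 then 0 else phi p.1).
have FU i x : F << (i, x) >> = if x == 0 then 0 else phi i by apply: fliftU.
have F0 x : x \in spanp (@tensor_rel (fund_ideal A) (mu2 A)) -> F x = 0.
  move: x; apply: spanp_ind => [|x y hx hy|_ [[x [y [z ->]]]|[x [y [z ->]]]]].
  - exact: raddf0.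
  - by rewrite raddfB hx hy subrr.
  - rewrite !raddfB !FU; case: eqP => _; first by rewrite !subr0.
    by rewrite raddfD addrAC addrK subrr.
  rewrite !raddfB !FU; have [->|y1] := mu2_cases y.
    by rewrite add0r eqxx subr0 subrr.
  have [->|z1] := mu2_cases z; first by rewrite addr0 eqxx subrr subr0.
  have -> : y + z = 0 by apply: val_inj; rewrite [LHS](_ : _ = val y * val z) // y1 z1 mulrNN mulr1.
  rewrite eqxx; have -> : z = y by apply: val_inj; rewrite y1 z1.
  case: eqP => _; first by rewrite !subr0.
  by rewrite sub0r -opprD phi2 oppr0.
have FE x : exists i, F x = phi i.
  move: x; apply: freeg_ind => [|x y [i hx] [j hy]|[i x]].
  - by exists 0; rewrite !raddf0.
  - by exists (i - j); rewrite !raddfB hx hy.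
  by rewrite FU; case: eqP => _; [exists 0; rewrite raddf0 | exists i].
have [||al [x [/esym/quo_pi_eq0 x0 <-]]|f fE] :=
    @rel_additive (tensor (fund_ideal A) (mu2 A)) (H_SL2_SM2 A 3)
      (fun t al => exists x, t = quo_pi _ x /\ F x = al).
- by move=> t; have [x ->] := quo_piP t; exists (F x), x.
- by move=> t al u be [x [-> <-]] [y [-> <-]]; exists (x - y); rewrite !raddfB.
- exact: F0.
exists f; split=> [al [t /fE[x [_ <-]]] // | u0 i].
have m1 : (-1 : A) ^+ 2 == 1 by rewrite sqrrN expr1n.
exists (quo_pi _ << (i, Mu2 m1) >>); apply/fE; exists << (i, Mu2 m1) >>; split=> //.
rewrite FU; case: eqP => // /(congr1 val); rewrite mu2_val0 /= => N1.
by case: u0; apply: uval_inj; rewrite uneg1E N1.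
Qed.

Theorem exact_sequence : exists
    (f : {additive tensor (fund_ideal A) (mu2 A) -> H_SL2_SM2 A 3})
    (g : {additive H_SL2_SM2 A 3 -> RP1_mod_psi1 A}),
  exact_at f g /\ (forall z, exists y, g y = z).
Proof.
have [phi phiE] := phi_ex; have [g gE] := mod_map_ex.
have phi2 i : phi i + phi i = 0.
  have [z zE] := quo_piP (val i); have R := phiE i z zE.
  have [m [m0 mE]] := minus1_double (cycle_bd z).
  by apply: (Rel_bd_eq0 m0); rewrite -mE; apply: RelD.
have [f [f1 f2]] := tensor_map_ex phi2; exists f, g; split=> [al|r].
  split=> [/gE[k [q [kR k0 kq /esym q0]]]|/f1[i ->]].
    have [t [t0 tq]] := chi_span q0.
    have kt : Delta (k - hyp t) 0 by rewrite -(subrr (val q)); apply: DeltaB.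
    have [->|[u0 [i ->]]] := Rel_phi_eq phiE kR k0 t0 kt; first by exists 0; rewrite raddf0.
    exact: f2.
  have [z zE] := quo_piP (val i); apply/gE.
  exists (tens [tuple minus1 A] (val z)), 0; split; last by rewrite raddf0.
  - exact: phiE.
  - by rewrite rho_minus1 (fund_ideal_deg z).1 ?mulr0z //; rewrite -[gw_class z]zE; case: (i).
  have [y ->] := X_exact1 A_universal (cycle_bd z); exact: Delta_minus1.
have [q ->] := quo_piP r; have [k [k0 dk kq]] := RP1_Delta q.
have [al alR] := Rel_ex A_nontrivial A_TB k0 dk.
have [rk|rk] := rho_cases alR; first by exists al; apply/gE; exists k, q.
have [be beR] := Rel_minus1 bd_s1; exists (al - be); apply/gE.
exists (k - tens [tuple minus1 A] s1), q; split=> //.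
- exact: RelB.
- by rewrite raddfB rho_minus1 deg_s1 mulr1z rk subrr.
by rewrite -[val q]subr0; apply: DeltaB => //; apply: Delta_minus1.
Qed.

(** * The case where -1 is a square *)

Section SquareRoot.
Variable b : A.
Hypothesis b2 : -1 = b ^+ 2.

Lemma swap_subproof (a a' : A) (aa' : a * a' = 1) : 0 * 0 - (b * a') * (b * a) = 1.
Proof. by rewrite mulr0 sub0r mulrACA -expr2 -b2 [a' * a]mulrC aa' mulr1 opprK. Qed.

Lemma swap_monomial (a a' : A) (aa' : a * a' = 1) :
  SL2Mx (SL2_mx2_subproof (swap_subproof aa')) \in @SL2_monomial A.
Proof.
rewrite unfold_in; apply/asboolP; exists (b * a'), (- (b * a)); split.
  by rewrite mulrN mulrACA -expr2 -b2 [a' * a]mulrC aa' mulr1 opprK.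
by right; rewrite opprK.
Qed.

(* A square root of -1 in SL_2 exchanging oo and 0 and fixing the point a. *)
Definition swap_at (a a' : A) (aa' : a * a' = 1) : SM2 A := MkSM2 (swap_monomial aa').

(** For w = [swap_at aa'] one has w^2 = -1 and h = w^-1 z + z. The boundary of (w, w^2; z) is w (x)
    w^-1 z - (-1) (x) z + w (x) z, that is w (x) h - (-1) (x) z. *)
Lemma swap_hyper (a a' : A) (aa' : a * a' = 1) (ha : is_unit a) : exists m, del 0 m = 0 /\
  tens [tuple minus1 A] (bd (X_complex A) 1 << X_inf_zero ha >>) =
  hyp (swap_at aa') + bd (K 1%N) 1 m.
Proof.
pose w : SL2 A := val (swap_at aa').
have wE : val w = mx2 0 (b * a') (b * a) 0 by [].
have wm : b * a' * - (b * a) = 1.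
  by rewrite mulrN mulrACA -expr2 -b2 [a' * a]mulrC aa' mulr1 opprK.
have [wi wz] : line (val w *m vec_inf A) = line (vec_zero A) /\
    line (val w *m vec_zero A) = line (vec_inf A).
  by apply: (anti_lines wm); rewrite opprK.
have ub : is_unit b.
  by exists (- b); rewrite mulrN -expr2 -b2 opprK.
have wp : line (val w *m vec_pt a) = line (vec_pt a).
  rewrite vec_ptE wE mx2_cv; apply: (line_eqP ub); rewrite scale_cv.
  by congr cv; rewrite ?mul0r ?add0r ?addr0 ?mulr1 // -mulrA [a' * a]mulrC aa' mulr1.
have ww : (w * w)%g = minus1 A.
  apply: val_inj; rewrite SL2_valM wE mx2_mul /=; congr mx2;
    rewrite ?(mul0r, mulr0, add0r, addr0) // mulrACA -expr2 -b2 ?[a' * a]mulrC aa' mulr1 //.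
have wt : X_act_simplex w (X_zero_inf ha) = X_inf_zero ha by apply: X_act_triple.
set z := bd (X_complex A) 1 << X_inf_zero ha >>.
have zw : act 1 w^-1%g z + z = hyper A.
  rewrite /hyper -(X_bd1_pair ha) /psi1_pair raddfD addrC; congr (_ + _).
  rewrite -X_bd_act; apply: (congr1 (bd (X_complex A) 1)); rewrite actU.
  by congr << _ >>; apply: act_eqV.
have z0 : bd (X_complex A) 0 z = 0 by apply: bdK.
exists (- tens [tuple w; (w * w)%g] z).
rewrite raddfN (del_tens _ z0) oppr0; split=> //; rewrite raddfN nerve_bd1 mulKg ww.
rewrite -/w -zw raddfD; set p := tens _ z; set q := tens _ z; set r := tens _ _.
by rewrite opprD opprB !addrA [RHS](ACl (3*(1*4)*(2*5)))/= !subrr !addr0.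
Qed.

(** Since b^2 = -1, the equations b a' = x and b a = -y are solved by a' = -b x and a = b y. *)
Lemma anti_swap (g : SM2 A) (x y : A) : x * y = 1 -> val (val g) = mx2 0 x (- y) 0 ->
  exists a a' (aa' : a * a' = 1), g = swap_at aa'.
Proof.
move=> xy gE; have aa' : (b * y) * - (b * x) = 1.
  by rewrite mulrN mulrACA -expr2 -b2 [y * x]mulrC xy mulr1 opprK.
exists (b * y), (- (b * x)), aa'; apply: val_inj; apply: val_inj; rewrite gE /=.
by congr mx2; rewrite ?mulrN mulrA -expr2 -b2 mulN1r ?opprK.
Qed.

(** For antidiagonal g, [swap_hyper] turns h (x) g into some (-1) (x) z with z a boundary. A
    diagonal g is the quotient of the antidiagonal g weyl by weyl. *)
Lemma Delta_hyper0 (g : SM2 A) : Delta (hyp g) 0.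
Proof.
have anti (h : SM2 A) (x y : A) : x * y = 1 -> val (val h) = mx2 0 x (- y) 0 -> Delta (hyp h) 0.
  move=> xy /(anti_swap xy)[a [a' [aa' ->]]]; have ha : is_unit a by exists a'.
  have [m [m0 mE]] := swap_hyper aa' ha.
  rewrite -[hyp _](addrK (bd (K 1%N) 1 m)) -mE -[0]subr0.
  by apply: DeltaB; [apply: Delta_minus1 | apply: Delta_bd].
have [x [y [xy [gE|gE]]]] := SM2P g; last exact: anti gE.
have [m [m0 mE]] := hyper_div (g * weyl A)%g (weyl A); rewrite mulgK in mE.
rewrite -[hyp g](addrK (bd (K 1%N) 1 m)) -mE -[0]subr0; apply: DeltaB; last exact: Delta_bd.
rewrite -[0]subr0; apply: DeltaB; last by apply: (anti _ 1 1); rewrite ?mulr1.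
apply: (anti _ x y) => //; rewrite [LHS](_ : _ = val (val g) *m val (val (weyl A))) //.
by rewrite gE mx2_mul; congr mx2; rewrite ?mulr0 ?mul0r ?mulr1 ?addr0 ?add0r ?mulrN1.
Qed.

Lemma minus1_hyper y : exists (g : SM2 A) m, del 0 m = 0 /\
  tens [tuple minus1 A] (bd (X_complex A) 1 y) = hyp g + bd (K 1%N) 1 m.
Proof.
move: y; apply: freeg_ind => [|x y [g [m [m0 hx]]] [h [n [n0 hy]]]|s].
- have [m [m0 mE]] := hyper_one A; exists 1%g, (- m).
  by rewrite !raddfN m0 oppr0 !raddf0 mE subrr.
- have [m1 [m10 m1E]] := hyper_div g h; exists (g * h^-1)%g, (m1 + (m - n)).
  rewrite !raddfD !raddfN m0 n0 m10 oppr0 !addr0; split=> //.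
  by rewrite hx hy opprD addrACA m1E -addrA [in LHS]/hyper raddfD.
have [g [a [ha <-]]] := X_triangle_trans s; have [a' aa'] := ha.
set t := << X_inf_zero ha >> : X_complex A 2.
have [m [m0 mE]] := swap_hyper aa' ha.
have z0 : bd (X_complex A) 0 (bd (X_complex A) 1 t) = 0 by apply: bdK.
have [n [n0 nE]] := minus1_act g z0.
exists (swap_at aa'), (n + m); split; first by rewrite raddfD n0 m0 addr0.
have -> : bd (X_complex A) 1 << X_act_simplex g (X_inf_zero ha) >> =
    act 1 g (bd (X_complex A) 1 t) by rewrite -X_bd_act actU.
by rewrite (raddfD (bd _ 1)) -nE addrCA -mE subrK.
Qed.

(** By [Delta_hyper0] any representative k of a class may be used to define the map. It is injective
    because the kernel of [Delta], made of chains (-1) (x) z, consists of classes h (x) g by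
    [minus1_hyper]. *)
Theorem RP1_iso : exists h : {additive H_SL2_SM2 A 3 -> RP1 A}, bijective h.
Proof.
have [||q [k [kR kq]]|h hE] := @rel_additive (H_SL2_SM2 A 3) (RP1 A)
    (fun al q => exists k, Rel al k /\ Delta k (val q)).
- move=> al; have [k kR] := Rel_total A_universal A_nontrivial al.
  have [k1 k2] := Rel_cycle kR; have [q kq] := Delta_total A_universal k1 k2.
  by have [q1 q1E] := Delta_RP1 kq; exists q1, k; rewrite q1E.
- move=> al q be r [k [kR kq]] [l [lR lr]]; exists (k - l).
  by split; [apply: RelB | apply: DeltaB].
- have [g [gq _]] := Rel0_Delta kR kq; apply: val_inj.
  rewrite -[val q]subr0; apply: Delta_uniq; rewrite -(subrr (hyp g)).
  by apply: DeltaB => //; apply: Delta_hyper0.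
exists h.
have hI : injective h.
  move=> al be ab; apply/eqP; rewrite -subr_eq0; apply/eqP.
  have /hE[k [kR k0]] : h (al - be) = 0 by rewrite raddfB ab subrr.
  have [y [m [m0 kE]]] := Delta_ker A_mu2 k0; have [g [n [n0 nE]]] := minus1_hyper y.
  move: kR; rewrite kE nE -addrA -raddfD; apply: Rel_eq0 => //.
  by rewrite raddfD n0 m0 addr0.
have hS q : exists al, h al = q.
  have [k [k0 dk kq]] := RP1_Delta q; have [al alR] := Rel_ex A_nontrivial A_TB k0 dk.
  by exists al; apply/hE; exists k.
have /choice[h' h'K] := hS; exists h' => // al; exact: hI.
Qed.

End SquareRoot.

End Final.

(** * The zero ring *)

Section TrivialRing.
Variable A : comPzRingType.
Hypothesis A_trivial : (1 : A) = 0.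

Lemma trivial_SL2 (g h : SL2 A) : g = h.
Proof.
have A0 (x : A) : x = 0 by rewrite -[x]mulr1 A_trivial mulr0.
by apply: val_inj; apply/matrixP => i j; rewrite [LHS]A0 [RHS]A0.
Qed.

(** SL_2 is trivial, so every chain of SL_2 comes from SM_2. *)
Lemma trivial_homology (al : H_SL2_SM2 A 3) : al = 0.
Proof.
have [x] := rel_class_total al.
have [x' ->] : exists x', x = point_map (SM2_incl A) 3 x'.
  move: x; apply: freeg_ind => [|x y [x' ->] [y' ->]|[t []]].
  - by exists 0; rewrite raddf0.
  - by exists (x' - y'); rewrite raddfB.
  exists << ([tuple 1%g | i < 3], tt) >>; rewrite nerve_mapU.
  by rewrite (equiv_nmap (trivial_action _)); congr << (_, _) >>;
    apply: eq_from_tnth => i; apply: trivial_SL2.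
rewrite (_ : point_map (SM2_incl A) 3 x' =
  bd (point_complex (SL2 A)) 3 0 + point_map (SM2_incl A) 3 x').
  exact: rel_class_eq0.
by rewrite raddf0 add0r.
Qed.

Lemma trivial_RP1 (q : RP1 A) : q = 0.
Proof.
have [k [_ _ [y [c [_ yc qE]]]]] := RP1_Delta q.
apply: val_inj; rewrite [LHS]qE (_ : c = 0) ?raddf0 //.
apply: val_inj; apply: (@tens_inj (0.-tuple (SL2 A)) _ [tuple]); rewrite -yc raddf0.
move: y {yc}; apply: tens_ind => [|x y hx hy|t x]; first by rewrite raddf0.
  by rewrite raddfB hx hy subrr.
by rewrite (tuple1E t) bd0_tens (trivial_SL2 (thead t)^-1%g 1%g) actf1 subrr raddf0.
Qed.

End TrivialRing.

Theorem theorem8p2 (A : comPzRingType)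
  (A_universal : universal_GE2_ring A)
  (A_mu2 : forall x : mu2 A, x = 1 :> A \/ x = -1 :> A)
  (A_TB : forall i : nat, (i <= 3)%N ->
     bijective (group_homology_map (@T2_to_B2 A) i)) :
  (exists (f : {additive tensor (fund_ideal A) (mu2 A) -> H_SL2_SM2 A 3})
          (g : {additive H_SL2_SM2 A 3 -> RP1_mod_psi1 A}),
     exact_at f g /\ (forall z, exists y, g y = z))
  /\
  ((exists2 b : A, is_unit b & -1 = b ^+ 2) ->
   exists h : {additive H_SL2_SM2 A 3 -> RP1 A}, bijective h).
Proof.
(* The comparison of SM_2 acting on [bool] with SL_2 acting on lines requires oo and 0 to be
   distinct, that is 1 <> 0. *)
have [A0|A1] := pselect ((1 : A) = 0); last first.
  split; first exact: exact_sequence.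
  by move=> [b _ b2]; apply: (RP1_iso A_universal A1 A_TB A_mu2 b2).
split=> [|_].
  exists \0, \0; split=> [al|z].
    by split=> // _; exists 0; rewrite [RHS]trivial_homology // raddf0.
  by have [q ->] := quo_piP z; exists 0; rewrite (trivial_RP1 A0 q) !raddf0.
exists \0; exists (fun _ => 0) => x.
  by rewrite [RHS]trivial_homology.
by rewrite [RHS]trivial_RP1 // raddf0.
Qed.
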